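(* Let $\mathfrak A$ be a unital and simple $C^*$-algebra. Then every separable $\mathfrak A$-$C^*$-algebra $A$, whose action satisfies $(a\cdot\alpha)^*=a^*\cdot\alpha^*$ for all $a\in A$, $\alpha\in\mathfrak A$, and which has finite $\mathfrak A$-module decomposition rank, ${\rm dr}_{\mathfrak A}(A)<\infty$, is $\mathfrak A$-quasidiagonal.
   Context: An $\mathfrak A$-$C^*$-algebra is a $C^*$-algebra $A$ that is a right Banach $\mathfrak A$-module with contractive action such that $(ab)\cdot\alpha=a(b\cdot\alpha)$ and $a\cdot(\alpha\beta)=(a\cdot\alpha)\cdot\beta$. A module map is a continuous linear map preserving the right $\mathfrak A$-action. $\mathbb M_n(\mathfrak A)$ and $F\otimes\mathfrak A$ ($F$ a finite dimensional $C^*$-algebra) carry the action $(t\otimes\beta)\cdot\alpha=t\otimes\beta\alpha$. C.p. means completely positive, c.c.p. contractive completely positive. Admissible maps: the class of admissible c.p. maps is determined by the following rules. (i) A c.p. module map is admissible. (ii) If a c.p. map $\phi:A\to B$ is admissible, so are $x\mapsto\phi(uxu^* )$ and $x\mapsto v\phi(x)v^*$ for $u\in A$, $v\in B$. (iii) C.p. maps $\phi:A\to B$ of the form $\phi(x)=\rho(x)u$, $\rho\in A^*_+$, $u\in B_+$, are admissible. (iv) Compositions, positive multiples and finite sums of admissible c.p. maps are admissible. Approximate order zero: for $K\subseteq A_1$ (the closed unit ball) norm compact and $\varepsilon>0$, a c.c.p. map $\varphi:A\to B$ is $(\varepsilon,K)$-order 0 if for each $\delta>0$ and $a,b\in K$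 with $\|ab\|<\delta$ there are $a',b'\in A$ within $\frac\delta2$ of $a,b$ respectively with $\|\varphi(a')\varphi(b')\|<\varepsilon$. Module decomposition rank: ${\rm dr}_{\mathfrak A}(A)\le n$ if for every finite set $\mathcal F\subset A$ and $\varepsilon>0$ there are a finite dimensional $C^*$-algebra $F$, a c.c.p. admissible map $\psi:A\to F\otimes\mathfrak A$, and a nonempty set $\mathcal G$ of c.c.p. module maps $\varphi:F\otimes\mathfrak A\to A$ such that $\|\varphi\circ\psi(a)-a\|<\varepsilon$ for $a\in\mathcal F$, $\varphi\in\mathcal G$, and $F$ decomposes into $n+1$ ideals $F=F^{(0)}\oplus\cdots\oplus F^{(n)}$ such that for each $i=0,\dots,n$, any compact $K_i\subseteq(F^{(i)}\otimes\mathfrak A)_1$ and any $\varepsilon_i>0$, there is $\varphi\in\mathcal G$ whose restriction $\varphi^{(i)}:F^{(i)}\otimes\mathfrak A\to A$ is $(\varepsilon_i,K_i)$-order 0. ${\rm dr}_{\mathfrak A}(A)$ is the least such $n$ (or $\infty$). $\mathfrak A$-quasidiagonal: there is a net of admissible c.c.p. maps $\phi_n:A\to\mathbb M_{k(n)}(\mathfrak A)$ with $\|\phi_n(ab)-\phi_n(a)\phi_n(b)\|\to0$ and $\|\phi_n(a)\|\to\|a\|$ for all $a,b\in A$.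
   Formalization: In the definition of module decomposition rank, one map φ in 𝒢 must be (ε_i,K_i)-order 0 on all blocks i=0,…,n at once; if φ could depend on i, every nuclear algebra (e.g. O_2 with 𝔄=ℂ) would have rank at most 1 and the claim would fail. *)

(* Defs.v *)
From HB Require Import structures.
From mathcomp Require Import all_boot all_order all_algebra.
From mathcomp Require Import complex.
From mathcomp Require Import all_classical all_reals all_analysis.

Set Implicit Arguments.
Unset Strict Implicit.
Unset Printing Implicit Defensive.

Import Order.TTheory GRing.Theory Num.Theory.
Import numFieldNormedType.Exports.

Local Open Scope classical_set_scope.
Local Open Scope ring_scope.
Local Open Scope complex_scope.

(* C*-algebras need not be unital and MathComp's rings are, so the product is
   part of the mixin.  Norms take values in the complex field R[i]; [0 < e] in
   R[i] says that e is a positive real. *)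
HB.mixin Record CompleteNormedModule_isCstarAlgebra (R : realType) A
    of CompleteNormedModule R[i] A := {
  cmul : A -> A -> A ;
  cstar : A -> A ;
  cmulA : forall a b c, cmul a (cmul b c) = cmul (cmul a b) c ;
  cmul_linearl : forall b (z : R[i]) a1 a2,
    cmul (z *: a1 + a2) b = z *: cmul a1 b + cmul a2 b ;
  cmul_linearr : forall a (z : R[i]) b1 b2,
    cmul a (z *: b1 + b2) = z *: cmul a b1 + cmul a b2 ;
  cstar_antilinear : forall (z : R[i]) a1 a2,
    cstar (z *: a1 + a2) = z^* *: cstar a1 + cstar a2 ;
  cstarM : forall a b, cstar (cmul a b) = cmul (cstar b) (cstar a) ;
  cstarK : involutive cstar ;
  cmul_norm : forall a b, `|cmul a b| <= `|a| * `|b| ;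
  cstar_identity : forall a, `|cmul (cstar a) a| = `|a| ^+ 2 }.

#[short(type="cstarAlgType")]
HB.structure Definition CstarAlgebra (R : realType) :=
  {A of CompleteNormedModule_isCstarAlgebra R A & CompleteNormedModule R[i] A}.

(* The 𝔄-C*-algebras: neither [act a 1 = a] for unital 𝔄 nor compatibility of
   the action with the involution is part of the notion. *)
HB.mixin Record CstarAlgebra_isCstarModule (R : realType) (U : cstarAlgType R) A
    of CstarAlgebra R A := {
  act : A -> U -> A ;
  act_linearl : forall u (z : R[i]) a b,
    act (z *: a + b) u = z *: act a u + act b u ;
  act_linearr : forall a (z : R[i]) u v,
    act a (z *: u + v) = z *: act a u + act a v ;
  act_norm : forall a u, `|act a u| <= `|a| * `|u| ;
  act_mull : forall a b u, act (cmul a b) u = cmul a (act b u) ;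
  act_mulr : forall a u v, act a (cmul u v) = act (act a u) v }.

#[short(type="cstarModType")]
HB.structure Definition CstarModule (R : realType) (U : cstarAlgType R) :=
  {A of CstarAlgebra_isCstarModule R U A & CstarAlgebra R A}.

Section CstarBasics.
Variable R : realType.
Implicit Types A B F : cstarAlgType R.

Definition unital A : Prop :=
  exists e : A, forall a : A, cmul e a = a /\ cmul a e = a.

Definition closed_ideal A (I : set A) : Prop :=
  [/\ closed I, I 0,
      (forall (z : R[i]) a b, I a -> I b -> I (z *: a + b)),
      (forall x a, I a -> I (cmul x a)) &
      (forall x a, I a -> I (cmul a x))].

Definition simple_cstar A : Prop :=
  (exists a : A, a != 0) /\
  forall I : set A, closed_ideal I -> I = [set 0] \/ I = setT.

Definition separable_cstar A : Prop :=
  exists S : set A, countable S /\ dense S.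

Definition finite_dim A : Prop :=
  exists (m : nat) (e : 'I_m -> A),
    forall x, exists c : 'I_m -> R[i], x = \sum_j c j *: e j.

Definition cpos A (a : A) : Prop := exists x : A, a = cmul (cstar x) x.

(* Product and involution of M_n(A). *)
Definition mxcmul A n (M N : 'M[A]_n) : 'M[A]_n :=
  \matrix_(i, j) \sum_k cmul (M i k) (N k j).

Definition mxcstar A n (M : 'M[A]_n) : 'M[A]_n :=
  \matrix_(i, j) cstar (M j i).

(* The positive elements of M_n(A) are the N^* N, so no norm on M_n(A) is
   needed here. *)
Definition completely_positive A B (phi : A -> B) : Prop :=
  linear phi /\
  forall n (M : 'M[A]_n), exists N : 'M[B]_n,
    map_mx phi (mxcmul (mxcstar M) M) = mxcmul (mxcstar N) N.

Definition ccp A B (phi : A -> B) : Prop :=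
  completely_positive phi /\ forall a, `|phi a| <= `|a|.

Definition positive_functional A (rho : A -> R[i]) : Prop :=
  [/\ scalar rho, continuous (rho : A -> R[i]^o) & forall a, cpos a -> 0 <= rho a].

(* phi restricted to the C*-subalgebra D of A is (e, K)-order 0; K is meant to
   be a compact subset of the unit ball of D, and a', b' range over D. *)
Definition approx_order0 A B (D : set A) (phi : A -> B) (e : R[i]) (K : set A) :
    Prop :=
  forall (d : R[i]) (a b : A), 0 < d -> K a -> K b -> `|cmul a b| < d ->
  exists a' b' : A, [/\ D a', D b', `|a' - a| <= d / 2, `|b' - b| <= d / 2 &
    `|cmul (phi a') (phi b')| < e].

(* Internal direct sum of ideals I 0, ..., I n. *)
Definition ideal_decomposition F n (I : 'I_n.+1 -> set F) : Prop :=
  (forall i, closed_ideal (I i)) /\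
  forall x, exists! f : {ffun 'I_n.+1 -> F},
    (forall i, I i (f i)) /\ x = \sum_i f i.

End CstarBasics.

Section CstarModules.
Variables (R : realType) (U : cstarAlgType R).
Implicit Types A B T : cstarModType U.

Definition module_map A B (phi : A -> B) : Prop :=
  [/\ linear phi, continuous phi & forall a u, phi (act a u) = act (phi a) u].

Inductive admissible : forall A B : cstarModType U, (A -> B) -> Prop :=
| admissible_module A B (phi : A -> B) :
    completely_positive phi -> module_map phi -> admissible phi
| admissible_conjl A B (phi : A -> B) (u : A) :
    admissible phi -> admissible (fun x => phi (cmul (cmul u x) (cstar u)))
| admissible_conjr A B (phi : A -> B) (v : B) :
    admissible phi -> admissible (fun x => cmul (cmul v (phi x)) (cstar v))
| admissible_functional A B (rho : A -> R[i]) (u : B) :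
    positive_functional rho -> cpos u ->
    completely_positive (fun x : A => rho x *: u) ->
    admissible (fun x : A => rho x *: u)
| admissible_comp A B (D : cstarModType U) (phi : A -> B) (psi : B -> D) :
    admissible phi -> admissible psi -> admissible (fun x => psi (phi x))
| admissible_scale A B (phi : A -> B) (c : R[i]) :
    0 < c -> admissible phi -> admissible (fun x => c *: phi x)
| admissible_add A B (phi psi : A -> B) :
    admissible phi -> admissible psi -> admissible (fun x => phi x + psi x).

(* T, with elementary tensors t, is F (x) U for F finite dimensional: the
   algebraic tensor product is then already complete, and its C*-norm is unique.
   The last two clauses say that the linear map from the algebraic tensor product
   to T induced by t is onto and one-to-one. *)
Definition is_tensor (F : cstarAlgType R) T (t : F -> U -> T) : Prop :=
  [/\ (forall u (z : R[i]) f g, t (z *: f + g) u = z *: t f u + t g u),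
      (forall f (z : R[i]) u v, t f (z *: u + v) = z *: t f u + t f v),
      (forall f g u v, cmul (t f u) (t g v) = t (cmul f g) (cmul u v)),
      (forall f u, cstar (t f u) = t (cstar f) (cstar u)) &
      (forall f u v, act (t f u) v = t f (cmul u v))] /\
  (forall x : T, exists m (f : 'I_m -> F) (u : 'I_m -> U),
      x = \sum_j t (f j) (u j)) /\
  (forall m (f : 'I_m -> F) (u : 'I_m -> U),
      (forall c : 'I_m -> R[i], \sum_j c j *: f j = 0 -> forall j, c j = 0) ->
      \sum_j t (f j) (u j) = 0 -> forall j, u j = 0).

Definition tensor_ideal (F : cstarAlgType R) T (t : F -> U -> T) (I : set F) :
    set T :=
  [set x | exists m (f : 'I_m -> F) (u : 'I_m -> U),
     (forall j, I (f j)) /\ x = \sum_j t (f j) (u j)].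

(* T is M_k(U): iota is an isomorphism from the *-algebra of k x k matrices over
   U, which has only one C*-norm, and the action is entrywise. *)
Definition is_matrix_algebra k T (iota : 'M[U]_k -> T) : Prop :=
  bijective iota /\
  [/\ (forall M N, iota (M + N) = iota M + iota N),
      (forall (z : R[i]) M, iota (map_mx (fun u => z *: u) M) = z *: iota M),
      (forall M N, iota (mxcmul M N) = cmul (iota M) (iota N)),
      (forall M, iota (mxcstar M) = cstar (iota M)) &
      (forall M u, iota (map_mx (fun v => cmul v u) M) = act (iota M) u)].

(* One map phi of G serves all blocks i at once.  If phi could vary with i, then
   every nuclear A would satisfy the condition with n = 1 and U = C: take
   F = F0 (+) F0, psi = (psi0, psi0) and
   G = {(x, y) |-> phi0 x, (x, y) |-> phi0 y}. *)
Definition module_dr_le A (n : nat) : Prop :=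
  forall (S : set A) (e : R[i]), finite_set S -> 0 < e ->
  exists (F : cstarAlgType R) (T : cstarModType U) (t : F -> U -> T)
         (psi : A -> T) (G : set (T -> A)) (I : 'I_n.+1 -> set F),
    [/\ finite_dim F, is_tensor t, ccp psi & admissible psi] /\
    [/\ G !=set0,
        (forall phi, G phi -> ccp phi /\ module_map phi),
        (forall phi a, G phi -> S a -> `|phi (psi a) - a| < e),
        ideal_decomposition I &
        forall (K : 'I_n.+1 -> set T) (d : 'I_n.+1 -> R[i]),
          (forall i, compact (K i)) ->
          (forall i, K i `<=` tensor_ideal t (I i) `&` [set x | `|x| <= 1]) ->
          (forall i, 0 < d i) ->
          exists2 phi, G phi &
            forall i, approx_order0 (tensor_ideal t (I i)) phi (d i) (K i)].

Definition module_dr A : \bar R :=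
  ereal_inf [set n%:R%:E | n in [set n | module_dr_le A n]].

Definition directed (J : Type) (le : J -> J -> Prop) : Prop :=
  [/\ inhabited J, (forall j, le j j),
      (forall i j k, le i j -> le j k -> le i k) &
      (forall i j, exists k, le i k /\ le j k)].

Definition net_cvg (J : Type) (le : J -> J -> Prop) (x : J -> R[i]) (l : R[i]) :
    Prop :=
  forall e : R[i], 0 < e -> exists j0, forall j, le j0 j -> `|x j - l| < e.

Definition module_quasidiagonal A : Prop :=
  exists (J : Type) (le : J -> J -> Prop) (k : J -> nat)
         (T : J -> cstarModType U) (iota : forall j, 'M[U]_(k j) -> T j)
         (phi : forall j, A -> T j),
    directed le /\
    [/\ (forall j, (0 < k j)%N /\ is_matrix_algebra (@iota j)),
        (forall j, ccp (phi j) /\ admissible (phi j)),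
        (forall a b, net_cvg le
           (fun j => `|phi j (cmul a b) - cmul (phi j a) (phi j b)|) 0) &
        (forall a, net_cvg le (fun j => `|phi j a|) `|a|)].

End CstarModules.

(* Main.v *)
(* Since the action is compatible with the involution, commutators of U act by zero on
   A, and the annihilator of A is a closed ideal of U.  The unit of U acts as the
   identity on A (it does so on F (x) U, and A is approximated through F (x) U), so if
   the annihilator is U then A = 0.  Otherwise U is commutative and simple, hence
   one-dimensional, and T = F (x) U is a finite dimensional C*-algebra, which embeds
   into a matrix algebra.

   Given a finite subset of A, take psi : A -> T and G for a small tolerance.  The
   elements x_c = psi(c c^* ) - psi(c) psi(c)^* are positive, and the Schwarz inequality
   for phi in G shows that phi(x_c) is small, uniformly in phi.  Hence phi(q) is small
   for the spectral projection q of sum_c x_c at large eigenvalues.  Let z be the unit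
   of the ideal generated by the component of q in a block of T, z = sum_k y_k q w_k.
   If phi is approximately order zero on this block, then phi(z)^(m+2) is close to
   sum_k phi(y_k) phi(q)^m phi(w_k), so that phi(z) is small too; one phi does this for
   all blocks.  Cutting T down by 1 - z is a star-homomorphism; it makes all x_c small,
   so its composition with psi is almost multiplicative, and since phi(z psi(c)) is
   small it does not decrease the norm of psi(c) by much. *)
From HB Require Import structures.
Require Import Defs.
From mathcomp Require Import all_boot all_order all_algebra.
From mathcomp Require Import complex spectral sesquilinear ring lra zify.
From mathcomp Require Import all_classical all_reals all_analysis.

Set Implicit Arguments.
Unset Strict Implicit.
Unset Printing Implicit Defensive.

Import Order.TTheory GRing.Theory Num.Theory.
Import numFieldNormedType.Exports.

Local Open Scope classical_set_scope.
Local Open Scope ring_scope.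
Local Open Scope complex_scope.

Notation "a ** b" := (cmul a b) (at level 40, left associativity) : ring_scope.
Notation "a ^#" := (cstar a) (at level 3, format "a ^#") : ring_scope.

(** * Norms and the involution *)

Section RealNorm.
Variable R : realType.
Local Notation C := R[i].

(** Spectral theory is available only for matrices, while [A] is abstract. So [A] is reached through
    the maps into matrix algebras obtained by representing [T]: they recover the norm of [A] up to
    an arbitrarily small error, and an element of [A] counts as positive when every contractive
    completely positive map into matrices sends it to a positive matrix. As [A] has no unit, the
    Schwarz inequality for psi relies on approximate units, built from powers of 1 - c^# c. Cutting
    by q itself would not be multiplicative, whence the passage to the central z. The price is that
    y_k and w_k depend on [T] and have no a priori bound, while the order of choice is: tolerance,
    then psi and G, then q and z, then phi. This is why powers of phi(z) are estimated: their norms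
    are exact for exponents 2^j, and taking roots removes the constant sum_k |y_k| |w_k|, leaving
    |phi(z)| <= 2 beta if beta bounds |phi(q)| on G. Approximate order zero enters only through
    finitely many pairs with product zero; these suffice because idempotents span [T]. *)

Lemma ge0_ReE (z : C) : 0 <= z -> z = (complex.Re z)%:C.
Proof. by case: z => a b; rewrite lecE /= => /andP[/eqP -> _]. Qed.

Lemma gt0_ReE (z : C) : 0 < z -> z = (complex.Re z)%:C /\ 0 < complex.Re z.
Proof.
move=> z0; have zE := ge0_ReE (ltW z0); split=> //.
by move: z0; rewrite ltcE => /andP[].
Qed.

(** The norms of the structures take values in [R[i]]; the real part moves them to [R], where
    suprema and linear arithmetic are available. *)
Definition nrm (V : normedZmodType C) (a : V) : R := complex.Re `|a|.

Section Normed.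
Variable V : normedZmodType C.
Implicit Types a b : V.

Lemma nrmE a : `|a| = (nrm a)%:C.
Proof. by apply: ge0_ReE; rewrite normr_ge0. Qed.

Lemma nrm_ge0 a : 0 <= nrm a.
Proof. by rewrite -ler0c -nrmE normr_ge0. Qed.

Lemma nrm_gt0 a : (0 < nrm a) = (a != 0).
Proof. by rewrite -ltcR -nrmE rmorph0 normr_gt0. Qed.

Lemma nrm0 : nrm (0 : V) = 0.
Proof. by rewrite /nrm normr0. Qed.

Lemma nrm0_eq0 a : nrm a = 0 -> a = 0.
Proof. by move=> h; apply/eqP; rewrite -normr_eq0 nrmE h. Qed.

Lemma nrm_le0_eq0 a : nrm a <= 0 -> a = 0.
Proof. by move=> h; apply: nrm0_eq0; apply/le_anti; rewrite h nrm_ge0. Qed.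

Lemma nrmN a : nrm (- a) = nrm a.
Proof. by rewrite /nrm normrN. Qed.

Lemma nrmD a b : nrm (a + b) <= nrm a + nrm b.
Proof. by rewrite -lecR rmorphD /= -!nrmE ler_normD. Qed.

Lemma nrmB a b : nrm (a - b) <= nrm a + nrm b.
Proof. by rewrite -(nrmN b) nrmD. Qed.

Lemma nrmBC a b : nrm (a - b) = nrm (b - a).
Proof. by rewrite /nrm distrC. Qed.

Lemma nrm_sum (I : Type) (r : seq I) (P : pred I) (F : I -> V) :
  nrm (\sum_(i <- r | P i) F i) <= \sum_(i <- r | P i) nrm (F i).
Proof.
elim/big_rec2: _ => [|i x y _ h]; first by rewrite nrm0.
by rewrite (le_trans (nrmD _ _)) ?lerD2l.
Qed.

End Normed.

Lemma nrmZ (V : normedModType C) (z : C) (a : V) : nrm (z *: a) = nrm z * nrm a.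
Proof. by apply: complexI; rewrite -nrmE normrZ !nrmE -rmorphM. Qed.

Lemma nrm_real (x : R) : nrm (x%:C : C) = `|x|.
Proof.
by apply: complexI; rewrite -nrmE normc_def /= expr0n /= addr0 sqrtr_sqr.
Qed.

Lemma nrmZr (V : normedModType C) (x : R) (a : V) : nrm (x%:C *: a) = `|x| * nrm a.
Proof. by rewrite nrmZ nrm_real. Qed.

Lemma nrmcM (z w : C) : nrm (z * w) = nrm z * nrm w.
Proof. by apply: complexI; rewrite -nrmE normrM !nrmE -rmorphM. Qed.

Lemma normr_Re (z : C) : `|complex.Re z| <= nrm z.
Proof. by rewrite -lecR -nrmE normc_ge_Re. Qed.

Lemma nrmci : nrm ('i%C : C) = 1.
Proof. by rewrite /nrm normc_def /= expr0n expr1n add0r sqrtr1. Qed.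

Lemma normr_Im (z : C) : `|complex.Im z| <= nrm z.
Proof.
by rewrite -[X in `|X|]opprK -ReiNIm normrN (le_trans (normr_Re _)) // nrmcM nrmci mulr1.
Qed.

Lemma nrm_ReIm (z : C) : nrm z <= `|complex.Re z| + `|complex.Im z|.
Proof.
rewrite {1}(complexE z) (le_trans (nrmD _ _)) // nrmcM nrmci mul1r.
by rewrite !nrm_real.
Qed.

End RealNorm.

Section CstarBasics.
Variables (R : realType).
Local Notation C := R[i].
Variable A : cstarAlgType R.
Implicit Types a b c : A.

Lemma cmulDl a b c : (a + b) ** c = a ** c + b ** c.
Proof. by have := @cmul_linearl R A c 1 a b; rewrite !scale1r. Qed.

Lemma cmulDr a b c : a ** (b + c) = a ** b + a ** c.
Proof. by have := @cmul_linearr R A a 1 b c; rewrite !scale1r. Qed.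

Lemma cmul0l a : 0 ** a = 0.
Proof. by apply: (addIr (0 ** a)); rewrite -cmulDl !add0r. Qed.

Lemma cmul0r a : a ** 0 = 0.
Proof. by apply: (addIr (a ** 0)); rewrite -cmulDr !add0r. Qed.

Lemma cmulZl (z : C) a b : (z *: a) ** b = z *: (a ** b).
Proof. by have := @cmul_linearl R A b z a 0; rewrite !addr0 cmul0l addr0. Qed.

Lemma cmulZr (z : C) a b : a ** (z *: b) = z *: (a ** b).
Proof. by have := @cmul_linearr R A a z b 0; rewrite !addr0 cmul0r addr0. Qed.

Lemma cmulNl a b : (- a) ** b = - (a ** b).
Proof. by rewrite -scaleN1r cmulZl scaleN1r. Qed.

Lemma cmulNr a b : a ** (- b) = - (a ** b).
Proof. by rewrite -scaleN1r cmulZr scaleN1r. Qed.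

Lemma cmulBl a b c : (a - b) ** c = a ** c - b ** c.
Proof. by rewrite cmulDl cmulNl. Qed.

Lemma cmulBr a b c : a ** (b - c) = a ** b - a ** c.
Proof. by rewrite cmulDr cmulNr. Qed.

Lemma cmul_suml (I : Type) (r : seq I) (P : pred I) (F : I -> A) a :
  (\sum_(i <- r | P i) F i) ** a = \sum_(i <- r | P i) F i ** a.
Proof.
apply: (big_morph (fun x => x ** a)) => [x y|]; by rewrite ?cmulDl ?cmul0l.
Qed.

Lemma cmul_sumr (I : Type) (r : seq I) (P : pred I) (F : I -> A) a :
  a ** (\sum_(i <- r | P i) F i) = \sum_(i <- r | P i) a ** F i.
Proof.
apply: (big_morph (fun x => a ** x)) => [x y|]; by rewrite ?cmulDr ?cmul0r.
Qed.

Lemma cstarD a b : (a + b)^# = a^# + b^#.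
Proof. by have := @cstar_antilinear R A 1 a b; rewrite scale1r rmorph1 scale1r. Qed.

Lemma cstar0 : (0 : A)^# = 0.
Proof. by apply: (addIr (0^#)); rewrite -cstarD !add0r. Qed.

Lemma cstarZ (z : C) a : (z *: a)^# = z^* *: a^#.
Proof. by have := @cstar_antilinear R A z a 0; rewrite !addr0 cstar0 addr0. Qed.

Lemma cstarZr (x : R) a : (x%:C *: a)^# = x%:C *: a^#.
Proof. by rewrite cstarZ; congr (_ *: _); exact: conjc_real. Qed.

Lemma cstarN a : (- a)^# = - a^#.
Proof. by apply: (addIr (a^#)); rewrite -cstarD !addNr cstar0. Qed.

Lemma cstarB a b : (a - b)^# = a^# - b^#.
Proof. by rewrite cstarD cstarN. Qed.

Lemma cstar_sum (I : Type) (r : seq I) (P : pred I) (F : I -> A) :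
  (\sum_(i <- r | P i) F i)^# = \sum_(i <- r | P i) (F i)^#.
Proof. by apply: (big_morph (@cstar R A) cstarD cstar0). Qed.

Lemma nrmM a b : nrm (a ** b) <= nrm a * nrm b.
Proof. by rewrite -lecR rmorphM /= -!nrmE cmul_norm. Qed.

Lemma nrm_starM a : nrm (a^# ** a) = nrm a ^+ 2.
Proof. by apply: complexI; rewrite -nrmE cstar_identity nrmE rmorphXn. Qed.

Lemma nrm_star a : nrm a^# = nrm a.
Proof.
have le b : nrm b <= nrm b^#.
  have [->|b0] := eqVneq b 0; first by rewrite cstar0.
  have := nrmM b^# b; rewrite nrm_starM expr2 ler_pM2r //.
  by rewrite nrm_gt0.
by apply/le_anti; rewrite le andbT -{2}(cstarK a) le.
Qed.

Lemma nrm_Mstar a : nrm (a ** a^#) = nrm a ^+ 2.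
Proof. by rewrite -{1}(cstarK a) nrm_starM nrm_star. Qed.

Lemma starM_eq0 a : a^# ** a = 0 -> a = 0.
Proof.
move=> h; apply: nrm0_eq0; apply/eqP.
by rewrite -sqrf_eq0 -nrm_starM h nrm0.
Qed.

Definition sa a := a^# = a.

Lemma sa_starM a : sa (a^# ** a).
Proof. by rewrite /sa cstarM cstarK. Qed.

Lemma sa_Mstar a : sa (a ** a^#).
Proof. by rewrite /sa cstarM cstarK. Qed.

(** Exponents 2^k: for self-adjoint elements the C*-identity makes the norms of these powers exact,
    which stands in for the spectral radius formula. *)
Definition sqiter k a := iter k (fun x => x ** x) a.

Lemma sqiter_sa k a : sa a -> sa (sqiter k a).
Proof. by move=> sa_a; elim: k => //= k IH; rewrite /sa cstarM IH. Qed.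

Lemma nrm_sqiter k a : sa a -> nrm (sqiter k a) = nrm a ^+ (2 ^ k).
Proof.
move=> sa_a; elim: k => [|k IH] //=.
by rewrite -{1}(sqiter_sa k sa_a) nrm_starM IH expnSr exprM.
Qed.

(* [cpow a n] is the power of exponent [n.+1]. *)
Definition cpow a n := iter n (fun x => a ** x) a.

Lemma cpowS a n : cpow a n.+1 = a ** cpow a n.
Proof. by []. Qed.

Lemma cpowD a m n : cpow a m ** cpow a n = cpow a (m + n).+1.
Proof. by elim: m => [|m IH] //; rewrite addSn !cpowS -cmulA IH. Qed.

Lemma sqiter_cpow k a : sqiter k a = cpow a (2 ^ k).-1.
Proof.
elim: k => [|k IH] //=; rewrite IH cpowD; congr cpow.
by rewrite expnS mul2n -addnn; case: (2 ^ k)%N (expn_gt0 2 k) => // m _; rewrite addnS.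
Qed.

Lemma cpos_starM a : cpos (a^# ** a).
Proof. by exists a. Qed.

Lemma re_im a : exists b c, [/\ sa b, sa c & a = b + 'i%C *: c].
Proof.
exists (2^-1 *: (a + a^#)), (2^-1 *: (- 'i%C *: (a - a^#))); split.
- by rewrite /sa cstarZ cstarD cstarK fmorphV rmorph_nat addrC.
- rewrite /sa !cstarZ cstarB cstarK fmorphV rmorph_nat -(opprB a) scalerN -scaleNr.
  congr (_ *: (_ *: _)).
  by apply/eqP; rewrite eq_complex /= !oppr0 !opprK !eqxx.
have i1 : 'i%C * - 'i%C = 1 :> C by rewrite mulrN -expr2 sqr_i opprK.
rewrite !scalerA mulrAC i1 mul1r -scalerDr addrACA.
by rewrite subrr addr0 -mulr2n -[a *+ 2]scaler_nat scalerA mulVf ?scale1r // pnatr_eq0.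
Qed.

End CstarBasics.

(** * Matrix algebras as C*-algebras *)

Section RowNorm.
Local Open Scope sesquilinear_scope.
Variable R : realType.
Local Notation C := R[i].
Local Notation "''[' u , v ]" := (dotmx u v) : ring_scope.

(** Euclidean norm. Vectors are rows, and matrices act on them from the right throughout. *)
Definition vn N (v : 'rV[C]_N) : R := complex.Re (sqrtC '[v, v]).

Section Fixed.
Variable N : nat.
Implicit Types u v w : 'rV[C]_N.

Lemma vnE v : sqrtC '[v, v] = (vn v)%:C.
Proof. by apply: ge0_ReE; exact: sqrt_dnorm_ge0. Qed.

Lemma vn_ge0 v : 0 <= vn v.
Proof. by rewrite -ler0c -vnE sqrt_dnorm_ge0. Qed.

Lemma vn_sq v : '[v, v] = (vn v ^+ 2)%:C.
Proof. by rewrite rmorphXn /= -vnE sqrtCK. Qed.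

Lemma vn_eq0 v : vn v = 0 -> v = 0.
Proof.
move=> h; apply/eqP; rewrite -(dnorm_eq0 (@dotmx C N)); apply/eqP.
by apply: (etrans (vn_sq v)); rewrite h expr0n.
Qed.

Lemma vn0 : vn (0 : 'rV[C]_N) = 0.
Proof. by rewrite /vn linear0l sqrtC0. Qed.

Lemma vn_CS u v : nrm '[u, v] <= vn u * vn v.
Proof.
have [d [dE h]] : exists d : 'rV[C]_N -> C, (forall w, sqrtC (d w) = (vn w)%:C) /\
    `|'[u, v]| <= sqrtC (d u) * sqrtC (d v).
  exists (fun w => '[w, w]); split; first exact: vnE.
  exact: (CauchySchwarz_sqrt (@dotmx C N) u v).1.
by move: h; rewrite !dE nrmE -(rmorphM (real_complex R)) lecR.
Qed.

Lemma vnD u v : vn (u + v) <= vn u + vn v.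
Proof.
have [d [dE h]] : exists d : 'rV[C]_N -> C, (forall w, sqrtC (d w) = (vn w)%:C) /\
    sqrtC (d (u + v)) <= sqrtC (d u) + sqrtC (d v).
  exists (fun w => '[w, w]); split; first exact: vnE.
  exact: (triangle_lerif (@dotmx C N) u v).1.
by move: h; rewrite !dE -(rmorphD (real_complex R)) lecR.
Qed.

Lemma vnZ (z : C) v : vn (z *: v) = nrm z * vn v.
Proof.
apply: complexI; rewrite -vnE (dnormZ (@dotmx C N)) sqrtCM ?nnegrE ?exprn_ge0 //.
by rewrite vnE exprnP sqrCK // nrmE -rmorphM.
Qed.

Lemma vn_sum (I : Type) (r : seq I) (P : pred I) (F : I -> 'rV[C]_N) :
  vn (\sum_(i <- r | P i) F i) <= \sum_(i <- r | P i) vn (F i).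
Proof.
elim/big_rec2: _ => [|i x y _ h]; first by rewrite vn0.
by rewrite (le_trans (vnD _ _)) ?lerD2l.
Qed.

Lemma dotmxC u v : '[v, u] = '[u, v]^*.
Proof.
rewrite !dotmxE !mxE rmorph_sum; apply: eq_bigr => i _.
by rewrite !mxE rmorphM mulrC; congr (_ * _); exact/esym/conjcK.
Qed.

Lemma dotmxDl u u' v : '[u + u', v] = '[u, v] + '[u', v].
Proof. by rewrite !dotmxE mulmxDl mxE. Qed.

Lemma dotmxZl (z : C) u v : '[z *: u, v] = z * '[u, v].
Proof. by rewrite !dotmxE -scalemxAl mxE. Qed.

Lemma dotmxDr u v v' : '[u, v + v'] = '[u, v] + '[u, v'].
Proof. by rewrite !(dotmxC _ u) dotmxDl rmorphD. Qed.

Lemma dotmxZr (z : C) u v : '[u, z *: v] = z^* * '[u, v].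
Proof. by rewrite !(dotmxC _ u) dotmxZl rmorphM. Qed.

Lemma dotmx_adj M (u : 'rV[C]_M) (B : 'M[C]_(M, N)) (v : 'rV[C]_N) :
  '[u *m B, v] = '[u, v *m B^t*].
Proof.
rewrite !dotmxE (_ : (v *m B^t*)^t* = B *m v^t*) ?mulmxA //.
by rewrite trmx_mul map_mxM trmxCK.
Qed.

Lemma dotmx_delta v i : '[v, delta_mx 0 i] = v 0 i.
Proof.
rewrite dotmxE mxE (bigD1 i) //= big1 ?addr0 => [|j ji].
  by rewrite !mxE !eqxx rmorph1 mulr1.
by rewrite !mxE (negPf ji) andbF rmorph0 mulr0.
Qed.

Lemma vn_delta i : vn (delta_mx 0 i : 'rV[C]_N) = 1.
Proof.
by rewrite /vn dotmx_delta mxE !eqxx sqrtC1.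
Qed.

Lemma nrm_coord v i : nrm (v 0 i) <= vn v.
Proof. by rewrite -dotmx_delta (le_trans (vn_CS _ _)) ?vn_delta ?mulr1. Qed.

Lemma vn_coord v : vn v <= \sum_i nrm (v 0 i).
Proof.
rewrite {1}(row_sum_delta v) (le_trans (vn_sum _ _ _)) //.
by apply: ler_sum => i _; rewrite vnZ vn_delta mulr1.
Qed.

End Fixed.

(** Crude, but enough to bound [opset] and to compare the operator norm with the entries in the
    completeness proof. *)
Lemma vn_mulmx_bound M N (B : 'M[C]_(M, N)) (v : 'rV[C]_M) :
  vn (v *m B) <= (\sum_i \sum_j nrm (B i j)) * vn v.
Proof.
rewrite mulmx_sum_row (le_trans (vn_sum _ _ _)) // mulr_suml.
apply: ler_sum => i _; rewrite vnZ mulrC ler_pM ?vn_ge0 ?nrm_ge0 ?nrm_coord //.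
by rewrite (le_trans (vn_coord _)) //; apply: ler_sum => j _; rewrite mxE.
Qed.

Definition opset M N (B : 'M[C]_(M, N)) : set R :=
  [set vn (v *m B) | v in [set v | vn v <= 1]].

Definition opn M N (B : 'M[C]_(M, N)) : R := sup (opset B).

Section OpNorm.
Variables M N : nat.
Implicit Types B : 'M[C]_(M, N).

Lemma opset_sup B : has_sup (opset B).
Proof.
split; first by exists (vn (0 *m B)), 0 => //=; rewrite vn0 ler01.
exists (\sum_i \sum_j nrm (B i j)) => _ [v /= v1 <-].
rewrite (le_trans (vn_mulmx_bound _ _)) // ler_piMr //.
by do 2!apply: sumr_ge0 => ? _; exact: nrm_ge0.
Qed.

Lemma opn_ge0 B : 0 <= opn B.
Proof.
have := ub_le_sup (proj2 (opset_sup B)); apply.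
by exists 0; rewrite /= ?vn0 ?ler01 // mul0mx vn0.
Qed.

Lemma opnP B (v : 'rV[C]_M) : vn (v *m B) <= opn B * vn v.
Proof.
have [v0|v0] := eqVneq (vn v) 0.
  by rewrite v0 (vn_eq0 v0) mul0mx vn0 mulr0.
have vp : 0 < vn v by rewrite lt_neqAle eq_sym v0 vn_ge0.
rewrite -ler_pdivrMr //; apply: (ub_le_sup (proj2 (opset_sup B))).
have ni : nrm ((vn v)^-1%:C : C) = (vn v)^-1.
  by rewrite nrm_real ger0_norm // invr_ge0 vn_ge0.
exists ((vn v)^-1%:C *: v) => /=; first by rewrite vnZ ni mulVf.
by rewrite -scalemxAl vnZ ni mulrC.
Qed.

Lemma opn_le B (c : R) : 0 <= c ->
  (forall v, vn (v *m B) <= c * vn v) -> opn B <= c.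
Proof.
move=> c0 h; apply: ge_sup; first exact: (proj1 (opset_sup B)).
by move=> _ [v /= v1 <-]; rewrite (le_trans (h v)) // ler_piMr.
Qed.

Lemma opnD B B' : opn (B + B') <= opn B + opn B'.
Proof.
apply: opn_le => [|v]; first by rewrite addr_ge0 ?opn_ge0.
by rewrite mulmxDr (le_trans (vnD _ _)) // mulrDl lerD ?opnP.
Qed.

Lemma opn0_eq0 B : opn B = 0 -> B = 0.
Proof.
move=> h; apply/row_matrixP => i; rewrite row0 rowE; apply: vn_eq0.
by apply/le_anti; rewrite vn_ge0 (le_trans (opnP _ _)) // h mul0r.
Qed.

Lemma opnZ (z : C) B : opn (z *: B) = nrm z * opn B.
Proof.
have le (w : C) (D : 'M[C]_(M, N)) : opn (w *: D) <= nrm w * opn D.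
  apply: opn_le => [|v]; first by rewrite mulr_ge0 ?nrm_ge0 ?opn_ge0.
  by rewrite -scalemxAr vnZ -mulrA ler_wpM2l ?nrm_ge0 ?opnP.
apply/le_anti; rewrite le /=; have [->|z0] := eqVneq z 0.
  by rewrite nrm0 mul0r opn_ge0.
have zp : 0 < nrm z by rewrite nrm_gt0.
rewrite -ler_pdivlMl // (_ : (nrm z)^-1 = nrm z^-1).
  by rewrite -{1}(scalerK z0 B) le.
apply: (mulfI (lt0r_neq0 zp)); rewrite -nrmcM (mulfV z0) (mulfV (lt0r_neq0 zp)).
by rewrite nrm_real normr1.
Qed.

Lemma opn_entry B i j : nrm (B i j) <= opn B.
Proof.
have -> : B i j = ((delta_mx 0 i : 'rV_M) *m B) 0 j by rewrite -rowE mxE.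
by rewrite (le_trans (nrm_coord _ _)) // (le_trans (opnP _ _)) // vn_delta mulr1.
Qed.

Lemma opn_sum_entry B : opn B <= \sum_i \sum_j nrm (B i j).
Proof.
apply: opn_le => [|v]; last exact: vn_mulmx_bound.
by do 2!apply: sumr_ge0 => ? _; exact: nrm_ge0.
Qed.

End OpNorm.

Lemma opnM M N K (B : 'M[C]_(M, N)) (D : 'M[C]_(N, K)) :
  opn (B *m D) <= opn B * opn D.
Proof.
apply: opn_le => [|v]; first by rewrite mulr_ge0 ?opn_ge0.
rewrite mulmxA (le_trans (opnP _ _)) // [leRHS]mulrAC [leRHS]mulrC.
by rewrite ler_wpM2l ?opn_ge0 ?opnP.
Qed.

Lemma opn_sq_le M N (B : 'M[C]_(M, N)) : opn B ^+ 2 <= opn (B *m B^t*).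
Proof.
have s0 : 0 <= Num.sqrt (opn (B *m B^t*)) by rewrite sqrtr_ge0.
rewrite -[leRHS](sqr_sqrtr (opn_ge0 _)) lerXn2r ?nnegrE ?opn_ge0 //.
apply: opn_le => // v.
rewrite -(@ler_pXn2r _ 2) ?nnegrE ?mulr_ge0 ?vn_ge0 // exprMn sqr_sqrtr ?opn_ge0 //.
have -> : vn (v *m B) ^+ 2 = nrm '[v, v *m (B *m B^t*)].
  by rewrite mulmxA -dotmx_adj vn_sq nrm_real ger0_norm // exprn_ge0 ?vn_ge0.
rewrite (le_trans (vn_CS _ _)) // mulrC expr2 mulrA.
by rewrite ler_wpM2r ?vn_ge0 ?opnP.
Qed.

(** |B|^2 <= |B B^#| <= |B| |B^#|; divide by |B|, then exchange B with its adjoint. *)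
Lemma opn_adj M N (B : 'M[C]_(M, N)) : opn (B^t*) = opn B.
Proof.
have star M' N' (D : 'M[C]_(M', N')) : opn D <= opn (D^t*).
  have [->|D0] := eqVneq (opn D) 0; first exact: opn_ge0.
  have Dp : 0 < opn D by rewrite lt_neqAle eq_sym D0 opn_ge0.
  by rewrite -(ler_pM2l Dp) -expr2 (le_trans (opn_sq_le _)) ?opnM.
by have := star _ _ (B^t*); rewrite trmxCK => h; apply/le_anti; rewrite h star.
Qed.

Lemma opn_cstar M N (B : 'M[C]_(M, N)) : opn (B^t* *m B) = opn B ^+ 2.
Proof.
have le1 := opnM (B^t*) B; have := opn_sq_le (B^t*).
rewrite opn_adj trmxCK => le2; apply/le_anti.
by rewrite le2 (le_trans le1) // opn_adj expr2.
Qed.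

End RowNorm.

(** A separate name, so that the operator norm is kept apart from any other norm on matrices. *)
Definition opmx (R : realType) (N : nat) : Type := 'M[R[i]]_N.

Section OpMatrix.
Local Open Scope sesquilinear_scope.
Variables (R : realType) (N : nat).
Local Notation C := R[i].
Local Notation T := (opmx R N).

HB.instance Definition _ := GRing.Lmodule.copy T 'M[C]_N.

Let opnC (B : T) : C := (opn (B : 'M[C]_N))%:C.

Let opnC_D (B D : T) : opnC (B + D) <= opnC B + opnC D.
Proof. by rewrite -rmorphD lecR opnD. Qed.

Let opnC_Z (z : C) (B : T) : opnC (z *: B) = `|z| * opnC B.
Proof. by rewrite nrmE -rmorphM; congr (_%:C); exact: opnZ. Qed.

Let opnC_eq0 (B : T) : opnC B = 0 -> B = 0.
Proof. by move=> /complexI h; exact: opn0_eq0. Qed.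

HB.instance Definition _ := Lmodule_isNormed.Build C T opnC_D opnC_Z opnC_eq0.

(** Real and imaginary parts of entries are 1-Lipschitz for the operator norm, so a Cauchy filter
    converges entrywise; [opn_sum_entry] brings the convergence back to the norm. *)
Lemma opmx_complete (F : set_system T) : ProperFilter F -> cauchy F -> cvg F.
Proof.
move=> FF /cauchy_ballP Fc.
have near2 (e : R) : 0 < e ->
    \forall x \near F & y \near F, opn ((x : 'M[C]_N) - y) < e.
  move=> e0; have e0' : 0 < e%:C :> C by rewrite ltcR.
  have := Fc _ e0'; rewrite near_map2.
  apply: filterS => -[x y] /=.
  by rewrite -ball_normE /= nrmE ltcR.
have lim (g : T -> R) : (forall B D, `|g B - g D| <= opn ((B : 'M[C]_N) - D)) ->
    exists l, forall e, 0 < e -> \forall B \near F, `|l - g B| < e.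
  move=> glip; have : cvg (g @ F).
    apply: R_complete; apply/cauchy_ballP => e e0; rewrite near_map2.
    apply: filterS (near2 _ e0) => -[x y] /=.
    by rewrite /ball /=; apply: le_lt_trans.
  move=> /cvg_ex[l gl]; exists l => e e0.
  by have /cvgrPdist_lt /(_ _ e0) := gl.
have [lre lreP] : exists l : 'I_N -> 'I_N -> R, forall i j e, 0 < e ->
    \forall B \near F, `|l i j - complex.Re ((B : 'M[C]_N) i j)| < e.
  suff /choice[f fP] : forall p : 'I_N * 'I_N, exists l, forall e, 0 < e ->
      \forall B \near F, `|l - complex.Re ((B : 'M[C]_N) p.1 p.2)| < e.
    by exists (fun i j => f (i, j)) => i j; exact: (fP (i, j)).
  move=> [i j] /=; apply: lim => B D; rewrite -raddfB /=.
  by apply: le_trans (normr_Re _) _; have := opn_entry ((B : 'M[C]_N) - D) i j; rewrite !mxE.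
have [lim_ limP] : exists l : 'I_N -> 'I_N -> R, forall i j e, 0 < e ->
    \forall B \near F, `|l i j - complex.Im ((B : 'M[C]_N) i j)| < e.
  suff /choice[f fP] : forall p : 'I_N * 'I_N, exists l, forall e, 0 < e ->
      \forall B \near F, `|l - complex.Im ((B : 'M[C]_N) p.1 p.2)| < e.
    by exists (fun i j => f (i, j)) => i j; exact: (fP (i, j)).
  move=> [i j] /=; apply: lim => B D; rewrite -raddfB /=.
  by apply: le_trans (normr_Im _) _; have := opn_entry ((B : 'M[C]_N) - D) i j; rewrite !mxE.
pose L : 'M[C]_N := \matrix_(i, j) (lre i j +i* lim_ i j).
apply/cvg_ex; exists (L : T); apply/cvgrPdist_lt => d d0.
have [e [e0 ->]] : exists e : R, 0 < e /\ d = e%:C.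
  by exists (complex.Re d); have [] := gt0_ReE d0.
(* The 2 accounts for real and imaginary parts; the successor makes the final inequality strict and
   [c] positive even for N = 0. *)
pose c := (N * N).+1%:R * 2 : R.
have c0 : 0 < c by rewrite mulr_gt0 ?ltr0n.
have ec : 0 < e / c by rewrite divr_gt0.
have H : \forall B \near F, forall p : 'I_N * 'I_N,
    `|lre p.1 p.2 - complex.Re ((B : 'M[C]_N) p.1 p.2)| < e / c /\
    `|lim_ p.1 p.2 - complex.Im ((B : 'M[C]_N) p.1 p.2)| < e / c.
  apply: filter_forall => -[i j] /=.
  exact: filterI (lreP i j _ ec) (limP i j _ ec).
apply: filterS H => B H; rewrite nrmE ltcR.
suff: opn (L - (B : 'M[C]_N)) < e by [].
apply: le_lt_trans (opn_sum_entry _) _.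
have bound : e / c * 2 * (N * N)%:R < e.
  have eE : e = e / c * c by rewrite divfK // gt_eqF.
  move: (e / c) ec eE => x x0 ->; rewrite /c -natr1 -subr_gt0.
  by rewrite (_ : _ - _ = x * 2) ?mulr_gt0 //; ring.
apply: le_lt_trans bound.
apply: (@le_trans _ _ (\sum_(i < N) \sum_(j < N) (e / c * 2))); last first.
  by rewrite !sumr_const !card_ord -mulrnA -[X in X <= _]mulr_natr.
apply: ler_sum => i _; apply: ler_sum => j _; rewrite !mxE.
apply: le_trans (nrm_ReIm _) _; rewrite !raddfB /= [leRHS]mulr_natr mulr2n.
by have [h1 h2] := H (i, j); rewrite lerD // ltW.
Qed.

HB.instance Definition _ := Uniform_isComplete.Build T opmx_complete.

Let op_mul (B D : T) : T := (B : 'M[C]_N) *m D.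
Let op_star (B : T) : T := (B : 'M[C]_N)^t*.

Let op_mulA B D E : op_mul B (op_mul D E) = op_mul (op_mul B D) E.
Proof. exact: mulmxA. Qed.

Let op_linl (b : T) (z : C) a1 a2 :
  op_mul (z *: a1 + a2) b = z *: op_mul a1 b + op_mul a2 b.
Proof. by rewrite /op_mul mulmxDl scalemxAl. Qed.

Let op_linr (b : T) (z : C) a1 a2 :
  op_mul b (z *: a1 + a2) = z *: op_mul b a1 + op_mul b a2.
Proof. by rewrite /op_mul mulmxDr scalemxAr. Qed.

Let op_antilin (z : C) a1 a2 :
  op_star (z *: a1 + a2) = z^* *: op_star a1 + op_star a2.
Proof. by apply/matrixP => i j; rewrite !mxE rmorphD rmorphM. Qed.

Let op_starM a b : op_star (op_mul a b) = op_mul (op_star b) (op_star a).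
Proof. by rewrite /op_star /op_mul trmx_mul map_mxM. Qed.

Let op_starK : involutive op_star.
Proof. by move=> a; exact: trmxCK. Qed.

Let op_norm a b : `|op_mul a b| <= `|a| * `|b|.
Proof. by rewrite !nrmE -rmorphM lecR; exact: opnM. Qed.

Let op_cstar a : `|op_mul (op_star a) a| = `|a| ^+ 2.
Proof.
by rewrite !nrmE -rmorphXn; congr (_%:C); exact: opn_cstar.
Qed.

HB.instance Definition _ := CompleteNormedModule_isCstarAlgebra.Build R T
  op_mulA op_linl op_linr op_antilin op_starM op_starK op_norm op_cstar.

Lemma opmx_mulE (B D : T) : B ** D = (B : 'M[C]_N) *m (D : 'M[C]_N) :> 'M[C]_N.
Proof. by []. Qed.

Lemma opmx_starE (B : T) : B^# = (B : 'M[C]_N)^t* :> 'M[C]_N.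
Proof. by []. Qed.

End OpMatrix.

(** * Positive semidefinite matrices *)

HB.lock Definition sform (R : realType) (N : nat) (B : opmx R N)
  (u v : 'rV[R[i]]_N) : R[i] := dotmx (u *m (B : 'M[R[i]]_N)) v.

Section Psd.
Local Open Scope sesquilinear_scope.
Variables (R : realType) (N : nat).
Local Notation C := R[i].
Local Notation T := (opmx R N).
Local Notation "''[' u , v ]" := (dotmx u v) : ring_scope.
Implicit Types (B P Q : T) (u v w : 'rV[C]_N).

Lemma sformDl B P u v : sform (B + P) u v = sform B u v + sform P u v.
Proof.
rewrite unlock; have E := mulmxDr u (B : 'M[C]_N) (P : 'M[C]_N).
by apply: etrans (congr1 (fun x => '[x, v]) E) _; exact: dotmxDl.
Qed.

Lemma sformZl (z : C) B u v : sform (z *: B) u v = z * sform B u v.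
Proof.
rewrite unlock; have E := esym (scalemxAr z u (B : 'M[C]_N)).
by apply: etrans (congr1 (fun x => '[x, v]) E) _; exact: dotmxZl.
Qed.

Lemma sform0l u v : sform 0 u v = 0.
Proof. by rewrite -(scale0r (0 : T)) sformZl mul0r. Qed.

Lemma sformBl B P u v : sform (B - P) u v = sform B u v - sform P u v.
Proof. by rewrite sformDl -scaleN1r sformZl mulN1r. Qed.

Lemma sformD B u1 u2 v1 v2 : sform B (u1 + u2) (v1 + v2) =
  sform B u1 v1 + sform B u1 v2 + (sform B u2 v1 + sform B u2 v2).
Proof.
rewrite unlock (mulmxDl u1 u2 (B : 'M[C]_N)) dotmxDl !dotmxDr.
by rewrite -addrA.
Qed.

Lemma sformZ B (z w : C) u v : sform B (z *: u) (w *: v) = z * w^* * sform B u v.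
Proof.
by rewrite unlock -(scalemxAl z u (B : 'M[C]_N)) dotmxZl dotmxZr mulrA.
Qed.

Lemma sform_adj B P u v :
  sform (B ** P ** B^#) u v = sform P (u *m (B : 'M[C]_N)) (v *m (B : 'M[C]_N)).
Proof.
by rewrite unlock opmx_mulE opmx_mulE opmx_starE !mulmxA dotmx_adj trmxCK.
Qed.

Lemma sform_Mstar B v : sform (B ** B^#) v v = (vn (v *m (B : 'M[C]_N)) ^+ 2)%:C.
Proof.
by rewrite unlock opmx_mulE opmx_starE mulmxA dotmx_adj trmxCK vn_sq.
Qed.

Lemma sform_star B u v : sform B^# u v = (sform B v u)^*.
Proof.
by rewrite unlock opmx_starE dotmx_adj trmxCK dotmxC.
Qed.

Lemma sform_delta B i j :
  sform B (delta_mx 0 i) (delta_mx 0 j) = (B : 'M[C]_N) i j.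
Proof. by rewrite unlock dotmx_delta -rowE mxE. Qed.

Lemma nrm_sform B u v : nrm (sform B u v) <= nrm B * (vn u * vn v).
Proof.
by rewrite unlock (le_trans (vn_CS _ _)) // mulrA ler_wpM2r ?vn_ge0 // opnP.
Qed.

(** In contrast with [cpos], this form of positivity is visibly stable under sums and limits;
    [psd_sqrt] leads back to a factorization. *)
Definition psd P : Prop := forall v, 0 <= sform P v v.

Lemma psdD P Q : psd P -> psd Q -> psd (P + Q).
Proof. by move=> hP hQ v; rewrite sformDl addr_ge0. Qed.

Lemma psd0 : psd 0.
Proof. by move=> v; rewrite sform0l. Qed.

Lemma psd_sum (I : Type) (r : seq I) (p : pred I) (F : I -> T) :
  (forall i, p i -> psd (F i)) -> psd (\sum_(i <- r | p i) F i).
Proof.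
move=> h; apply: (big_ind psd) => //; [exact: psd0 | exact: psdD].
Qed.

Lemma psdZ (x : R) P : 0 <= x -> psd P -> psd (x%:C *: P).
Proof. by move=> x0 hP v; rewrite sformZl; apply: mulr_ge0 (hP v); rewrite ler0c. Qed.

Lemma psd_Mstar B : psd (B ** B^#).
Proof. by move=> v; rewrite sform_Mstar ler0c sqr_ge0. Qed.

Lemma psd_starM B : psd (B^# ** B).
Proof. by rewrite -{2}(cstarK B); exact: psd_Mstar. Qed.

Lemma ge0_closed (z : C) :
  (forall e : R, 0 < e -> exists2 p : C, 0 <= p & nrm (z - p) <= e) -> 0 <= z.
Proof.
move=> h; rewrite lecE /=; apply/andP; split.
  rewrite -normr_le0; apply/ler_addgt0Pr => e /h[p p0 zp]; rewrite add0r.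
  apply: le_trans zp; apply: le_trans (normr_Im _).
  by rewrite raddfB /= (ger0_Im p0) subr0.
apply/ler_addgt0Pr => e /h[p p0 zp].
have : 0 <= complex.Re p by move: p0; rewrite lecE => /andP[].
have := le_trans (normr_Re _) zp; rewrite raddfB /= ler_norml => /andP[? _]; lra.
Qed.

Lemma psd_closed B :
  (forall e : R, 0 < e -> exists2 P, psd P & nrm (B - P) <= e) -> psd B.
Proof.
move=> h v; apply: ge0_closed => e e0.
have c0 : 0 < vn v * vn v + 1 by rewrite ltr_wpDl ?mulr_ge0 ?vn_ge0.
have [P hP BP] := h _ (divr_gt0 e0 c0).
exists (sform P v v) => //.
rewrite -sformBl (le_trans (nrm_sform _ _ _)) //.
apply: (@le_trans _ _ (e / (vn v * vn v + 1) * (vn v * vn v + 1))).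
  by rewrite ler_pM ?nrm_ge0 ?mulr_ge0 ?vn_ge0 // lerDl.
by rewrite divfK // gt_eqF.
Qed.

(** The form of P^# - P vanishes on the diagonal, as that of P is real there; evaluating it at u + v
    and u + i v shows that it vanishes everywhere. *)
Lemma psd_sa P : psd P -> sa P.
Proof.
move=> hP.
pose S : T := P^# - P; suff: S = 0 by move/eqP; rewrite subr_eq0 => /eqP.
have S0 v : sform S v v = 0.
  rewrite sformBl sform_star (ge0_ReE (hP v)).
  by apply/eqP; rewrite subr_eq0; apply/eqP; exact: conjc_real.
have ciE u v : sform S u ('i%C *: v) = - 'i%C * sform S u v.
  rewrite -[u in LHS]scale1r sformZ mul1r; congr (_ * _).
  by apply/eqP; rewrite eq_complex /= oppr0 !eqxx.
have iE u v : sform S ('i%C *: u) v = 'i%C * sform S u v.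
  by rewrite -[v in LHS]scale1r sformZ rmorph1 mulr1.
have S1 u v : sform S u v = 0.
  have h1 := S0 (u + v); have h2 := S0 (u + 'i%C *: v).
  move: h1 h2; rewrite !sformD !ciE !iE !S0 !mulr0 !addr0 !add0r.
  move: (sform S u v) (sform S v u) => a b h1.
  have i0 : 'i%C != 0 :> C by rewrite eq_complex /= oner_eq0 andbF.
  move=> /eqP; rewrite mulNr addrC -mulrBr mulf_eq0 (negPf i0) /= subr_eq0 => /eqP ba.
  by move/eqP: h1; rewrite ba -mulr2n mulrn_eq0 /= => /eqP.
by apply/matrixP => i j; rewrite -sform_delta S1 mxE.
Qed.

End Psd.

(** * Functional calculus for matrices *)

Section MatrixCalculus.
Local Open Scope sesquilinear_scope.
Variables (R : realType) (N : nat).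
Local Notation C := R[i].
Local Notation "''[' u , v ]" := (dotmx u v) : ring_scope.
Variable H : 'M[C]_N.
Let V : 'M[C]_N := spectralmx H.
Let d : 'rV[C]_N := spectral_diag H.

(** The algebraic rules below rest only on V being unitary; [mxfun_id] ties the construction to H
    when H is self-adjoint. *)
Definition mxfun (f : C -> C) : 'M[C]_N := V^t* *m diag_mx (map_mx f d) *m V.

Definition specval i : C := spectral_diag H 0 i.

Let VV : V *m V^t* = 1%:M.
Proof. by apply/unitarymxP; exact: spectral_unitarymx. Qed.

Let VV' : V^t* *m V = 1%:M.
Proof.
by rewrite -invmx_unitary ?spectral_unitarymx // mulVmx ?spectral_unit.
Qed.

Lemma mxfun_id : H^t* = H -> mxfun id = H.
Proof.
move=> saH; have /orthomx_spectralP : H \is normalmx by apply/normalmxP; rewrite saH.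
rewrite invmx_unitary ?spectral_unitarymx // => e; rewrite [RHS]e /mxfun.
by rewrite (_ : map_mx id d = d) //; apply/matrixP => i j; rewrite mxE.
Qed.

Lemma specval_real i : H^t* = H -> specval i = (complex.Re (specval i))%:C.
Proof.
move=> saH; apply/esym/RRe_real.
have /mxOverP/(_ 0 i) : spectral_diag H \is a realmx; last by [].
apply: hermitian_spectral_diag_real; apply/is_hermitianmxP.
by rewrite expr0 scale1r; exact/esym/saH.
Qed.

Lemma mxfun_ext f g : (forall i, f (specval i) = g (specval i)) -> mxfun f = mxfun g.
Proof.
move=> h; rewrite /mxfun (_ : map_mx f d = map_mx g d) //.
by apply/rowP => i; rewrite !mxE h.
Qed.

Lemma mxfunM f g : mxfun f *m mxfun g = mxfun (fun t => f t * g t).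
Proof.
have VVK (X : 'M[C]_N) : X *m V *m V^t* = X by rewrite -mulmxA VV mulmx1.
rewrite /mxfun !mulmxA VVK -(mulmxA (V^t*) (diag_mx _) (diag_mx _)) mulmx_diag.
rewrite (_ : \row_j _ = map_mx (fun t => f t * g t) d) //.
by apply/rowP => i; rewrite !mxE.
Qed.

Lemma mxfunD f g : mxfun f + mxfun g = mxfun (fun t => f t + g t).
Proof.
rewrite /mxfun -mulmxDl -mulmxDr -raddfD /=.
rewrite (_ : map_mx f d + map_mx g d = map_mx (fun t => f t + g t) d) //.
by apply/rowP => i; rewrite !mxE.
Qed.

Lemma mxfunZ (z : C) f : z *: mxfun f = mxfun (fun t => z * f t).
Proof.
rewrite /mxfun scalemxAl scalemxAr -linearZ /=.
rewrite (_ : z *: map_mx f d = map_mx (fun t => z * f t) d) //.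
by apply/rowP => i; rewrite !mxE.
Qed.

Lemma mxfun_star f : (mxfun f)^t* = mxfun (fun t => (f t)^*).
Proof.
rewrite /mxfun !trmx_mul !map_mxM trmxCK mulmxA.
rewrite tr_diag_mx map_diag_mx.
set d1 := (X in diag_mx X); set d2 := map_mx _ d; suff -> : d1 = d2 by [].
by apply/rowP => i; rewrite !mxE.
Qed.

Lemma vn_spec_row i : vn (row i V) = 1.
Proof.
have /row_unitarymxP/(_ i i) := spectral_unitarymx H.
by rewrite /vn eqxx => ->; rewrite sqrtC1.
Qed.

Lemma mxfun_row f i : row i V *m mxfun f = f (specval i) *: row i V.
Proof.
rewrite /mxfun !mulmxA -row_mul VV -!row_mul mul1mx.
apply/rowP => k; rewrite !mxE (bigD1 i) //= big1 ?addr0 => [|j ji].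
  by rewrite !mxE eqxx mulr1n.
by rewrite !mxE eq_sym (negPf ji) mulr0n mul0r.
Qed.

Lemma mxfun_opn_ge f i : nrm (f (specval i)) <= opn (mxfun f).
Proof.
have := opnP (mxfun f) (row i V).
by rewrite mxfun_row vnZ vn_spec_row !mulr1.
Qed.

Lemma vn_sum_sq (v : 'rV[C]_N) : vn v ^+ 2 = \sum_i nrm (v 0 i) ^+ 2.
Proof.
apply: complexI; rewrite -vn_sq dotmxE mxE rmorph_sum /=.
apply: eq_bigr => i _; rewrite !mxE rmorphXn /= -nrmE.
by rewrite -normCK.
Qed.

Lemma vn_unitary (v : 'rV[C]_N) : vn (v *m V^t*) = vn v.
Proof. by rewrite /vn dotmx_adj trmxCK -mulmxA VV' mulmx1. Qed.

Lemma vn_unitaryr (v : 'rV[C]_N) : vn (v *m V) = vn v.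
Proof. by rewrite /vn dotmx_adj -mulmxA VV mulmx1. Qed.

(** Unitary invariance of [vn] reduces the bound to a diagonal matrix acting on coordinates. *)
Lemma mxfun_opn_le f (c : R) : 0 <= c ->
  (forall i, nrm (f (specval i)) <= c) -> opn (mxfun f) <= c.
Proof.
move=> c0 h; apply: opn_le => // v.
rewrite -(@ler_pXn2r _ 2) ?nnegrE ?mulr_ge0 ?vn_ge0 // exprMn.
rewrite -(vn_unitary v) /mxfun !mulmxA vn_unitaryr.
move: (v *m V^t*) => w; rewrite (vn_sum_sq (w *m _)) (vn_sum_sq w) mulr_sumr.
apply: ler_sum => i _; rewrite mxE (bigD1 i) //= big1 ?addr0 => [|j ji].
  rewrite !mxE eqxx mulr1n nrmcM exprMn mulrC ler_wpM2r ?sqr_ge0 //.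
  by rewrite lerXn2r ?nnegrE ?nrm_ge0 ?h.
by rewrite !mxE (negPf ji) mulr0n mulr0.
Qed.

End MatrixCalculus.

Section FunctionalCalculus.
Local Open Scope sesquilinear_scope.
Variables (R : realType) (N : nat).
Local Notation C := R[i].
Local Notation T := (opmx R N).
Variable H : T.

Definition mfun (f : C -> C) : T := mxfun (H : 'M[C]_N) f.
Local Notation sv := (specval (H : 'M[C]_N)).

Lemma mfun_id : sa H -> mfun id = H.
Proof. exact: mxfun_id. Qed.

Lemma mfun_ext f g : (forall i, f (sv i) = g (sv i)) -> mfun f = mfun g.
Proof. exact: mxfun_ext. Qed.

Lemma mfunM f g : mfun f ** mfun g = mfun (fun t => f t * g t).
Proof. exact: etrans (opmx_mulE _ _) (mxfunM _ f g). Qed.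

Lemma mfunD f g : mfun f + mfun g = mfun (fun t => f t + g t).
Proof. exact: (mxfunD (H : 'M[C]_N) f g). Qed.

Lemma mfunZ (z : C) f : z *: mfun f = mfun (fun t => z * f t).
Proof. exact: (mxfunZ (H : 'M[C]_N) z f). Qed.

Lemma mfunB f g : mfun f - mfun g = mfun (fun t => f t - g t).
Proof.
by rewrite -scaleN1r mfunZ mfunD; apply: mfun_ext => i; rewrite mulN1r.
Qed.

Lemma mfun0 : mfun (fun=> 0) = 0.
Proof.
by rewrite -(scale0r (mfun id)) mfunZ; apply: mfun_ext => i; rewrite mul0r.
Qed.

Lemma mfun1 : mfun (fun=> 1) = 1%:M :> 'M[C]_N.
Proof.
rewrite /mfun /mxfun (_ : map_mx _ (spectral_diag _) = const_mx 1); last first.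
  by apply/rowP => i; rewrite !mxE.
by rewrite diag_const_mx mulmx1 -invmx_unitary ?spectral_unitarymx // mulVmx ?spectral_unit.
Qed.

Lemma mfun_sum (I : Type) (r : seq I) (P : pred I) (F : I -> C -> C) :
  \sum_(i <- r | P i) mfun (F i) = mfun (fun t => \sum_(i <- r | P i) F i t).
Proof.
elim: r => [|i r IH].
  by rewrite big_nil -mfun0; apply: mfun_ext => i; rewrite big_nil.
rewrite big_cons IH; case: ifPn => Pi; last first.
  by apply: mfun_ext => j; rewrite big_cons (negPf Pi).
by rewrite mfunD; apply: mfun_ext => j; rewrite big_cons Pi.
Qed.

Lemma mfun_star f : (mfun f)^# = mfun (fun t => (f t)^*).
Proof. exact: etrans (opmx_starE _) (mxfun_star _ f). Qed.

Lemma mfun_psd f : (forall i, 0 <= f (sv i)) -> psd (mfun f).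
Proof.
move=> h.
pose g (t : C) : C := sqrtc (f t).
suff -> : mfun f = mfun g ** (mfun g)^# by exact: psd_Mstar.
rewrite mfun_star mfunM; apply: mfun_ext => i; rewrite /g.
have g0 : 0 <= sqrtc (f (sv i)) by rewrite sqrtc_ge0 h.
rewrite -[LHS]sqr_sqrtc expr2; congr (_ * _).
by rewrite (ge0_ReE g0); apply/esym; exact: conjc_real.
Qed.

Lemma mfun_nrm_ge f i : nrm (f (sv i)) <= nrm (mfun f).
Proof. exact: mxfun_opn_ge. Qed.

Lemma mfun_nrm_le f (c : R) : 0 <= c ->
  (forall i, nrm (f (sv i)) <= c) -> nrm (mfun f) <= c.
Proof. exact: mxfun_opn_le. Qed.

Lemma specval_sform i : sa H -> exists2 v, vn v = 1 & sform H v v = sv i.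
Proof.
move=> saH; exists (row i (spectralmx (H : 'M[C]_N))); first exact: vn_spec_row.
rewrite unlock; have := mxfun_row (H : 'M[C]_N) id i; rewrite mxfun_id //.
by move=> ->; rewrite dotmxZl vn_sq vn_spec_row expr1n mulr1.
Qed.

Lemma psd_specval i : psd H -> 0 <= sv i.
Proof. by move=> hH; have [v _ <-] := specval_sform i (psd_sa hH); exact: hH. Qed.

Lemma psd_sqrt : psd H -> exists B : T, H = B ** B^#.
Proof.
move=> hH; exists (mfun (@sqrtc R)).
rewrite mfun_star mfunM -[LHS](mfun_id (psd_sa hH)); apply: mfun_ext => i.
have g0 : 0 <= sqrtc (sv i) by rewrite sqrtc_ge0 psd_specval.
rewrite -[LHS]sqr_sqrtc expr2; congr (_ * _).
by rewrite (ge0_ReE g0); apply/esym; exact: conjc_real.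
Qed.

(** Otherwise the maximum of the finitely many |eigenvalues| would be a bound for the norm strictly
    below it. *)
Lemma sa_nrm : sa H -> H != 0 -> exists i, nrm (sv i) = nrm H.
Proof.
move=> saH H0; apply: contrapT => h.
have {}h i : nrm (sv i) < nrm H.
  have := mfun_nrm_ge id i; rewrite (mfun_id saH) => le.
  by rewrite lt_neqAle le andbT; apply/eqP => e; apply: h; exists i.
pose c := \big[Num.max/0]_i nrm (sv i).
have c0 : 0 <= c by apply: bigmax_ge_id.
have : nrm (mfun id) <= c.
  by apply: mfun_nrm_le => // i; apply: (le_bigmax_cond 0 (fun i => nrm (sv i))).
rewrite (mfun_id saH) leNgt => /negP; apply.
by apply/bigmax_ltP; split=> [|i _]; [rewrite nrm_gt0 | exact: h].
Qed.

End FunctionalCalculus.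

Section PsdOrder.
Variables (R : realType) (N : nat).
Local Notation C := R[i].
Local Notation T := (opmx R N).

(** Write P = B B^#; then |v B|^2 is the form of P at v, which is at most that of D. *)
Lemma psd_nrm_le (P D : T) : psd P -> psd (D - P) -> nrm P <= nrm D.
Proof.
move=> hP hD; have [B PB] := psd_sqrt hP.
rewrite PB nrm_Mstar -[leRHS]sqr_sqrtr ?nrm_ge0 //.
rewrite lerXn2r ?nnegrE ?nrm_ge0 ?sqrtr_ge0 //.
apply: opn_le => [|v]; first exact: sqrtr_ge0.
rewrite -(@ler_pXn2r _ 2) ?nnegrE ?mulr_ge0 ?vn_ge0 ?sqrtr_ge0 //.
rewrite exprMn sqr_sqrtr ?nrm_ge0 // -lecR -sform_Mstar -PB.
have := hD v; rewrite sformBl subr_ge0 => /le_trans; apply.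
have := nrm_sform D v v; rewrite -expr2 -lecR -nrmE; apply: le_trans.
have : 0 <= sform D v v.
  by have := addr_ge0 (hD v) (hP v); rewrite -sformDl subrK.
by move=> h; rewrite ger0_norm.
Qed.

End PsdOrder.

(** * Finite dimensional C*-algebras *)

Section RealSpectrum.
Variables (R : realType).
Local Notation C := R[i].

(** After Schur triangularization the trace is the sum of the squares of the real diagonal entries.
    If it is zero, so are these entries, and Cayley-Hamilton gives nilpotency. *)
Lemma trace_sq_real_spectrum n (M : 'M[C]_n) :
  (forall a, eigenvalue M a -> a = (complex.Re a)%:C) ->
  0 <= \tr (M *m M) /\
  (\tr (M *m M) = 0 -> exists k, iter k (mulmx M) 1%:M = 0).
Proof.
case: n M => [|n] M realM.
  split; first by rewrite /mxtrace big_ord0.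
  by move=> _; exists 0%N; apply/matrixP => -[].
have [P Pu] := Schur M (ltn0Sn n).
rewrite /similar_to conjumx ?unitarymx_unit //.
have Pi := unitarymx_unit Pu.
move=> trigPM.
have [D [MD trigD]] : exists D, M = invmx P *m D *m P /\ is_trig_mx D.
  by exists (P *m M *m invmx P); rewrite !mulmxA mulVmx // mul1mx mulmxKV.
have realD i : D i i = (complex.Re (D i i))%:C.
  apply: realM; apply/eigenvalueP.
  have /eigenvalueP[v vD v0] : eigenvalue D (D i i).
    rewrite eigenvalue_root_char char_poly_trig //.
    by apply/rootP; rewrite horner_prod (bigD1 i) //= !hornerE subrr mul0r.
  exists (v *m P); last by apply: contra_neq v0 => h; rewrite -(mulmxK Pi v) h mul0mx.
  by rewrite MD !mulmxA mulmxK // vD scalemxAl.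
have trig (i j : 'I_n.+1) : (i < j)%N -> D i j = 0 by move: i j; apply/is_trig_mxP.
have trE : \tr (M *m M) = \sum_i D i i ^+ 2.
  have -> : M *m M = invmx P *m (D *m D *m P).
    by rewrite {1 2}MD !mulmxA mulmxK.
  rewrite mxtrace_mulC mulmxK //; apply: eq_bigr => i _.
  rewrite mxE (bigD1 i) //= big1 ?addr0 ?expr2 // => j.
  by rewrite neq_ltn => /orP[/trig ->|/trig ->]; rewrite ?mul0r ?mulr0.
have sq0 i : 0 <= D i i ^+ 2.
  by rewrite realD -rmorphXn ler0c sqr_ge0.
split; first by rewrite trE sumr_ge0.
rewrite trE => /eqP; rewrite psumr_eq0 // => /allP D0.
have {}D0 i : D i i = 0.
  by apply/eqP; rewrite -sqrf_eq0; apply: D0; rewrite mem_index_enum.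
have Dn : iter n.+1 (mulmx D) 1%:M = 0.
  have := Cayley_Hamilton D; rewrite char_poly_trig //.
  rewrite (eq_bigr (fun=> 'X)) => [|i _]; last by rewrite D0 subr0.
  rewrite prodr_const card_ord rmorphXn /= horner_mx_X => e.
  suff E k : iter k (mulmx D) 1%:M = D ^+ k by exact: etrans (E n.+1) e.
  by elim: k => [|k IH] //; rewrite exprS -IH.
have E k : iter k (mulmx M) 1%:M = invmx P *m (iter k (mulmx D) 1%:M) *m P.
  elim: k => [|k IH] /=; first by rewrite mulmx1 mulVmx.
  by rewrite IH {1}MD !mulmxA mulmxK.
by exists n.+1; rewrite E Dn mulmx0 mul0mx.
Qed.

End RealSpectrum.

Section Basis.
Variables (R : realType) (T : cstarAlgType R).
Local Notation C := R[i].

(** [finite_dim] supplies only a spanning family; one of minimal size is free, since a nontrivial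
    relation would eliminate one of its elements. *)
Lemma finite_dim_basis : finite_dim T ->
  exists m (e : 'I_m -> T) (co : T -> 'rV[C]_m),
    [/\ forall x, x = \sum_j co x 0 j *: e j,
        forall c : 'rV[C]_m, co (\sum_j c 0 j *: e j) = c &
        linear co].
Proof.
move=> [m0 [e0 sp0]].
pose spans m := `[< exists e : 'I_m -> T,
  forall x, exists c : 'I_m -> C, x = \sum_j c j *: e j >].
have ex : exists m, spans m by exists m0; apply/asboolP; exists e0.
case: (ex_minnP ex) => m /asboolP[e sp] min.
have free (c : 'I_m -> C) : \sum_j c j *: e j = 0 -> forall j, c j = 0.
  move=> c0 i; apply: contrapT => /eqP ci.
  case: m e sp min c c0 i ci => [|m] e sp min c c0 i ci; first by case: i ci.
  suff : spans m by move/min; rewrite ltnn.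
  apply/asboolP; exists (fun j => e (lift i j)) => x; have [d ->] := sp x.
  exists (fun j => d (lift i j) - d i * (c i)^-1 * c (lift i j)).
  have ei : e i = - \sum_j ((c i)^-1 * c (lift i j)) *: e (lift i j).
    move: c0; rewrite (bigD1_ord i) //= => /eqP; rewrite addr_eq0 => /eqP h.
    rewrite -[LHS](scalerK ci) h scalerN scaler_sumr; congr (- _).
    by apply: eq_bigr => j _; rewrite scalerA.
  rewrite (bigD1_ord i) //= ei scalerN scaler_sumr addrC -sumrB.
  by apply: eq_bigr => j _; rewrite scalerBl scalerA mulrA.
have [co0 co0P] := choice sp.
pose co x : 'rV[C]_m := \row_j co0 x j.
have coE x : x = \sum_j co x 0 j *: e j.
  by rewrite [LHS]co0P; apply: eq_bigr => j _; rewrite mxE.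
have uniq (c d : 'rV[C]_m) :
    \sum_j c 0 j *: e j = \sum_j d 0 j *: e j -> c = d.
  move=> /eqP; rewrite -subr_eq0 -sumrB => /eqP h; apply/rowP => j.
  apply/eqP; rewrite -subr_eq0; apply/eqP.
  apply: (free (fun j => c 0 j - d 0 j)); rewrite -[RHS]h.
  by apply: eq_bigr => i _; rewrite scalerBl.
exists m, e, co; split => //.
  by move=> c; apply: uniq; rewrite -coE.
move=> z x y; apply: uniq; rewrite -coE {1}(coE x) {1}(coE y).
rewrite scaler_sumr -big_split; apply: eq_bigr => j _ /=.
by rewrite scalerA -scalerDl !mxE.
Qed.

End Basis.

Definition star_hom (R : realType) (A B : cstarAlgType R) (f : A -> B) : Prop :=
  [/\ linear f, (forall a b, f (a ** b) = f a ** f b) & (forall a, f a^# = (f a)^#)].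

Section Similarity.
Variables (R : realType) (B : cstarAlgType R) (s si g one : B).
Hypotheses (one_l : forall b : B, one ** b = b) (one_r : forall b : B, b ** one = b).
Hypotheses (ssi : s ** si = one) (sis : si ** s = one) (ss : s ** s = g).

Lemma similarM x y : si ** (x ** y) ** s = si ** x ** s ** (si ** y ** s).
Proof. by rewrite -!cmulA (cmulA s) ssi one_l. Qed.

Lemma similar_inj x : si ** x ** s = 0 -> x = 0.
Proof.
move=> h; rewrite -[x]one_l -[LHS]one_r -ssi -!cmulA (cmulA si) (cmulA _ s).
by rewrite h cmul0l cmul0r.
Qed.

(** The hypothesis on x and y says that y is the adjoint of x for the form g; conjugation by the
    square root s of g turns it into the ordinary adjoint. *)
Lemma similar_star x y : sa s -> sa si -> x ** g = g ** y^# ->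
  si ** x ** s = (si ** y ** s)^#.
Proof.
rewrite /sa => Hs Hsi xg; rewrite !cstarM Hs Hsi -[LHS]one_r -ssi.
by rewrite -!cmulA (cmulA s s) ss (cmulA x) xg -ss !cmulA sis one_l.
Qed.

End Similarity.

(* The trace of the regular representation is faithful, since self-adjoint elements
   act with real spectrum.  Conjugating the regular representation by the square
   root of the Gram matrix of this trace makes it a star-homomorphism. *)
Section Representation.
Local Open Scope sesquilinear_scope.
Variables (R : realType) (T : cstarAlgType R).
Local Notation C := R[i].
Variables (m : nat) (e : 'I_m -> T) (co : T -> 'rV[C]_m).
Hypothesis coE : forall x, x = \sum_j co x 0 j *: e j.
Hypothesis coK : forall c : 'rV[C]_m, co (\sum_j c 0 j *: e j) = c.
Hypothesis co_lin : linear co.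

Let coD x y : co (x + y) = co x + co y.
Proof. by have := co_lin 1 x y; rewrite !scale1r. Qed.
Let co0 : co 0 = 0.
Proof. by apply: (addIr (co 0)); rewrite -coD !add0r. Qed.
Let coZ (z : C) x : co (z *: x) = z *: co x.
Proof. by have := co_lin z x 0; rewrite co0 !addr0. Qed.
Let co_sum (F : 'I_m -> T) : co (\sum_i F i) = \sum_i co (F i).
Proof. exact: (big_morph co coD co0). Qed.
Let co_inj x y : co x = co y -> x = y.
Proof. by move=> h; rewrite (coE x) (coE y) h. Qed.

(** Right multiplication, since coordinates are rows: this makes [rmx] multiplicative rather than
    antimultiplicative. *)
Definition rmx (y : T) : 'M[C]_m := \matrix_i co (e i ** y).

Lemma rmxP x y : co (x ** y) = co x *m rmx y.
Proof.
rewrite {1}(coE x) cmul_suml co_sum mulmx_sum_row.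
by apply: eq_bigr => i _; rewrite cmulZl coZ rowK.
Qed.

Lemma rmx_lin : linear rmx.
Proof.
move=> z x y; apply/matrixP => i j; rewrite !mxE cmulDr cmulZr coD coZ.
by rewrite !mxE.
Qed.

Lemma row_ext (M M' : 'M[C]_m) :
  (forall x, co x *m M = co x *m M') -> M = M'.
Proof.
move=> h; apply/row_matrixP => i; rewrite !rowE.
by have := h (\sum_j (delta_mx 0 i : 'rV[C]_m) 0 j *: e j); rewrite coK.
Qed.

Lemma rmxM x y : rmx (x ** y) = rmx x *m rmx y.
Proof. by apply: row_ext => z; rewrite -rmxP mulmxA -!rmxP cmulA. Qed.

(** No unit of T is at hand to evaluate at; y^# serves instead, giving y^# ** y = 0. *)
Lemma rmx_inj y : rmx y = 0 -> y = 0.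
Proof.
move=> h; apply: starM_eq0; apply: co_inj.
by rewrite rmxP h mulmx0 co0.
Qed.

Definition tau (x : T) : C := \tr (rmx x).

Lemma tauC x y : tau (x ** y) = tau (y ** x).
Proof. by rewrite /tau !rmxM mxtrace_mulC. Qed.

Lemma tauD x y : tau (x + y) = tau x + tau y.
Proof. by have := rmx_lin 1 x y; rewrite /tau !scale1r => ->; rewrite raddfD. Qed.

Lemma tauZ (z : C) x : tau (z *: x) = z * tau x.
Proof.
have r0 : rmx 0 = 0 by apply/matrixP => i j; rewrite !mxE cmul0r co0 mxE.
by have := rmx_lin z x 0; rewrite /tau r0 !addr0 => ->; rewrite mxtraceZ.
Qed.

(** From y ** b = a *: y follows y ** b ** y^# = a *: (y ** y^#), where both products are
    self-adjoint and the second is nonzero. *)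
Lemma sa_real_spectrum b : sa b ->
  forall a, eigenvalue (rmx b) a -> a = (complex.Re a)%:C.
Proof.
move=> sab a /eigenvalueP[v vb v0].
pose y := \sum_j v 0 j *: e j.
have yb : y ** b = a *: y by apply: co_inj; rewrite rmxP /y coK vb coZ coK.
have y0 : y ** y^# != 0.
  apply: contra_neq v0 => h; rewrite -(coK v) -/y.
  by rewrite -(cstarK y) (@starM_eq0 _ _ y^#) ?cstarK // cstar0 co0.
have := sa_Mstar y; rewrite /sa.
have : (y ** b ** y^#)^# = y ** b ** y^# by rewrite !cstarM cstarK sab cmulA.
rewrite yb cmulZl cstarZ => h1 h2; move: h1; rewrite h2 => /eqP.
rewrite -subr_eq0 -scalerBl scaler_eq0 (negPf y0) orbF subr_eq0 => /eqP h.
by apply/esym/RRe_real/CrealP.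
Qed.

(** A zero trace makes right multiplication by b nilpotent, so some power of b vanishes, and the
    norms of its powers with exponents 2^k force b = 0. *)
Lemma tau_sa b : sa b -> 0 <= tau (b ** b) /\ (tau (b ** b) = 0 -> b = 0).
Proof.
move=> sab; rewrite /tau rmxM.
have [t0 tn] := trace_sq_real_spectrum (sa_real_spectrum sab); split=> // /tn[k kn].
have h n y : co y *m iter n (mulmx (rmx b)) 1%:M = co (iter n (fun x => x ** b) y).
  elim: n y => [|n IH] y; first by rewrite mulmx1.
  by rewrite iterS mulmxA -rmxP IH iterSr.
have itE n : iter n (fun x => x ** b) b = cpow b n.
  elim: n => [|n IH] //=; rewrite IH.
  by elim: n {IH} => [|n IH] //=; rewrite -cmulA IH.
have bk : cpow b k = 0 by apply: co_inj; rewrite -itE -h kn mulmx0 co0.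
have b0 n : cpow b (k + n) = 0.
  by elim: n => [|n IH]; rewrite ?addn0 // addnS cpowS IH cmul0r.
have : nrm (sqiter k b) = 0.
  have le : (k <= (2 ^ k).-1)%N by rewrite -ltnS prednK ?expn_gt0 // ltn_expl.
  by rewrite sqiter_cpow -(subnKC le) b0 nrm0.
by rewrite nrm_sqiter // => /eqP; rewrite expf_eq0 => /andP[_ /eqP/nrm0_eq0].
Qed.

Lemma tau_sum (F : 'I_m -> T) : tau (\sum_i F i) = \sum_i tau (F i).
Proof.
have t0 : tau 0 = 0 by rewrite -(scale0r 0) tauZ mul0r.
exact: (big_morph tau tauD t0).
Qed.

(** For x = b + i c the mixed terms cancel under the trace, leaving [tau_sa] for b and c. *)
Lemma tau_Mstar x : 0 <= tau (x ** x^#) /\ (tau (x ** x^#) = 0 -> x = 0).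
Proof.
have [b [c [sab sac ->]]] := re_im x.
have xs : (b + 'i%C *: c)^# = b + - 'i%C *: c.
  rewrite cstarD cstarZ sab sac; congr (_ + _ *: _).
  by apply/eqP; rewrite eq_complex /= oppr0 !eqxx.
have tE : tau ((b + 'i%C *: c) ** (b + 'i%C *: c)^#) = tau (b ** b) + tau (c ** c).
  rewrite xs cmulDl !cmulDr !cmulZl !cmulZr !tauD !tauZ (tauC c b).
  have i2 : 'i%C * - 'i%C = 1 :> C by rewrite mulrN -expr2 sqr_i opprK.
  by rewrite mulrA i2 mul1r mulNr -addrA; congr (_ + _); rewrite addrA addNr add0r.
rewrite tE; have [b0 bn] := tau_sa sab; have [c0 cn] := tau_sa sac.
split; first exact: addr_ge0.
by move/eqP; rewrite paddr_eq0 // => /andP[/eqP/bn -> /eqP/cn ->]; rewrite scaler0 addr0.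
Qed.

Definition gram : opmx R m := \matrix_(i, j) tau (e i ** (e j)^#).

Lemma gramP x y : sform gram (co x) (co y) = tau (x ** y^#).
Proof.
rewrite unlock dotmxE mxE {2}(coE x) {2}(coE y) cstar_sum cmul_sumr tau_sum.
apply: eq_bigr => j _; rewrite cmul_suml tau_sum !mxE mulr_suml.
by apply: eq_bigr => i _; rewrite !mxE cstarZ cmulZl cmulZr !tauZ mulrAC mulrA.
Qed.

Lemma co_surj (v : 'rV[C]_m) : exists x, v = co x.
Proof. by exists (\sum_j v 0 j *: e j); rewrite coK. Qed.

Lemma gram_psd : psd gram.
Proof.
by move=> v; have [x ->] := co_surj v; rewrite gramP; case: (tau_Mstar x).
Qed.

Lemma gram_specval i : 0 < specval (gram : 'M[C]_m) i.
Proof.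
rewrite lt_neqAle psd_specval ?andbT; last exact: gram_psd.
have [v v1 <-] := specval_sform i (psd_sa gram_psd).
have [x vx] := co_surj v; rewrite vx gramP eq_sym; apply/eqP.
case: (tau_Mstar x) => _ h /h x0.
by move: v1; rewrite vx x0 co0 vn0 => /esym/eqP; rewrite oner_eq0.
Qed.

Let S : opmx R m := mfun gram (@sqrtc R).
Let Si : opmx R m := mfun gram (fun t => (sqrtc t)^-1).
Let one : opmx R m := (1%:M : 'M[C]_m).

Let one_l (M : opmx R m) : one ** M = M.
Proof. exact: etrans (opmx_mulE _ _) (mul1mx _). Qed.
Let one_r (M : opmx R m) : M ** one = M.
Proof. exact: etrans (opmx_mulE _ _) (mulmx1 _). Qed.

Let sq_neq0 i : sqrtc (specval (gram : 'M[C]_m) i) != 0.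
Proof. by rewrite sqrtc_eq0 gt_eqF // gram_specval. Qed.

Let SSi : S ** Si = one.
Proof. by rewrite mfunM; apply: etrans (mfun1 gram); apply: mfun_ext => i; rewrite mulfV. Qed.
Let SiS : Si ** S = one.
Proof. by rewrite mfunM; apply: etrans (mfun1 gram); apply: mfun_ext => i; rewrite mulVf. Qed.
Let SS : S ** S = gram.
Proof.
rewrite mfunM -[RHS](mfun_id (psd_sa gram_psd)); apply: mfun_ext => i.
by rewrite -expr2 sqr_sqrtc.
Qed.

Let sqJ i : (sqrtc (specval (gram : 'M[C]_m) i))^* = sqrtc (specval (gram : 'M[C]_m) i).
Proof.
have g0 : 0 <= sqrtc (specval (gram : 'M[C]_m) i) by rewrite sqrtc_ge0 ltW ?gram_specval.
by rewrite (ge0_ReE g0); exact: conjc_real.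
Qed.

Let Sstar : S^# = S.
Proof. by rewrite mfun_star; apply: mfun_ext => i; exact: sqJ. Qed.
Let Sistar : Si^# = Si.
Proof.
by rewrite mfun_star; apply: mfun_ext => i; rewrite fmorphV; congr (_^-1); exact: sqJ.
Qed.

Let rop (y : T) : opmx R m := rmx y.

Let rop_gram y : rop y ** gram = gram ** (rop y^#)^#.
Proof.
apply/matrixP => i j; rewrite -!sform_delta.
have [x ->] := co_surj (delta_mx 0 i); have [w ->] := co_surj (delta_mx 0 j).
have -> : sform (rop y ** gram) (co x) (co w) = tau (x ** y ** w^#).
  rewrite -gramP rmxP unlock opmx_mulE mulmxA //.
rewrite unlock opmx_mulE opmx_starE mulmxA dotmx_adj trmxCK -rmxP.
have := gramP x (w ** y^#); rewrite unlock => ->.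
by rewrite cstarM cstarK cmulA.
Qed.

Definition rep (y : T) : opmx R m := Si ** rop y ** S.

Lemma rep_hom : star_hom rep.
Proof.
have rop_lin : linear rop := rmx_lin.
have ropM x y : rop (x ** y) = rop x ** rop y.
  exact: etrans (rmxM x y) (esym (opmx_mulE _ _)).
split.
- by move=> z x y; rewrite /rep rop_lin cmulDr cmulDl cmulZr cmulZl.
- by move=> x y; rewrite /rep ropM (similarM one_l SSi).
- move=> y; apply: (similar_star one_l one_r SSi SiS SS Sstar Sistar).
  by rewrite rop_gram cstarK.
Qed.

Lemma rep_inj y : rep y = 0 -> y = 0.
Proof. by move=> h; apply: rmx_inj; exact: (similar_inj one_l one_r SSi h). Qed.

End Representation.

Lemma finite_dim_rep (R : realType) (T : cstarAlgType R) : finite_dim T ->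
  exists N (p : T -> opmx R N), star_hom p /\ injective p.
Proof.
move=> /finite_dim_basis[m [e [co [coE coK co_lin]]]].
exists m, (rep e co); have hom := rep_hom coE coK co_lin; split => // x y h.
apply/eqP; rewrite -subr_eq0; apply/eqP; apply: (rep_inj coE coK co_lin).
have [lin _ _] := hom.
by rewrite -scaleN1r addrC lin h scaleN1r addNr.
Qed.

(** Taking roots of order 2^k removes the constant K; concretely, Bernoulli's inequality makes the
    powers of a ratio above 1 exceed K. *)
Lemma pow2_le (R : realType) (K a c : R) : 0 <= a -> 0 <= c ->
  (forall k, a ^+ (2 ^ k) <= K * c ^+ (2 ^ k)) -> a <= c.
Proof.
move=> a0 c0 h; rewrite leNgt; apply/negP => ca.
have [c00|cn] := eqVneq c 0.
  by have := h 0%N; rewrite expn0 !expr1 c00 mulr0 leNgt -{1}c00 ca.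
have cp : 0 < c by rewrite lt_neqAle eq_sym cn.
have hK k : (a / c) ^+ (2 ^ k) <= K by rewrite expr_div_n ler_pdivrMr ?exprn_gt0.
pose d := a / c - 1.
have d0 : 0 < d by rewrite subr_gt0 ltr_pdivlMr ?mul1r.
have bern n : n%:R * d <= (a / c) ^+ n.
  suff : 1 + n%:R * d <= (a / c) ^+ n by apply: le_trans; rewrite lerDr.
  elim: n => [|n IH]; first by rewrite mul0r addr0 expr0.
  have rE : a / c = 1 + d by rewrite /d addrC subrK.
  rewrite exprS rE; rewrite rE in IH.
  have n0 : 0 <= n%:R * d by rewrite mulr_ge0 ?ler0n // ltW.
  have : (1 + d) * (1 + n%:R * d) <= (1 + d) * (1 + d) ^+ n.
    by rewrite ler_wpM2l // addr_ge0 // ltW.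
  apply: le_trans; rewrite -natr1; nra.
have [n Kn] : exists n, K / d < n%:R.
  by exists (Num.truncn (K / d)).+1; exact: truncnS_gt.
have := hK n; rewrite leNgt => /negP; apply.
rewrite (lt_le_trans _ (bern _)) // -ltr_pdivrMr // (lt_trans Kn) //.
by rewrite ltr_nat ltn_expl.
Qed.

(** * Faithful representations of finite dimensional algebras *)

Section StarHom.
Variables (R : realType) (A B : cstarAlgType R) (f : A -> B).
Local Notation C := R[i].
Hypothesis hom : star_hom f.

Lemma hom0 : f 0 = 0.
Proof. by case: hom => lin _ _; have := lin (-1) 0 0; rewrite scaler0 addr0 scaleN1r addNr. Qed.

Lemma homD x y : f (x + y) = f x + f y.
Proof. by case: hom => lin _ _; have := lin 1 x y; rewrite !scale1r. Qed.

Lemma homZ (z : C) x : f (z *: x) = z *: f x.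
Proof. by case: hom => lin _ _; have := lin z x 0; rewrite hom0 !addr0. Qed.

Lemma homN x : f (- x) = - f x.
Proof. by rewrite -scaleN1r homZ scaleN1r. Qed.

Lemma homB x y : f (x - y) = f x - f y.
Proof. by rewrite homD homN. Qed.

Lemma homM x y : f (x ** y) = f x ** f y.
Proof. by case: hom. Qed.

Lemma hom_star x : f x^# = (f x)^#.
Proof. by case: hom. Qed.

Lemma hom_sum (I : Type) (r : seq I) (P : pred I) (F : I -> A) :
  f (\sum_(i <- r | P i) F i) = \sum_(i <- r | P i) f (F i).
Proof. exact: (big_morph f homD hom0). Qed.

Lemma hom_sqiter k x : f (sqiter k x) = sqiter k (f x).
Proof. by elim: k => //= k IH; rewrite homM IH. Qed.

Lemma hom_cp : completely_positive f.
Proof.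
split; first by case: hom.
move=> n M; exists (map_mx f M); apply/matrixP => i j; rewrite !mxE hom_sum.
by apply: eq_bigr => k _; rewrite homM !mxE hom_star.
Qed.

End StarHom.

Section FinDim.
Variables (R : realType) (T : cstarAlgType R) (N : nat) (p : T -> opmx R N).
Hypotheses (hom : star_hom p) (inj : injective p).
Local Notation C := R[i].

Lemma hom_sa b : sa b -> sa (p b).
Proof. by move=> sab; rewrite /sa -(hom_star hom) sab. Qed.

Section Lift.
Variable b : T.
Hypothesis sab : sa b.
Local Notation sv := (specval (p b : 'M[C]_N)).

(** Lagrange interpolation by polynomials without constant term: start with t / l and multiply by (t
    - u) / (l - u). Such polynomials in b stay in T without using a unit. *)
Let lift (l : C) (s : seq C) : l != 0 -> exists g : C -> C,
  [/\ exists y, p y = mfun (p b) g, g l = 1 & forall t, t \in s -> t != l -> g t = 0].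
Proof.
move=> l0; elim: s => [|u s [g [[y py] gl gs]]].
  exists (fun t => l^-1 * t); split => //; last by rewrite mulVf.
  exists (l^-1 *: b); rewrite (homZ hom) -{1}(mfun_id (hom_sa sab)) mfunZ.
  by apply: mfun_ext.
have [ul|ul] := eqVneq u l.
  exists g; split => // [|t]; first by exists y.
  by rewrite in_cons => /orP[/eqP->|/gs //]; rewrite ul eqxx.
have lu : l - u != 0 by rewrite subr_eq0 eq_sym.
exists (fun t => (l - u)^-1 * (g t * t - u * g t)); split.
- exists ((l - u)^-1 *: (y ** b - u *: y)).
  rewrite (homZ hom) (homB hom) (homM hom) (homZ hom) py.
  rewrite -[X in _ ** X](mfun_id (hom_sa sab)) mfunM (mfunZ _ u).
  by rewrite mfunB mfunZ.
- by rewrite gl mul1r mulr1 mulVf.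
- move=> t; rewrite in_cons => /orP[/eqP->|ts] tl; last by rewrite gs // mul0r mulr0 subr0 mulr0.
  by rewrite mulrC [g u * u]mulrC subrr mul0r.
Qed.

Definition eigval : seq C := undup [seq l <- codom sv | l != 0].

Lemma eigproj_lift (l : C) : l != 0 ->
  exists q, p q = mfun (p b) (fun t => (t == l)%:R).
Proof.
move=> l0; have [g [[y py] gl gs]] := lift (codom sv) l0.
exists y; rewrite py; apply: mfun_ext => i.
by have [->|ne] := eqVneq (sv i) l; [rewrite gl | rewrite gs ?codom_f].
Qed.

Lemma eigval_sum (f : C -> C) : f 0 = 0 ->
  mfun (p b) f = \sum_(l <- eigval) f l *: mfun (p b) (fun t => (t == l)%:R).
Proof.
move=> f0; under eq_bigr do rewrite mfunZ.
rewrite mfun_sum; apply: mfun_ext => i.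
have [si|si] := eqVneq (sv i) 0.
  rewrite si f0 big_seq big1 // => l; rewrite mem_undup mem_filter => /andP[l0 _].
  by rewrite eq_sym (negPf l0) mulr0.
rewrite (bigD1_seq (sv i)) ?undup_uniq //=; last first.
  by rewrite mem_undup mem_filter si codom_f.
rewrite eqxx mulr1 big1 ?addr0 // => l li.
by rewrite eq_sym (negPf li) mulr0.
Qed.

(** The condition f 0 = 0 is there because [p] need not reach the identity matrix: only spectral
    projections at nonzero eigenvalues are lifted. *)
Lemma mfun_lift (f : C -> C) : f 0 = 0 -> exists y, p y = mfun (p b) f.
Proof.
move=> f0; rewrite (eigval_sum f0).
have : all (fun l => l != 0) eigval.
  by apply/allP => l; rewrite mem_undup mem_filter => /andP[].
elim: eigval => [|l s IH] /=.
  by move=> _; exists 0; rewrite big_nil (hom0 hom).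
move=> /andP[l0 /IH[y py]]; have [q pq] := eigproj_lift l0.
by exists (f l *: q + y); rewrite big_cons (homD hom) (homZ hom) pq py.
Qed.

End Lift.

(** Real and imaginary parts are combinations of their spectral projections, which lie in T; so the
    idempotents span T. *)
Lemma idem_ind (P : T -> Prop) :
  P 0 -> (forall (z : C) x y, P x -> P y -> P (z *: x + y)) ->
  (forall q, q ** q = q -> P q) -> forall a, P a.
Proof.
move=> P0 Plin Pid.
have Psa b : sa b -> P b.
  move=> sab.
  suff [y py Py] : exists2 y, p y = mfun (p b) id & P y.
    by move: py; rewrite (mfun_id (hom_sa sab)) => /inj <-.
  rewrite (@eigval_sum b id) //.
  have : all (fun l => l != 0) (eigval b).
    by apply/allP => l; rewrite mem_undup mem_filter => /andP[].
  elim: (eigval b) => [|l s IH] /=.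
    by move=> _; exists 0 => //; rewrite big_nil (hom0 hom).
  move=> /andP[l0 /IH[y py Py]]; have [q pq] := eigproj_lift sab l0.
  exists (l *: q + y); first by rewrite big_cons (homD hom) (homZ hom) pq py.
  apply: Plin Py; apply: Pid; apply: inj; rewrite (homM hom) pq mfunM.
  by apply: mfun_ext => i; rewrite -natrM mulnb andbb.
move=> a; have [b [c [sab sac ->]]] := re_im a.
by rewrite addrC; apply: Plin; apply: Psa.
Qed.

(** The norm of p h is attained at an eigenvalue l. Its projection lifts to some q in T, and h ** q
    = l *: q already holds in T. *)
Lemma rep_nrm_le x : nrm (p x) <= nrm x.
Proof.
have sah := sa_starM x; set h := x^# ** x in sah.
suff le : nrm (p h) <= nrm h.
  by move: le; rewrite /h (homM hom) (hom_star hom) !nrm_starM ler_pXn2r ?nnegrE ?nrm_ge0.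
have [->|ph0] := eqVneq (p h) 0; first by rewrite nrm0 nrm_ge0.
have [i il] := sa_nrm (hom_sa sah) ph0; set l := specval _ i in il.
have l0 : l != 0 by rewrite -nrm_gt0 il nrm_gt0.
have [q pq] := eigproj_lift sah l0.
have q0 : 0 < nrm q.
  rewrite nrm_gt0; apply/eqP => q0; move: pq; rewrite q0 (hom0 hom) => e.
  have := mfun_nrm_ge (p h) (fun t => (t == l)%:R) i.
  by rewrite -e eqxx nrm0 nrm_real normr1 ler10.
have hq : h ** q = l *: q.
  apply: inj; rewrite (homM hom) (homZ hom) pq -{1}(mfun_id (hom_sa sah)) mfunM mfunZ.
  by apply: mfun_ext => j; have [->|] := eqVneq (specval _ j) l; rewrite ?mulr0.
by rewrite -il -(ler_pM2r q0) -nrmZ -hq nrmM.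
Qed.

(** In T, the power of h with exponent 2^k is the sum of l^(2^k) q_l. The norms of the q_l in T are
    not known beforehand, but they form a constant that [pow2_le] removes. *)
Lemma rep_nrm_ge x : nrm x <= nrm (p x).
Proof.
have sah := sa_starM x; set h := x^# ** x in sah.
suff le : nrm h <= nrm (p h).
  by move: le; rewrite /h (homM hom) (hom_star hom) !nrm_starM ler_pXn2r ?nnegrE ?nrm_ge0.
have qx (l : C) : exists q, l != 0 -> p q = mfun (p h) (fun t => (t == l)%:R).
  have [->|l0] := eqVneq l 0; first by exists 0.
  by have [q pq] := eigproj_lift sah l0; exists q.
have [q qP] := choice qx.
apply: (@pow2_le _ (\sum_(l <- eigval h) nrm (q l))); rewrite ?nrm_ge0 // => k.
rewrite -(nrm_sqiter k sah).
have sqE j : sqiter j (p h) = mfun (p h) (fun t => t ^+ (2 ^ j)).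
  elim: j => [|j IH] /=.
    by rewrite -{1}(mfun_id (hom_sa sah)); apply: mfun_ext => i; rewrite expn0 expr1.
  by rewrite IH mfunM; apply: mfun_ext => i; rewrite -exprD addnn -mul2n -expnS.
have mem l : l \in eigval h -> l != 0 /\ nrm l <= nrm (p h).
  rewrite mem_undup mem_filter => /andP[l0 lc]; case/codomP: lc l0 => i -> s0; split=> //.
  by have := mfun_nrm_ge (p h) id i; rewrite (mfun_id (hom_sa sah)).
have -> : sqiter k h = \sum_(l <- eigval h) l ^+ (2 ^ k) *: q l.
  apply: inj; rewrite (hom_sqiter hom) sqE eigval_sum; last first.
    by rewrite expr0n; case: (2 ^ k)%N (expn_gt0 2 k).
  rewrite (hom_sum hom) big_seq [RHS]big_seq; apply: eq_bigr => l /mem[l0 _].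
  by rewrite (homZ hom) qP.
rewrite (le_trans (nrm_sum _ _ _)) // mulr_suml big_seq [leRHS]big_seq.
apply: ler_sum => l /mem[l0 le]; rewrite nrmZ mulrC ler_wpM2l ?nrm_ge0 //.
have -> : nrm (l ^+ (2 ^ k)) = nrm l ^+ (2 ^ k).
  by apply: complexI; rewrite -nrmE normrX nrmE rmorphXn.
by rewrite lerXn2r ?nnegrE ?nrm_ge0.
Qed.

Lemma rep_nrm x : nrm (p x) = nrm x.
Proof. by apply/le_anti; rewrite rep_nrm_le rep_nrm_ge. Qed.

Lemma rep_psd_cpos x : psd (p x) -> cpos x.
Proof.
move=> px; have sax : sa x by apply: inj; rewrite (hom_star hom); exact: psd_sa px.
have [w pw] := mfun_lift sax (sqrtc0 R).
exists w; apply: inj; rewrite (homM hom) (hom_star hom) pw mfun_star mfunM.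
rewrite -[LHS](mfun_id (psd_sa px)); apply: mfun_ext => i.
have g0 : 0 <= sqrtc (specval (p x : 'M[C]_N) i) by rewrite sqrtc_ge0 psd_specval.
rewrite -[LHS]sqr_sqrtc expr2; congr (_ * _).
by rewrite (ge0_ReE g0); apply/esym; exact: conjc_real.
Qed.

Lemma cpos_rep_psd x : cpos x -> psd (p x).
Proof.
by move=> [w ->]; rewrite (homM hom) (hom_star hom); exact: psd_starM.
Qed.

End FinDim.

(** * Units of ideals *)

Lemma psd_sform0 (R : realType) N (P : opmx R N) (v : 'rV[R[i]]_N) :
  psd P -> sform P v v = 0 -> v *m (P : 'M[R[i]]_N) = 0.
Proof.
move=> /psd_sqrt[B ->]; rewrite sform_Mstar => /complexI/eqP.
rewrite sqrf_eq0 => /eqP/vn_eq0 vB.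
by rewrite opmx_mulE mulmxA vB mul0mx.
Qed.

Lemma kermx_rank_sub (F : fieldType) n (M M' : 'M[F]_n) :
  (kermx M' <= kermx M)%MS -> (\rank M' <= \rank M)%N -> (kermx M <= kermx M')%MS.
Proof.
move=> sub le; have [rle <-] := mxrank_leqif_sup sub.
by rewrite eqn_leq rle /= !mxrank_ker leq_sub2l.
Qed.

Definition ideal (R : realType) (T : cstarAlgType R) (J : set T) : Prop :=
  [/\ J 0, (forall (z : R[i]) a b, J a -> J b -> J (z *: a + b)),
      (forall x a, J a -> J (x ** a)) & (forall x a, J a -> J (a ** x))].

Section IdealUnit.
Local Open Scope sesquilinear_scope.
Variables (R : realType) (T : cstarAlgType R) (N : nat) (p : T -> opmx R N).
Hypotheses (hom : star_hom p) (inj : injective p).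
Local Notation C := R[i].
Local Notation px x := (p x : 'M[C]_N).

(** Take b positive in J of maximal rank. Adding x ** x^# to b cannot shrink its kernel, so every x
    in J vanishes on the kernel of b, and the support projection of b is a left unit. *)
Let left_unit (J : set T) : ideal J ->
  exists z, [/\ J z, sa z & forall x, J x -> z ** x = x].
Proof.
move=> [J0 Jlin Jl Jr].
pose rk k := `[< exists b, [/\ J b, psd (p b) & \rank (px b) = k] >].
have ex : exists k, rk k.
  by exists (\rank (px 0)); apply/asboolP; exists 0; split; rewrite ?(hom0 hom) //; exact: psd0.
have bd k : rk k -> (k <= N)%N by move=> /asboolP[b [_ _ <-]]; exact: rank_leq_row.
case: (ex_maxnP ex bd) => r /asboolP[b [Jb psdb rb]] max.
have sab : sa b by apply: inj; rewrite (hom_star hom); exact: psd_sa psdb.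
have ker x (v : 'rV[C]_N) : J x -> v *m px b = 0 -> v *m px x = 0.
  move=> Jx; pose b' := b + x ** x^#.
  have Jb' : J b' by rewrite /b' -[b]scale1r; apply: Jlin => //; exact: Jr.
  have pb' : p b' = p b + p x ** (p x)^# by rewrite (homD hom) (homM hom) (hom_star hom).
  have psdb' : psd (p b') by rewrite pb'; apply: psdD => //; exact: psd_Mstar.
  have ker' (w : 'rV[C]_N) : w *m px b' = 0 -> w *m px b = 0 /\ w *m px x = 0.
    move=> wb'; have : sform (p b') w w = 0 by rewrite unlock wb' /dotmx linear0l.
    rewrite pb' sformDl => /eqP; rewrite paddr_eq0; [|exact: psdb|exact: psd_Mstar].
    move=> /andP[/eqP h1 /eqP h2]; split; first exact: psd_sform0.
    move: h2; rewrite sform_Mstar => /complexI/eqP.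
    by rewrite sqrf_eq0 => /eqP/vn_eq0.
  have sub : (kermx (px b') <= kermx (px b))%MS.
    apply/rV_subP => w /sub_kermxP /ker'[wb _]; exact/sub_kermxP.
  have rk' : (\rank (px b') <= r)%N by apply: max; apply/asboolP; exists b'.
  move=> vb.
  have sub' : (kermx (px b) <= kermx (px b'))%MS.
    by apply: kermx_rank_sub sub _; rewrite rb.
  have : (v <= kermx (px b'))%MS by apply: submx_trans sub'; exact/sub_kermxP.
  by move=> /sub_kermxP /ker'[].
(* The convention 0^-1 = 0 makes w the generalized inverse of b, and w ** b its support
   projection. *)
have [w pw] := mfun_lift hom sab (invr0 C).
pose z := w ** b.
have pz : p z = mfun (p b) (fun t => t^-1 * t).
  by rewrite (homM hom) pw -[X in _ ** X](mfun_id (hom_sa hom sab)) mfunM.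
exists z; split; first exact: Jl.
  apply: inj; rewrite (hom_star hom) pz mfun_star; apply: mfun_ext => i.
  by rewrite (specval_real i (hom_sa hom sab)) -fmorphV -rmorphM; exact: conjc_real.
move=> x Jx; apply/eqP; rewrite -subr_eq0; apply/eqP; apply: inj.
rewrite (hom0 hom).
have zb : (px z - 1%:M) *m px b = 0.
  rewrite mulmxBl mul1mx; apply/eqP; rewrite subr_eq0; apply/eqP.
  apply: etrans (esym (opmx_mulE _ _)) _; rewrite pz.
  rewrite -[X in _ ** X](mfun_id (hom_sa hom sab)) mfunM -[RHS](mfun_id (hom_sa hom sab)).
  apply: mfun_ext => i; have [->|t0] := eqVneq (specval (px b) i) 0; first by rewrite mulr0.
  by rewrite mulVf ?mul1r.
have : (px z - 1%:M) *m px x = 0.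
  apply/row_matrixP => i; rewrite row_mul row0; apply: ker => //.
  by rewrite -row_mul zb row0.
rewrite mulmxBl mul1mx => /eqP; rewrite subr_eq0 => /eqP e.
apply/eqP; rewrite (homB hom) subr_eq0 (homM hom); apply/eqP.
exact: etrans (opmx_mulE _ _) e.
Qed.

(** A left unit of the adjoint ideal is a right unit of J, and the two units coincide. Centrality
    follows, as z ** y and y ** z both equal z ** y ** z. *)
Lemma ideal_unit (J : set T) : ideal J ->
  exists z, [/\ J z, sa z, (forall x, J x -> z ** x = x),
    (forall x, J x -> x ** z = x) & (forall y, z ** y = y ** z)].
Proof.
move=> iJ; have [z [Jz saz zl]] := left_unit iJ.
have iJ' : ideal [set x^# | x in J].
  case: iJ => J0 Jlin Jl Jr; split.
  - by exists 0 => //; rewrite cstar0.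
  - move=> c _ _ [a Ja <-] [b Jb <-]; exists (c^* *: a + b); first exact: Jlin.
    by rewrite cstarD cstarZ; congr (_ *: _ + _); exact: conjcK.
  - move=> x _ [a Ja <-]; exists (a ** x^#); first exact: Jr.
    by rewrite cstarM cstarK.
  - move=> x _ [a Ja <-]; exists (x^# ** a); first exact: Jl.
    by rewrite cstarM cstarK.
have [z' [Jz' saz' zl']] := left_unit iJ'.
have zr x : J x -> x ** z' = x.
  move=> Jx; rewrite -[RHS]cstarK -(zl' x^#); last by exists x.
  by rewrite cstarM cstarK saz'.
have Jz'' : J z'.
  by case: Jz' => y Jy e; rewrite -saz' -e cstarK.
have zz : z = z' by rewrite -(zr _ Jz) zl.
subst z'; exists z; split => // y.
case: iJ => _ _ Jl Jr.
have e1 : z ** y ** z = z ** y by apply: zr; exact: Jr.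
have e2 : z ** (y ** z) = y ** z by apply: zl; exact: Jl.
by rewrite -e1 -cmulA e2.
Qed.

End IdealUnit.

(** * Completely positive maps and approximate units *)

Section LinearFun.
Variables (R : realType) (A B : cstarAlgType R) (f : A -> B).
Local Notation C := R[i].
Hypothesis lin : linear f.

Lemma lin0 : f 0 = 0.
Proof. by have := lin (-1) 0 0; rewrite scaler0 addr0 scaleN1r addNr. Qed.

Lemma linD x y : f (x + y) = f x + f y.
Proof. by have := lin 1 x y; rewrite !scale1r. Qed.

Lemma linZ (z : C) x : f (z *: x) = z *: f x.
Proof. by have := lin z x 0; rewrite lin0 !addr0. Qed.

Lemma linB x y : f (x - y) = f x - f y.
Proof. by rewrite linD -scaleN1r linZ scaleN1r. Qed.

Lemma lin_sum (I : Type) (r : seq I) (P : pred I) (F : I -> A) :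
  f (\sum_(i <- r | P i) F i) = \sum_(i <- r | P i) f (F i).
Proof. exact: (big_morph f linD lin0). Qed.

End LinearFun.

Lemma ccp_nrm (R : realType) (A B : cstarAlgType R) (f : A -> B) a :
  ccp f -> nrm (f a) <= nrm a.
Proof. by case=> _ /(_ a); rewrite !nrmE lecR. Qed.

Lemma ccp_lin (R : realType) (A B : cstarAlgType R) (f : A -> B) :
  ccp f -> linear f.
Proof. by case=> -[]. Qed.

Lemma mxcmulE (R : realType) (A : cstarAlgType R) n (M N : 'M[A]_n) i j :
  mxcmul M N i j = \sum_k M i k ** N k j.
Proof. by rewrite mxE. Qed.

Lemma mxcstarE (R : realType) (A : cstarAlgType R) n (M : 'M[A]_n) i j :
  mxcstar M i j = (M j i)^#.
Proof. by rewrite mxE. Qed.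

Section Cp.
Variables (R : realType) (A B : cstarAlgType R) (f : A -> B).
Hypothesis cp : completely_positive f.

Lemma cp_cpos a : cpos a -> cpos (f a).
Proof.
case=> x ->; case: cp => lin /(_ 1%N (const_mx x))[N /matrixP/(_ 0 0)].
by rewrite !mxE !big_ord1 !mxE => ->; exact: cpos_starM.
Qed.

(** Two-positivity, applied to the matrix with first row (x, y) and second row zero. *)
Lemma cp_pair x y : exists N : 'I_2 -> B * B,
  [/\ f (x^# ** x) = \sum_k (N k).1^# ** (N k).1,
      f (x^# ** y) = \sum_k (N k).1^# ** (N k).2,
      f (y^# ** x) = \sum_k (N k).2^# ** (N k).1 &
      f (y^# ** y) = \sum_k (N k).2^# ** (N k).2].
Proof.
pose M : 'M[A]_2 := \matrix_(i, j) if i == 0 then if j == 0 then x else y else 0.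
case: cp => lin /(_ 2%N M)[N /matrixP NE]; exists (fun k => (N k 0, N k 1)) => /=.
have sE i j : \sum_k (mxcstar M i k) ** (M k j) = (M 0 i)^# ** (M 0 j).
  rewrite big_ord_recl big_ord1 !mxcstarE.
  by rewrite (_ : M (lift _ _) j = 0) ?cmul0r ?addr0 // mxE.
have E i j : f ((M 0 i)^# ** (M 0 j)) = \sum_k (N k i)^# ** (N k j).
  have := NE i j; rewrite [LHS]mxE !mxcmulE sE => ->.
  by apply: eq_bigr => k _; rewrite mxcstarE.
by split; [have := E 0 0|have := E 0 1|have := E 1 0|have := E 1 1]; rewrite !mxE.
Qed.

(** Completing the square in [cp_pair]. With y in the role of the unit this is the Schwarz
    inequality, up to a last term that is positive as soon as f (y^# ** y) is a contraction. *)
Lemma schwarz_identity x y : exists d : 'I_2 -> B,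
  let g := f (y^# ** x) in
  f (x^# ** y) = g^# /\
  f (x^# ** x) - g^# ** g =
    \sum_k (d k)^# ** d k + (g^# ** g - g^# ** f (y^# ** y) ** g).
Proof.
have [N [xx xy yx yy]] := cp_pair x y.
exists (fun k => (N k).1 - (N k).2 ** f (y^# ** x)) => g.
have gE : f (x^# ** y) = g^#.
  by rewrite xy /g yx cstar_sum; apply: eq_bigr => k _; rewrite cstarM cstarK.
split=> //.
have -> : \sum_k ((N k).1 - (N k).2 ** g)^# ** ((N k).1 - (N k).2 ** g) =
    f (x^# ** x) - f (x^# ** y) ** g - (g^# ** f (y^# ** x) - g^# ** f (y^# ** y) ** g).
  rewrite xx xy yx yy !cmul_suml !cmul_sumr cmul_suml -!sumrB.
  by apply: eq_bigr => k _; rewrite cstarB cstarM cmulBl !cmulBr !cmulA.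
by rewrite gE -/g subrK.
Qed.

End Cp.

Section ApproxOrder.
Variables (R : realType) (A : cstarAlgType R).
Local Notation C := R[i].
Implicit Types a b c g v : A.

(* Stands in for positivity in [A], where no functional calculus is available. *)
Definition apos a : Prop :=
  forall N (th : A -> opmx R N), ccp th -> psd (th a).

Lemma cpos_psd N (P : opmx R N) : cpos P -> psd P.
Proof. by case=> w ->; exact: psd_starM. Qed.

Lemma apos_cpos a : cpos a -> apos a.
Proof. by move=> pa N th [cp _]; apply: cpos_psd; exact: cp_cpos. Qed.

Lemma apos_starM a : apos (a^# ** a).
Proof. by apply: apos_cpos; exact: cpos_starM. Qed.

Lemma aposD a b : apos a -> apos b -> apos (a + b).
Proof.
by move=> pa pb N th cth; rewrite (linD (ccp_lin cth)); apply: psdD; [exact: pa | exact: pb].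
Qed.

Lemma apos0 : apos 0.
Proof. by move=> N th cth; rewrite (lin0 (ccp_lin cth)); exact: psd0. Qed.

Lemma apos_sum (I : Type) (r : seq I) (P : pred I) (F : I -> A) :
  (forall i, P i -> apos (F i)) -> apos (\sum_(i <- r | P i) F i).
Proof. by move=> h; apply: (big_ind apos) => //; [exact: apos0 | exact: aposD]. Qed.

Lemma aposZ (x : R) a : 0 <= x -> apos a -> apos (x%:C *: a).
Proof.
by move=> x0 pa N th cth; rewrite (linZ (ccp_lin cth)); apply: psdZ => //; exact: pa.
Qed.

Lemma apos_closed a :
  (forall e : R, 0 < e -> exists2 b, apos b & nrm (a - b) <= e) -> apos a.
Proof.
move=> h N th cth; apply: psd_closed => e /h[b pb ab].
exists (th b); first exact: pb.
by rewrite -(linB (ccp_lin cth)) (le_trans (ccp_nrm _ cth)).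
Qed.

Lemma nat_inv (K e : R) : 0 <= K -> 0 < e -> exists n : nat, K * n.+1%:R^-1 <= e.
Proof.
move=> K0 e0; exists (Num.truncn (K / e)).
rewrite ler_pdivrMr ?ltr0n // mulrC -ler_pdivrMr //.
exact/ltW/truncnS_gt.
Qed.

Section Contraction.
Variable v : A.
Hypothesis v1 : nrm v <= 1.
Let h := v^# ** v.
Let D g := g - h ** g.
Let H k g := iter k (fun x => h ** x) g.

Let sah : h^# = h. Proof. exact: sa_starM. Qed.
Let h1 : nrm h <= 1.
Proof. by rewrite /h nrm_starM expr_le1 ?nrm_ge0. Qed.

Let HD k g : H k (D g) = D (H k g).
Proof. by elim: k => //= k ->; rewrite /D cmulBr. Qed.

Let DM g b : (D g)^# ** b = g^# ** D b.
Proof. by rewrite /D cstarB cstarM sah cmulBl cmulBr cmulA. Qed.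

Let HM k g b : (H k g)^# ** b = g^# ** H k b.
Proof.
elim: k b => //= k IH b; rewrite cstarM sah -cmulA IH; congr (_ ** _).
by rewrite /H -iterSr.
Qed.

Let HH j k g : H j (H k g) = H (j + k) g.
Proof. by rewrite /H -iterD. Qed.

(** h^k (1 - h)^2 is split symmetrically; an odd k leaves one factor h = v^# v in the middle. *)
Let HDD k g : apos (g^# ** H k (D (D g))).
Proof.
rewrite -(odd_double_half k); case: (odd k); rewrite ?add0n ?add1n.
  have -> : g^# ** H (k./2.*2.+1) (D (D g)) =
      (v ** H k./2 (D g))^# ** (v ** H k./2 (D g)).
    rewrite cstarM -cmulA (cmulA v^#) HM DM -/h; congr (_ ** _).
    apply/esym; apply: etrans (congr1 D (HH k./2 k./2.+1 (D g))) _.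
    by rewrite -HD addnS addnn.
  exact: apos_starM.
have -> : g^# ** H (k./2.*2) (D (D g)) = (H k./2 (D g))^# ** H k./2 (D g).
  by rewrite HM HH addnn DM -HD.
exact: apos_starM.
Qed.

Let nrmH k g : nrm (H k g) <= nrm g.
Proof.
elim: k => //= k IH; rewrite (le_trans (nrmM _ _)) //.
by apply: le_trans IH; rewrite ler_piMl ?nrm_ge0.
Qed.

(* For h = v^# v, g^# (1 - h) g is the limit of L^-1 g^# (L (1 - h) - (1 - h^L)) g,
   which is L^-1 times the sum of g^# h^k (1 - h)^2 g over k < j < L. *)
Lemma apos_contraction g : apos (g^# ** (g - v^# ** v ** g)).
Proof.
rewrite -/h -/(D g).
pose r k := g^# ** H k (D g).
have rS k : r k = r k.+1 + g^# ** H k (D (D g)).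
  have e : H k (D g) = H k.+1 (D g) + H k (D (D g)).
    rewrite (HD k (D g)) -[RHS]/(h ** H k (D g) + (H k (D g) - h ** H k (D g))).
    by rewrite addrC subrK.
  by rewrite /r {1}e cmulDr.
have r0 j : r 0%N = r j + \sum_(k < j) g^# ** H k (D (D g)).
  elim: j => [|j IH]; first by rewrite big_ord0 addr0.
  by rewrite IH rS big_ord_recr /= addrAC addrA.
have rsum L : \sum_(j < L) r j = g^# ** (g - H L g).
  elim: L => [|L IH]; first by rewrite big_ord0 subrr cmul0r.
  rewrite big_ord_recr /= IH /r HD /D -cmulDr; congr (_ ** _).
  by rewrite addrA subrK.
apply: apos_closed => e e0.
have K0 : 0 <= nrm g * (nrm g + nrm g) by rewrite mulr_ge0 ?addr_ge0 ?nrm_ge0.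
have [n ne] := nat_inv K0 e0.
exists (n.+1%:R^-1%:C *: \sum_(j < n.+1) \sum_(k < j) g^# ** H k (D (D g))).
  apply: aposZ; first by rewrite invr_ge0 ler0n.
  by apply: apos_sum => j _; apply: apos_sum => k _; exact: HDD.
have sumE : \sum_(j < n.+1) \sum_(k < j) g^# ** H k (D (D g)) =
    n.+1%:R%:C *: r 0%N - g^# ** (g - H n.+1 g).
  rewrite -rsum rmorph_nat scaler_nat -[X in _ *+ X]card_ord -sumr_const -sumrB.
  by apply: eq_bigr => j _; rewrite (r0 j) addrC addKr.
rewrite sumE scalerBr scalerA -rmorphM mulVf ?pnatr_eq0 // scale1r opprB addrC subrK.
rewrite nrmZr ger0_norm ?invr_ge0 ?ler0n // mulrC.
apply: le_trans ne; rewrite ler_wpM2r ?invr_ge0 ?ler0n //.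
rewrite (le_trans (nrmM _ _)) // nrm_star ler_wpM2l ?nrm_ge0 //.
by rewrite (le_trans (nrmB _ _)) // lerD2l nrmH.
Qed.

End Contraction.
End ApproxOrder.

(** Replaces a faithful representation of A; [dr_matrix_normed] derives it from finite module
    decomposition rank. *)
Definition matrix_normed (R : realType) (A : cstarAlgType R) : Prop :=
  forall (a : A) (e : R), 0 < e ->
    exists N (th : A -> opmx R N), ccp th /\ nrm a <= nrm (th a) + e.

(** * Approximate units *)

Section ApproxUnit.
Variables (R : realType) (A : cstarAlgType R).
Hypothesis Anormed : matrix_normed A.
Local Notation C := R[i].
Implicit Types a b g : A.

Lemma apos_nrm_le a b : apos a -> apos b -> nrm a <= nrm (a + b).
Proof.
move=> pa pb; apply/ler_addgt0Pr => e e0.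
have [N [th [cth ath]]] := Anormed a e0.
apply: le_trans ath _; rewrite lerD2r.
apply: le_trans (ccp_nrm (a + b) cth); rewrite (linD (ccp_lin cth)).
by apply: psd_nrm_le; [exact: pa | rewrite addrC addKr; exact: pb].
Qed.

Section Unit.
Variable c : A.
Hypothesis c1 : nrm c <= 1.
Let h := c^# ** c.
Let sah : h^# = h. Proof. exact: sa_starM. Qed.
Let D g := g - h ** g.
Let Dn k g := iter k D g.
(* [E n] is [1 - (1 - h)^n]; for even [n] it serves as an approximate unit for [c]. *)
Let E n := \sum_(k < n) Dn k h.

Let DB a b : D (a - b) = D a - D b.
Proof. by rewrite /D cmulBr !opprB addrACA [- b + _]addrC -addrACA. Qed.

Let Dmul a b : D (a ** b) = D a ** b.
Proof. by rewrite /D cmulBl cmulA. Qed.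

Let Dnmul k a b : Dn k (a ** b) = Dn k a ** b.
Proof. by elim: k => //= k IH; rewrite IH Dmul. Qed.

Let DnS k g : Dn k (D g) = D (Dn k g).
Proof. by rewrite /Dn -iterSr. Qed.

Let hD g : h ** D g = D (h ** g).
Proof. by rewrite /D cmulBr. Qed.

Let hDn k g : h ** Dn k g = Dn k (h ** g).
Proof. by elim: k => //= k IH; rewrite hD IH. Qed.

Let DnM k g b : (Dn k g)^# ** b = g^# ** Dn k b.
Proof.
have D1 x y : (D x)^# ** y = x^# ** D y.
  by rewrite /D cstarB cstarM sah cmulBl cmulBr cmulA.
by elim: k b => //= k IH b; rewrite D1 IH DnS.
Qed.

Let DnD j k g : Dn j (Dn k g) = Dn (j + k) g.
Proof. by rewrite /Dn iterD. Qed.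

Let ES n : E n.+1 = E n + Dn n h.
Proof. by rewrite /E big_ord_recr. Qed.

Let DnB k a b : Dn k (a - b) = Dn k a - Dn k b.
Proof. by elim: k => //= k ->; rewrite DB. Qed.

Let EM n g : E n ** g = g - Dn n g.
Proof.
elim: n => [|n IH]; first by rewrite /E big_ord0 cmul0l subrr.
rewrite ES cmulDl IH -Dnmul -hDn.
by rewrite [Dn n.+1 g]/(Dn n g - h ** Dn n g) opprB [RHS]addrA addrAC.
Qed.

Let saDn k : sa (Dn k h) /\ h ** Dn k h = Dn k h ** h.
Proof.
elim: k => [|k [IH1 IH2]] //=; split.
  by rewrite /sa /D cstarB cstarM sah IH1 IH2.
by rewrite hD IH2 Dmul.
Qed.

Let saE n : (E n)^# = E n.
Proof. by rewrite /E cstar_sum; apply: eq_bigr => k _; case: (saDn k). Qed.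

Let c1' : nrm c^# <= 1. Proof. by rewrite nrm_star. Qed.

(* [y^# h D^k y] is positive: for odd [k] it is [w^# (1 - c c^#) w]. *)
Let aposDh k g : apos (g^# ** Dn k (h ** g)).
Proof.
rewrite -(odd_double_half k); case: (odd k); rewrite ?add0n ?add1n.
  pose x := Dn k./2 g.
  have -> : g^# ** Dn k./2.*2.+1 (h ** g) =
      (c ** x)^# ** (c ** x - (c^#)^# ** c^# ** (c ** x)).
    have -> : (c ** x)^# ** (c ** x - (c^#)^# ** c^# ** (c ** x)) =
        x^# ** D (h ** x).
      by rewrite cstarK cstarM /D /h cmulBr [RHS]cmulBr !cmulA.
    rewrite /x hDn DnM; congr (_ ** _).
    by rewrite -[D _]/(Dn k./2.+1 (h ** g)) DnD addnS addnn.
  exact: apos_contraction.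
have -> : g^# ** Dn k./2.*2 (h ** g) = (c ** Dn k./2 g)^# ** (c ** Dn k./2 g).
  by rewrite cstarM -cmulA (cmulA c^#) -/h hDn DnM DnD addnn.
exact: apos_starM.
Qed.

(** With d = (1 - h)^(2n), use 1 = (1 - d)^2 + d + d (1 - d). The even exponent makes d a square,
    and d (1 - d) is a sum of terms (1 - h)^n h (1 - h)^k (1 - h)^n. *)
Let nrm_1Dn n g : nrm (E n.*2 ** g) <= nrm g.
Proof.
rewrite -(@ler_pXn2r _ 2) ?nnegrE ?nrm_ge0 // -!nrm_starM.
have -> : g^# ** g = (E n.*2 ** g)^# ** (E n.*2 ** g) +
    (g^# ** Dn n.*2 g + (g^# ** Dn n.*2 g - g^# ** Dn n.*2 (Dn n.*2 g))).
  rewrite cstarM saE -cmulA (EM _ (E _ ** g)) (EM _ g) DnB !cmulBr.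
  by rewrite addrACA subrK addNr addr0.
apply: apos_nrm_le; first exact: apos_starM.
apply: aposD.
  have -> : g^# ** Dn n.*2 g = (Dn n g)^# ** Dn n g by rewrite DnM DnD addnn.
  exact: apos_starM.
have -> : g^# ** Dn n.*2 g - g^# ** Dn n.*2 (Dn n.*2 g) =
    \sum_(k < n.*2) (Dn n g)^# ** Dn k (h ** Dn n g).
  have -> : \sum_(k < n.*2) (Dn n g)^# ** Dn k (h ** Dn n g) =
      (Dn n g)^# ** (E n.*2 ** Dn n g).
    by rewrite /E cmul_suml cmul_sumr; apply: eq_bigr => k _; rewrite Dnmul.
  rewrite EM DnM DnB !DnD cmulBr addnn.
  by rewrite (_ : n + n.*2 + n = n.*2.*2)%N; [rewrite addnn | lia].
by apply: apos_sum => k _; exact: aposDh.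
Qed.

(** Apply the previous bound to g = E itself: |E|^2 <= |E|. *)
Let nrm_E n : nrm (E n.*2) <= 1.
Proof.
have [->|E0] := eqVneq (E n.*2) 0; first by rewrite nrm0 ler01.
have := nrm_1Dn n (E n.*2); rewrite -{1}(saE n.*2) nrm_starM expr2.
by rewrite -[leRHS]mulr1 ler_pM2l // nrm_gt0.
Qed.

Let aposDhh k : apos (Dn k (h ** h)).
Proof.
rewrite -(odd_double_half k); case: (odd k); rewrite ?add0n ?add1n.
  have -> : Dn k./2.*2.+1 (h ** h) = (Dn k./2 h)^# ** (Dn k./2 h - c^# ** c ** Dn k./2 h).
    rewrite -/h -/(D (Dn k./2 h)) DnM sah.
    by rewrite -[D _]/(Dn k./2.+1 h) DnD addnS addnn hDn.
  exact: apos_contraction.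
have -> : Dn k./2.*2 (h ** h) = (Dn k./2 h)^# ** Dn k./2 h.
  by rewrite DnM sah DnD addnn hDn.
exact: apos_starM.
Qed.

(** The square of the error is h (1 - h)^(2m). The elements h (1 - h)^k decrease in k and the first
    2m of them add up to [E m.*2], of norm at most 1; so the error squared is at most 1 / (2m). *)
Lemma approx_unit_contraction (e : R) : 0 < e ->
  exists2 x, nrm x <= 1 & nrm (c - c ** x) <= e.
Proof.
move=> e0.
have e20 : 0 < e ^+ 2 by rewrite exprn_gt0.
have [n ne] := @nat_inv _ 1 (e ^+ 2) ler01 e20; rewrite mul1r in ne.
exists (E n.+1.*2); first exact: nrm_E; set m := n.+1.*2.
rewrite -(@ler_pXn2r _ 2) ?nnegrE ?nrm_ge0 ?(ltW e0) // -nrm_starM.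
have hE : h ** E m = h - Dn m h.
  by rewrite -EM /E cmul_sumr cmul_suml; apply: eq_bigr => k _; case: (saDn k).
have RE : (c - c ** E m)^# ** (c - c ** E m) = Dn m.*2 h.
  rewrite cstarB cstarM saE EM opprB addrCA subrr addr0 -Dnmul cmulBr cmulA -/h hE.
  by rewrite opprB addrCA subrr addr0 DnD addnn.
have RS k : Dn k h - Dn k.+1 h = Dn k (h ** h).
  by rewrite -[Dn k.+1 h]/(Dn k h - h ** Dn k h) opprB addrCA subrr addr0 hDn.
have aR k j : apos (Dn k h - Dn (k + j) h).
  elim: j => [|j IH]; first by rewrite addn0 subrr; exact: apos0.
  have -> : Dn k h - Dn (k + j.+1) h = Dn k h - Dn (k + j) h + Dn (k + j) (h ** h).
    by rewrite -RS addnS addrA subrK.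
  by apply: aposD.
rewrite RE; apply: (le_trans _ ne).
have m0 : 0 < m.*2%:R :> R by rewrite ltr0n double_gt0.
have le : m.*2%:R * nrm (Dn m.*2 h) <= 1.
  apply: (le_trans _ (nrm_E m)).
  have -> : m.*2%:R * nrm (Dn m.*2 h) = nrm (m.*2%:R%:C *: Dn m.*2 h).
    by rewrite nrmZr ger0_norm // ltW.
  have -> : E m.*2 = m.*2%:R%:C *: Dn m.*2 h + \sum_(k < m.*2) (Dn k h - Dn m.*2 h).
    rewrite rmorph_nat scaler_nat -[X in _ *+ X]card_ord -sumr_const -big_split.
    by apply: eq_bigr => k _; rewrite /= addrC subrK.
  apply: apos_nrm_le.
    apply: aposZ; first exact: ltW.
    by rewrite -RE; exact: apos_starM.
  apply: apos_sum => k _; have := aR k (m.*2 - k)%N.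
  by rewrite subnKC // ltnW.
have : nrm (Dn m.*2 h) <= m.*2%:R^-1 by rewrite -[leRHS]mulr1 ler_pdivlMl.
move/le_trans; apply; rewrite lef_pV2 ?posrE ?ltr0n ?double_gt0 // ler_nat.
by rewrite /m -!addnn -addnA leq_addr.
Qed.

End Unit.
End ApproxUnit.

Lemma nrmM_le (R : realType) (A : cstarAlgType R) (a b : A) (x y : R) :
  nrm a <= x -> nrm b <= y -> nrm (a ** b) <= x * y.
Proof. by move=> ax by_; rewrite (le_trans (nrmM _ _)) // ler_pM ?nrm_ge0. Qed.

Lemma nrm_star_le (R : realType) (A : cstarAlgType R) (a : A) (x : R) :
  nrm a <= x -> nrm a^# <= x.
Proof. by rewrite nrm_star. Qed.

(** * Schwarz inequalities *)

Section Schwarz.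
Variables (R : realType) (A : cstarAlgType R).
Hypothesis Anormed : matrix_normed A.
Local Notation C := R[i].

Lemma approx_unit (c : A) (e : R) : 0 < e ->
  exists2 x, nrm x <= 1 & nrm (c - c ** x) <= e.
Proof.
move=> e0; have [->|c0] := eqVneq c 0.
  by exists 0; rewrite ?cmul0r ?subrr nrm0 ?ler01 // ltW.
have cp : 0 < nrm c by rewrite nrm_gt0.
have c1 : nrm ((nrm c)^-1%:C *: c) <= 1.
  by rewrite nrmZr ger0_norm ?invr_ge0 ?nrm_ge0 // mulVf // gt_eqF.
have [x x1 cx] := approx_unit_contraction Anormed c1 (divr_gt0 e0 cp).
exists x => //; move: cx.
rewrite cmulZl -scalerBr nrmZr ger0_norm ?invr_ge0 ?nrm_ge0 //.
by rewrite mulrC ler_pM2r ?invr_gt0.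
Qed.

Lemma psd_bound N (g H : opmx R N) (c : R) : nrm H <= c -> psd H ->
  psd (c%:C *: (g ** g^#) - g ** H ** g^#).
Proof.
move=> Hc pH v; rewrite sformBl sformZl subr_ge0 sform_Mstar sform_adj.
set w := v *m _; rewrite (le_trans _ (_ : (nrm (sform H w w))%:C <= _)) //.
  by rewrite -nrmE ger0_norm.
rewrite -rmorphM lecR (le_trans (nrm_sform _ _ _)) // -expr2.
by rewrite ler_wpM2r ?sqr_ge0.
Qed.

Lemma psd_contraction N (g H : opmx R N) : nrm H <= 1 -> psd H ->
  psd (g^# ** g - g^# ** H ** g).
Proof.
by move=> H1 pH; have := psd_bound g^# H1 pH; rewrite cstarK scale1r.
Qed.

(** An approximate unit x of c replaces the unit of A in [schwarz_identity]; th (c ** x) tends to th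
    c, and positivity passes to the limit. *)
Lemma schwarz_matrix N (th : A -> opmx R N) c : ccp th ->
  psd (th (c ** c^#) - th c ** (th c)^#).
Proof.
move=> cth; apply: psd_closed => e e0.
(* Two error terms, each at most nrm c times this tolerance; the 1 keeps the denominator
   positive. *)
have d0 : 0 < e / (2 * nrm c + 1) by rewrite divr_gt0 // ltr_wpDl ?mulr_ge0 ?nrm_ge0.
have [x x1 cx] := approx_unit c d0.
have [d [gE id]] := schwarz_identity cth.1 c^# x.
rewrite cstarK in gE id; set g := th (x^# ** c^#) in gE id.
exists (th (c ** c^#) - g^# ** g).
  rewrite id; apply: psdD; first by apply: psd_sum => k _; exact: psd_starM.
  apply: psd_contraction.
    rewrite (le_trans (ccp_nrm _ cth)) // nrm_starM.
    by rewrite expr_le1 ?nrm_ge0.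
  by apply: cpos_psd; apply: cp_cpos; [exact: cth.1 | exact: cpos_starM].
rewrite opprB addrC addrA subrK.
have -> : g^# ** g - th c ** (th c)^# =
  - ((th c - g^#) ** (th c)^# + g^# ** (th c - g^#)^#).
  by rewrite cstarB cstarK cmulBl cmulBr addrA subrK opprB.
have cg : nrm (th c - g^#) <= e / (2 * nrm c + 1).
  by rewrite -gE -(linB (ccp_lin cth)) (le_trans (ccp_nrm _ cth)).
have g1 : nrm g^# <= nrm c.
  rewrite -gE (le_trans (ccp_nrm _ cth)) // (le_trans (nrmM _ _)) //.
  by rewrite ler_piMr ?nrm_ge0.
rewrite nrmN (le_trans (nrmD _ _)) //.
have t1 : nrm ((th c - g^#) ** (th c)^#) <= e / (2 * nrm c + 1) * nrm c.
  by apply: nrmM_le cg _; apply: nrm_star_le; exact: ccp_nrm.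
have t2 : nrm (g^# ** (th c - g^#)^#) <= nrm c * (e / (2 * nrm c + 1)).
  by apply: nrmM_le g1 _; exact: nrm_star_le.
have eE : e = e / (2 * nrm c + 1) * (2 * nrm c + 1).
  by rewrite divfK // gt_eqF // ltr_wpDl ?mulr_ge0 ?nrm_ge0.
apply: le_trans (lerD t1 t2) _; rewrite [leRHS]eE.
by rewrite [nrm c * _]mulrC -mulrDr ler_wpM2l ?(ltW d0) // mulrDl mul1r lerDl.
Qed.

(** Here the unit is exact but the values lie in A. The last term of [schwarz_identity] is treated
    by [apos_contraction], since phi one has the form u^# ** u with u a contraction. *)
Lemma schwarz_unital (T : cstarAlgType R) (phi : T -> A) (one c : T) :
  ccp phi -> nrm one <= 1 -> sa one -> (forall y, one ** y = y) ->
  apos (phi (c ** c^#) - phi c ** (phi c)^#) /\ phi c^# = (phi c)^#.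
Proof.
move=> cphi one1 saone onel.
have oner y : y ** one = y by rewrite -[LHS]cstarK cstarM saone onel cstarK.
have [d [gE id]] := schwarz_identity cphi.1 c^# one.
rewrite cstarK saone onel oner in gE id.
split; last by rewrite gE cstarK.
have gE' : (phi c)^# = phi c^# by rewrite gE cstarK.
have e : phi c ** phi c^# = (phi c^#)^# ** phi c^# by rewrite -gE.
rewrite gE' e id; apply: aposD.
  by apply: apos_sum => k _; exact: apos_starM.
have [u uE] : cpos (phi (one ** one)).
  by rewrite -{1}saone; apply: cp_cpos; [exact: cphi.1 | exact: cpos_starM].
rewrite -cmulA -cmulBr uE; apply: apos_contraction.
rewrite -(@expr_le1 _ 2) ?nrm_ge0 // -nrm_starM -uE onel.
exact: le_trans (ccp_nrm _ cphi) one1.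
Qed.

End Schwarz.

Section Composition.
Variables (R : realType).

Lemma ccp_comp (A B D : cstarAlgType R) (f : A -> B) (g : B -> D) :
  ccp f -> ccp g -> ccp (fun a => g (f a)).
Proof.
move=> cf cg; split; last first.
  by move=> a; rewrite !nrmE lecR (le_trans (ccp_nrm _ cg)) // ccp_nrm.
split; first by move=> z a b; rewrite (ccp_lin cf) (ccp_lin cg).
move=> m X; have [[_ /(_ m X)[Y YE]] _] := cf.
have [[_ /(_ m Y)[Z ZE]] _] := cg.
by exists Z; rewrite -ZE -YE -map_mx_comp.
Qed.

Lemma ccp_hom (A B : cstarAlgType R) (f : A -> B) :
  star_hom f -> (forall a, nrm (f a) <= nrm a) -> ccp f.
Proof. by move=> hom h; split; [exact: hom_cp | move=> a; rewrite !nrmE lecR]. Qed.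

End Composition.

(** * Approximately order zero maps *)

Section OrderZero.
Variables (R : realType) (T A : cstarAlgType R) (N : nat) (p : T -> opmx R N).
Hypotheses (hom : star_hom p) (inj : injective p).
Variables (n : nat) (e : 'I_n -> T) (G : set (T -> A)).
Local Notation C := R[i].
Hypothesis e_idem : forall i, e i ** e i = e i.
Hypothesis e_central : forall i y, e i ** y = y ** e i.
Hypothesis Gccp : forall f, G f -> ccp f.

(** The block index is stored with the pair, so that one finite list may mix all blocks and be
    served by a single map. *)
Definition zero_pair (t : 'I_n * T * T) : Prop :=
  [/\ e t.1.1 ** t.1.2 = t.1.2, e t.1.1 ** t.2 = t.2 & t.1.2 ** t.2 = 0].

Definition small_on (s : seq ('I_n * T * T)) (d : R) (f : T -> A) : Prop :=
  forall t, t \in s -> nrm (f t.1.2 ** f t.2) <= d.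

Hypothesis Goz : forall (s : seq ('I_n * T * T)) (d : R),
  (forall t, t \in s -> zero_pair t) -> 0 < d -> exists2 f, G f & small_on s d f.

(* The filter on [G] along which all zero products become small. *)
Definition oz_ev (P : (T -> A) -> Prop) : Prop :=
  exists (s : seq ('I_n * T * T)) (d : R), [/\ forall t, t \in s -> zero_pair t, 0 < d &
    forall f, G f -> small_on s d f -> P f].

Lemma oz_ev_ex P : oz_ev P -> exists2 f, G f & P f.
Proof. by move=> [s [d [sz d0 h]]]; have [f Gf sf] := Goz sz d0; exists f => //; exact: h. Qed.

Lemma oz_evS (P Q : (T -> A) -> Prop) :
  (forall f, G f -> P f -> Q f) -> oz_ev P -> oz_ev Q.
Proof.
move=> PQ [s [d [sz d0 h]]]; exists s, d; split => // f Gf sf.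
by apply: PQ => //; exact: h.
Qed.

Lemma oz_evT (P : (T -> A) -> Prop) : (forall f, G f -> P f) -> oz_ev P.
Proof. by move=> h; exists [::], 1; split => // f Gf _; exact: h. Qed.

Lemma oz_evI P Q : oz_ev P -> oz_ev Q -> oz_ev (fun f => P f /\ Q f).
Proof.
move=> [s [d [sz d0 h]]] [s' [d' [sz' d0' h']]]; exists (s ++ s'), (Num.min d d'); split.
- by move=> t; rewrite mem_cat => /orP[/sz|/sz'].
- by rewrite lt_min d0.
- move=> f Gf sf; split; [apply: h|apply: h'] => // t ts.
    by apply: le_trans (sf t _) _; rewrite ?mem_cat ?ts // ge_min lexx.
  by apply: le_trans (sf t _) _; rewrite ?mem_cat ?ts ?orbT // ge_min lexx orbT.
Qed.

Lemma oz_ev_forall m (P : 'I_m -> (T -> A) -> Prop) :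
  (forall i, oz_ev (P i)) -> oz_ev (fun f => forall i, P i f).
Proof.
elim: m P => [|m IH] P h; first by apply: oz_evT => f _ [].
have := oz_evI (h ord0) (IH (fun i => P (lift ord0 i)) (fun i => h _)).
by apply: oz_evS => f _ [h0 hS] i; case: (unliftP ord0 i) => [j|] ->.
Qed.

Definition tends0 (F : (T -> A) -> A) : Prop :=
  forall d, 0 < d -> oz_ev (fun f => nrm (F f) <= d).

Lemma tends0_ext F F' : (forall f, G f -> F f = F' f) -> tends0 F -> tends0 F'.
Proof. by move=> FF h d /h; apply: oz_evS => f Gf; rewrite FF. Qed.

Lemma tends0_zero F : (forall f, G f -> F f = 0) -> tends0 F.
Proof. by move=> h d d0; apply: oz_evT => f Gf; rewrite h // nrm0 ltW. Qed.

Lemma tends0D F F' : tends0 F -> tends0 F' -> tends0 (fun f => F f + F' f).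
Proof.
move=> hF hF' d d0; have d20 : 0 < d / 2 by rewrite divr_gt0.
apply: oz_evS (oz_evI (hF _ d20) (hF' _ d20)) => f Gf [h h'].
by rewrite (le_trans (nrmD _ _)) // [leRHS]splitr lerD.
Qed.

Lemma tends0_bound (F F' : (T -> A) -> A) (c : R) :
  (forall f, G f -> nrm (F' f) <= c * nrm (F f)) -> tends0 F -> tends0 F'.
Proof.
move=> h hF d d0; have c0 : 0 < `|c| + 1 by rewrite ltr_wpDl.
apply: oz_evS (hF _ (divr_gt0 d0 c0)) => f Gf le.
apply: le_trans (h f Gf) _; apply: (@le_trans _ _ ((`|c| + 1) * nrm (F f))).
  by rewrite ler_wpM2r ?nrm_ge0 // (le_trans (ler_norm c)) // lerDl.
by rewrite mulrC -ler_pdivlMr.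
Qed.

Lemma tends0N F : tends0 F -> tends0 (fun f => - F f).
Proof. by apply: (@tends0_bound _ _ 1) => f _; rewrite nrmN mul1r. Qed.

Lemma tends0Z (z : C) F : tends0 F -> tends0 (fun f => z *: F f).
Proof. by apply: (@tends0_bound _ _ (nrm z)) => f _; rewrite nrmZ. Qed.

Lemma tends0Ml (c : R) (F F' : (T -> A) -> A) : (forall f, G f -> nrm (F f) <= c) ->
  tends0 F' -> tends0 (fun f => F f ** F' f).
Proof.
move=> h; apply: (@tends0_bound _ _ c) => f Gf.
by rewrite (le_trans (nrmM _ _)) // ler_wpM2r ?nrm_ge0 ?h.
Qed.

Lemma tends0Mr (c : R) (F F' : (T -> A) -> A) : (forall f, G f -> nrm (F' f) <= c) ->
  tends0 F -> tends0 (fun f => F f ** F' f).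
Proof.
move=> h; apply: (@tends0_bound _ _ c) => f Gf.
by rewrite (le_trans (nrmM _ _)) // [leRHS]mulrC ler_wpM2l ?nrm_ge0 ?h.
Qed.

Definition asymp F F' := tends0 (fun f => F f - F' f).

Lemma asymp_refl F : asymp F F.
Proof. by apply: tends0_zero => f _; rewrite subrr. Qed.

Lemma asymp_trans F1 F2 F3 : asymp F1 F2 -> asymp F2 F3 -> asymp F1 F3.
Proof.
by move=> h1 h2; apply: tends0_ext (tends0D h1 h2) => f _; rewrite addrA subrK.
Qed.

Lemma asymp_sym F1 F2 : asymp F1 F2 -> asymp F2 F1.
Proof. by move=> h; apply: tends0_ext (tends0N h) => f _; rewrite opprB. Qed.

Lemma asymp_ext F1 F2 F1' F2' : (forall f, G f -> F1 f = F1' f) ->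
  (forall f, G f -> F2 f = F2' f) -> asymp F1 F2 -> asymp F1' F2'.
Proof. by move=> h1 h2; apply: tends0_ext => f Gf; rewrite h1 // h2. Qed.

Lemma asympMl (c : R) (F F1 F2 : (T -> A) -> A) : (forall f, G f -> nrm (F f) <= c) ->
  asymp F1 F2 -> asymp (fun f => F f ** F1 f) (fun f => F f ** F2 f).
Proof. by move=> h h12; apply: tends0_ext (tends0Ml h h12) => f _; rewrite cmulBr. Qed.

Lemma asympMr (c : R) (F F1 F2 : (T -> A) -> A) : (forall f, G f -> nrm (F f) <= c) ->
  asymp F1 F2 -> asymp (fun f => F1 f ** F f) (fun f => F2 f ** F f).
Proof. by move=> h h12; apply: tends0_ext (tends0Mr h h12) => f _; rewrite cmulBl. Qed.

Lemma asymp_sum (I : eqType) (r : seq I) (F F' : I -> (T -> A) -> A) :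
  (forall k, k \in r -> asymp (F k) (F' k)) ->
  asymp (fun f => \sum_(k <- r) F k f) (fun f => \sum_(k <- r) F' k f).
Proof.
elim: r => [|k r IH] h; first by apply: tends0_zero => f _; rewrite !big_nil subrr.
have hk := h k (mem_head _ _).
have hr : forall l, l \in r -> asymp (F l) (F' l).
  by move=> l lr; apply: h; rewrite inE lr orbT.
by apply: tends0_ext (tends0D hk (IH hr)) => f _; rewrite !big_cons opprD addrACA.
Qed.

Lemma zero_pair_tends0 i x y : zero_pair (i, x, y) -> tends0 (fun f => f x ** f y).
Proof.
move=> z d d0; exists [:: (i, x, y)], d; split => // [t|f Gf].
  by rewrite inE => /eqP ->.
by move/(_ (i, x, y)); apply; rewrite inE.
Qed.

Section Color.
Variable i : 'I_n.
Implicit Types x y a : T.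
Local Notation inT x := (e i ** x = x).

(* For [a] idempotent, both terms differ from [f (x ** a) ** f (a ** y)] by the
   image of a zero pair; the idempotents span [T]. *)
Lemma oz_balanced a x y : inT x -> inT y ->
  asymp (fun f => f (x ** a) ** f y) (fun f => f x ** f (a ** y)).
Proof.
move=> ix iy; move: a; apply: (idem_ind hom inj).
- apply: tends0_zero => f Gf; rewrite cmul0l cmul0r (lin0 (ccp_lin (Gccp Gf))).
  by rewrite cmul0l cmul0r subrr.
- move=> z a b ha hb; apply: tends0_ext (tends0D (tends0Z z ha) hb) => f Gf.
  have lf := ccp_lin (Gccp Gf).
  rewrite cmulDr cmulDl cmulZr cmulZl !(linD lf) !(linZ lf).
  rewrite cmulDl cmulDr cmulZl cmulZr scalerBr opprD.
  by rewrite addrACA.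
- move=> q qq.
  have z1 : zero_pair (i, x ** q, y - q ** y).
    split => /=; first by rewrite cmulA ix.
      by rewrite cmulBr iy cmulA e_central -cmulA iy.
    by rewrite cmulBr !cmulA -(cmulA x q q) qq subrr.
  have z2 : zero_pair (i, x - x ** q, q ** y).
    split => /=; first by rewrite cmulBr cmulA ix.
      by rewrite cmulA e_central -cmulA iy.
    by rewrite cmulBl !cmulA -(cmulA x q q) qq subrr.
  apply: tends0_ext (tends0D (zero_pair_tends0 z1) (tends0N (zero_pair_tends0 z2))) => f Gf.
  have lf := ccp_lin (Gccp Gf).
  by rewrite !(linB lf) cmulBr cmulBl opprB addrA subrK.
Qed.

Let nrmf x f : G f -> nrm (f x) <= nrm x.
Proof. by move=> Gf; apply: ccp_nrm; exact: Gccp. Qed.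

(** For exact order zero maps, f(x) f(y) = f(1) f(x y); here asymptotically, with the block unit for
    1. It is [oz_balanced] with x moved across. *)
Lemma oz_mul x y : inT x -> inT y ->
  asymp (fun f => f x ** f y) (fun f => f (e i) ** f (x ** y)).
Proof.
move=> ix iy; apply: asymp_ext (oz_balanced x (e_idem i) iy) => f Gf //.
by rewrite ix.
Qed.

Lemma oz_comm x : inT x -> asymp (fun f => f x ** f (e i)) (fun f => f (e i) ** f x).
Proof.
move=> ix; apply: asymp_ext (oz_mul ix (e_idem i)) => f Gf //.
by rewrite -e_central ix.
Qed.

Let hp k (f : T -> A) b := iter k (fun b => f (e i) ** b) b.

Let nrm_hp k f b : G f -> nrm (hp k f b) <= nrm (e i) ^+ k * nrm b.
Proof.
move=> Gf; elim: k => [|k IH]; first by rewrite expr0 mul1r.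
by rewrite exprS -mulrA; apply: nrmM_le; [exact: nrmf | exact: IH].
Qed.

Let hp_comm k x y : inT x ->
  asymp (fun f => f x ** hp k f (f y)) (fun f => hp k f (f x ** f y)).
Proof.
move=> ix; elim: k => [|k IH]; first exact: asymp_refl.
apply: (@asymp_trans _ (fun f => f (e i) ** (f x ** hp k f (f y)))).
  apply: asymp_ext (asympMr (c := nrm (e i) ^+ k * nrm y) _ (oz_comm ix)) => [f Gf|f Gf|f Gf] /=.
  - by rewrite -cmulA.
  - by rewrite -cmulA.
  - apply: le_trans (nrm_hp _ _ Gf) _; rewrite ler_wpM2l ?exprn_ge0 ?nrm_ge0 //.
    exact: nrmf.
exact: (asympMl (nrmf (e i))) IH.
Qed.

Let hp_asymp k F F' : asymp F F' -> asymp (fun f => hp k f (F f)) (fun f => hp k f (F' f)).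
Proof.
by move=> h; elim: k => //= k IH; exact: (asympMl (nrmf (e i))) IH.
Qed.

Let fw (l : seq T) (f : T -> A) b := foldr (fun x acc => f x ** acc) b l.
Let pw (l : seq T) y := foldr (fun x acc => x ** acc) y l.

Let inT_pw l y : (forall x, x \in l -> inT x) -> inT y -> inT (pw l y).
Proof.
elim: l => //= x l IH h iy; rewrite cmulA h ?inE ?eqxx //.
Qed.

(** [oz_mul] iterated along the word: each letter contributes one factor f (e i), carried to the
    left by [hp_comm]. *)
Let oz_word l y : (forall x, x \in l -> inT x) -> inT y ->
  asymp (fun f => fw l f (f y)) (fun f => hp (size l) f (f (pw l y))).
Proof.
elim: l => [|x l IH] h iy; first exact: asymp_refl.
have ix : inT x by apply: h; rewrite inE eqxx.
have hl z : z \in l -> inT z by move=> zl; apply: h; rewrite inE zl orbT.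
apply: (@asymp_trans _ (fun f => f x ** hp (size l) f (f (pw l y)))).
  exact: (asympMl (nrmf x)) (IH hl iy).
apply: (@asymp_trans _ (fun f => hp (size l) f (f x ** f (pw l y)))).
  exact: hp_comm.
apply: asymp_ext (hp_asymp (size l) (oz_mul ix (inT_pw hl iy))) => f Gf //=.
by rewrite /hp -iterSr.
Qed.

Let hp_sum k (r : seq (T * T)) (F : T * T -> T) f : G f ->
  hp k f (f (\sum_(j <- r) F j)) = \sum_(j <- r) hp k f (f (F j)).
Proof.
move=> Gf; rewrite (lin_sum (ccp_lin (Gccp Gf))).
by elim: k => //= k ->; rewrite cmul_sumr.
Qed.

Variables (q z : T) (r : seq (T * T)) (beta : R).
Hypotheses (iq : inT q) (qq : q ** q = q) (zz : z ** z = z) (saz : sa z).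
Hypothesis zE : z = \sum_(j <- r) j.1 ** q ** j.2.
Hypothesis rT : forall j, j \in r -> inT j.1 /\ inT j.2.
Hypotheses (beta0 : 0 < beta) (qbeta : forall f, G f -> nrm (f q) <= beta).

Let iz : inT z.
Proof.
rewrite zE cmul_sumr big_seq [RHS]big_seq; apply: eq_bigr => j /rT[h _].
by rewrite !cmulA h.
Qed.

Let K := \sum_(j <- r) nrm j.1 * nrm j.2.

(** The power of f z and the sum of the f(j.1) f(q)^(m+1) f(j.2) are both asymptotic to f(e i)^(m+2)
    f(z), as z and q are idempotent. Note that [cpow] with argument m.+2 is the power of exponent m
    + 3. *)
Lemma oz_pow m (d : R) : 0 < d ->
  oz_ev (fun f => nrm (cpow (f z) m.+2) <= K * beta ^+ m.+1 + d).
Proof.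
move=> d0.
have h1 : asymp (fun f => cpow (f z) m.+2) (fun f => hp m.+2 f (f z)).
  apply: asymp_ext (oz_word (l := nseq m.+2 z) _ iz) => [f Gf|f Gf|x].
  - by rewrite /fw; elim: (m.+2) => //= k ->.
  - rewrite size_nseq; congr (hp _ _ (f _)).
    by rewrite /pw; elim: (m.+2) => //= k ->.
  - by rewrite mem_nseq => /andP[_ /eqP->].
have h2 : asymp (fun f => \sum_(j <- r) hp m.+2 f (f (j.1 ** q ** j.2)))
    (fun f => \sum_(j <- r) f j.1 ** iter m.+1 (fun b => f q ** b) (f j.2)).
  apply: asymp_sum => j /rT[j1 j2]; apply: asymp_sym.
  apply: asymp_ext (oz_word (l := j.1 :: nseq m.+1 q) _ j2) => [f Gf|f Gf|x].
  - have fE k b : foldr (fun x acc => f x ** acc) b (nseq k q) =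
      iter k (fun b => f q ** b) b by elim: k => //= k ->.
    by rewrite /fw [LHS]/=; congr (_ ** _); exact: (fE m.+1).
  - have -> : size (j.1 :: nseq m.+1 q) = m.+2 by rewrite /= size_nseq.
    suff -> : pw (j.1 :: nseq m.+1 q) j.2 = j.1 ** q ** j.2 by [].
    rewrite /pw [LHS]/= -cmulA; congr (_ ** _).
    by elim: m {h1} => //= k ->; rewrite cmulA qq.
  - by rewrite inE => /orP[/eqP->|]; rewrite ?mem_nseq // => /andP[_ /eqP->].
have h3 : asymp (fun f => hp m.+2 f (f z)) (fun f => \sum_(j <- r) hp m.+2 f (f (j.1 ** q ** j.2))).
  by apply: tends0_zero => f Gf; rewrite {1}zE (hp_sum _ _ (fun j => j.1 ** q ** j.2)) // subrr.
apply: oz_evS (asymp_trans h1 (asymp_trans h3 h2) d0) => f Gf le.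
rewrite -[cpow _ _](subrK (\sum_(j <- r) f j.1 ** iter m.+1 (fun b => f q ** b) (f j.2))).
rewrite (le_trans (nrmD _ _)) // addrC lerD // (le_trans (nrm_sum _ _ _)) //.
rewrite /K mulr_suml; apply: ler_sum => j _; rewrite -mulrA.
apply: nrmM_le; first exact: nrmf.
rewrite mulrC; elim: (m.+1) => [|k IH] /=; first by rewrite expr0 mul1r nrmf.
by rewrite exprS -mulrA; apply: nrmM_le IH; exact: qbeta.
Qed.

(** At exponent M = 2^(j+2) the norm of the power of f z is exact. Half of (2 beta)^M absorbs the
    asymptotic error, and for large j the other half absorbs K beta^(M - 2). *)
Lemma oz_support : oz_ev (fun f => nrm (f z) <= 2 * beta).
Proof.
have b2 : 0 < beta ^+ 2 by rewrite exprn_gt0.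
have K0 : 0 <= K by apply: sumr_ge0 => j _; rewrite mulr_ge0 ?nrm_ge0.
have [j jK] : exists j : nat, K / beta ^+ 2 <= j%:R.
  by exists (Num.truncn (K / beta ^+ 2)).+1; exact/ltW/truncnS_gt.
pose M := (2 ^ j.+2)%N.
have M4 : (4 <= M)%N by rewrite /M expnS expnS mulnA leq_pmulr ?expn_gt0.
have d0 : 0 < (2 * beta) ^+ M / 2 by rewrite divr_gt0 ?exprn_gt0 ?mulr_gt0.
have := oz_pow (M - 3) d0; apply: oz_evS => f Gf.
have saf : sa (f z).
  have [w ->] : cpos (f z).
    by rewrite -zz -{1}saz; apply: cp_cpos; [exact: (Gccp Gf).1 | exact: cpos_starM].
  exact: sa_starM.
have -> : (M - 3).+2 = M.-1 by lia.
have -> : (M - 3).+1 = (M - 2)%N by lia.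
rewrite -sqiter_cpow nrm_sqiter // => le.
rewrite -(@ler_pXn2r _ M) ?nnegrE ?nrm_ge0 ?mulr_ge0 ?(ltW beta0) //; last by lia.
apply: le_trans le _; rewrite [leRHS]splitr lerD2r.
have -> : beta ^+ (M - 2) = beta ^+ M / beta ^+ 2.
  by rewrite -{2}(subnK (ltnW (ltnW M4))) exprD mulfK // gt_eqF.
have hj : j%:R <= 2 ^+ M / 2 :> R.
  rewrite ler_pdivlMr // -natrM -natrX ler_nat.
  have h1 : (j < 2 ^ j)%N by exact: ltn_expl.
  have h2 : (M < 2 ^ M)%N by exact: ltn_expl.
  have h3 : M = (4 * 2 ^ j)%N by rewrite /M !expnS mulnA.
  by lia.
have -> : K * (beta ^+ M / beta ^+ 2) = K / beta ^+ 2 * beta ^+ M by ring.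
have -> : (2 * beta) ^+ M / 2 = 2 ^+ M / 2 * beta ^+ M by rewrite exprMn; ring.
by rewrite ler_wpM2r ?(le_trans jK) // exprn_ge0 // ltW.
Qed.

End Color.
End OrderZero.

(** * Cutting off the multiplicativity defect *)

Section Cut.
Variables (R : realType) (T A : cstarAlgType R) (N : nat) (p : T -> opmx R N).
Hypotheses (hom : star_hom p) (inj : injective p).
Variables (n : nat) (e : 'I_n -> T) (G : set (T -> A)) (psi : A -> T).
Local Notation C := R[i].
Hypothesis e_idem : forall i, e i ** e i = e i.
Hypothesis e_orth : forall i j, i != j -> e i ** e j = 0.
Hypothesis e_central : forall i y, e i ** y = y ** e i.
Hypothesis e_sa : forall i, sa (e i).
Hypothesis e_sum : forall y, \sum_i e i ** y = y.
Hypothesis Gccp : forall f, G f -> ccp f.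
Hypothesis Goz : forall (s : seq ('I_n * T * T)) (d : R),
  (forall t, t \in s -> zero_pair e t) -> 0 < d -> exists2 f, G f & small_on s d f.
Hypothesis Anormed : matrix_normed A.
Hypothesis cpsi : ccp psi.
Variables (cs : seq A) (eta M gam kap : R).
Hypothesis (eta0 : 0 < eta) (gam0 : 0 < gam) (kap0 : 0 <= kap) (M0 : 0 <= M).
Hypothesis csM : forall c, c \in cs -> nrm c <= M.
Hypothesis approx : forall f c, G f -> c \in cs ->
  nrm (f (psi c) - c) <= eta /\ nrm (f (psi (c ** c^#)) - c ** c^#) <= eta.
(** Bound for f x over all f in G, each c contributing (1 + 2 M) eta; the successor keeps it
    positive for an empty list. By [oz_support], f of each block unit is then at most 2 xi / gam,
    and [consts] turns the sum over n blocks, times M^2, into kap^2. *)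
Let xi := (size cs).+1%:R * ((1 + 2 * M) * eta).
Hypothesis consts : n%:R * (2 * (xi / gam)) * M ^+ 2 <= kap ^+ 2.

Let one := \sum_i e i.
Let onel y : one ** y = y. Proof. by rewrite /one cmul_suml e_sum. Qed.
Let saone : sa one.
Proof. by rewrite /sa /one cstar_sum; apply: eq_bigr => i _; exact: e_sa. Qed.
Let proj_nrm (z : T) : sa z -> z ** z = z -> nrm z <= 1.
Proof.
move=> saz zz; have [->|z0] := eqVneq z 0; first by rewrite nrm0 ler01.
have := nrm_starM z; rewrite saz zz expr2 => h.
have zp : 0 < nrm z by rewrite nrm_gt0.
by rewrite -(ler_pM2l zp) mulr1 -h.
Qed.
Let one1 : nrm one <= 1. Proof. exact: proj_nrm. Qed.

Let x_ c := psi (c ** c^#) - psi c ** (psi c)^#.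

Let cppsi : ccp (fun a => p (psi a)).
Proof. exact: ccp_comp cpsi (ccp_hom hom (rep_nrm_le hom inj)). Qed.

Let psd_x c : psd (p (x_ c)).
Proof.
rewrite (homB hom) (homM hom) (hom_star hom).
exact: (schwarz_matrix Anormed c cppsi).
Qed.

Let cpos_x c : cpos (x_ c).
Proof. exact: rep_psd_cpos hom inj _ (psd_x c). Qed.

Let apos_f f y : G f -> cpos y -> apos (f y).
Proof. by move=> /Gccp[cpf _] py; apply: apos_cpos; exact: cp_cpos. Qed.

Let psd_apos f y : G f -> psd (p y) -> apos (f y).
Proof. by move=> Gf py; apply: apos_f => //; exact: rep_psd_cpos hom inj _ py. Qed.

Let f_le f y w : G f -> psd (p y) -> psd (p (w - y)) -> nrm (f y) <= nrm (f w).
Proof.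
move=> Gf py pwy; rewrite -[w](subrK y) addrC (linD (ccp_lin (Gccp Gf))).
by apply: apos_nrm_le => //; exact: psd_apos.
Qed.

(** Adding the Schwarz defect of f at psi c to f (x_ c) gives f (psi (c ** c^#)) minus f (psi c) **
    (f (psi c))^#. Both terms are close to c ** c^#, and the added defect is positive. *)
Let fx_le f c : G f -> c \in cs -> nrm (f (x_ c)) <= (1 + 2 * M) * eta.
Proof.
move=> Gf cc; have [h1 h2] := approx Gf cc; have cM := csM cc.
have lf := ccp_lin (Gccp Gf).
have [apS fS] := schwarz_unital (psi c) (Gccp Gf) one1 saone onel.
have le := apos_nrm_le Anormed (apos_f Gf (cpos_x c)) apS.
apply: le_trans le _; rewrite /x_ (linB lf) addrA subrK.
set y := f (psi c).
have -> : f (psi (c ** c^#)) - y ** y^# =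
  (f (psi (c ** c^#)) - c ** c^#) + ((c - y) ** c^# + y ** (c - y)^#).
  by rewrite cstarB cmulBl cmulBr (addrA (c ** c^# - _)) subrK addrA subrK.
have cy : nrm (c - y) <= eta by rewrite nrmBC.
have yM : nrm y <= M.
  by rewrite (le_trans (ccp_nrm _ (Gccp Gf))) // (le_trans (ccp_nrm _ cpsi)).
rewrite (le_trans (nrmD _ _)) // mulrDl mul1r lerD // (le_trans (nrmD _ _)) //.
have -> : 2 * M * eta = eta * M + M * eta by ring.
by apply: lerD; apply: nrmM_le => //; exact: nrm_star_le.
Qed.

Let x := \sum_(c <- cs) x_ c.

Let psdx : psd (p x).
Proof. by rewrite (hom_sum hom); apply: psd_sum => c _; exact: psd_x. Qed.

Let sax : sa x.
Proof. by apply: inj; rewrite (hom_star hom); exact: psd_sa psdx. Qed.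

Let xi0 : 0 < xi.
Proof. by rewrite mulr_gt0 ?ltr0n // mulr_gt0 // ltr_wpDr ?mulr_ge0. Qed.

Let fx_xi f : G f -> nrm (f x) <= xi.
Proof.
move=> Gf; rewrite (lin_sum (ccp_lin (Gccp Gf))) (le_trans (nrm_sum _ _ _)) //.
apply: (@le_trans _ _ (\sum_(c <- cs) (1 + 2 * M) * eta)).
  by rewrite big_seq [leRHS]big_seq; apply: ler_sum => c; exact: fx_le.
rewrite big_const_seq count_predT iter_addr addr0 -[X in X <= _]mulr_natl.
by rewrite /xi ler_wpM2r ?ler_nat // mulr_ge0 ?addr_ge0 ?mulr_ge0 ?(ltW eta0).
Qed.

(** Indicator of large eigenvalues; it vanishes at 0 because gam > 0, so the spectral projection
    lies in T. *)
Let big (t : C) : C := (gam <= complex.Re t)%R%:R.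

Let big0 : big 0 = 0.
Proof. by rewrite /big /= leNgt gam0. Qed.

Let sv_real i : specval (p x : 'M[C]_N) i = (complex.Re (specval (p x : 'M[C]_N) i))%:C.
Proof. by apply: specval_real; exact: (hom_sa hom sax). Qed.

(** gam q <= x yields gam |f q| <= |f x| for every f in G, and off q the spectrum of x lies below
    gam. *)
Lemma cut_projection : exists q, [/\ sa q, q ** q = q,
  (forall f, G f -> nrm (f q) <= xi / gam) & nrm (x - q ** x) <= gam].
Proof.
have [q pq] := mfun_lift hom sax big0.
have pid := mfun_id (hom_sa hom sax).
have bigJ t : (big t)^* = big t by exact: conjc_nat.
have saq : sa q.
  apply: inj; rewrite (hom_star hom) pq mfun_star.
  by apply: mfun_ext => i; exact: bigJ.
exists q; split => //.
- apply: inj; rewrite (homM hom) pq mfunM; apply: mfun_ext => i.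
  by rewrite /big -natrM mulnb andbb.
- move=> f Gf; rewrite ler_pdivlMr // mulrC.
  have -> : gam * nrm (f q) = nrm (f (gam%:C *: q)).
    by rewrite (linZ (ccp_lin (Gccp Gf))) nrmZr ger0_norm // ltW.
  apply: le_trans (fx_xi Gf); apply: f_le => //.
    rewrite (homZ hom) pq mfunZ; apply: mfun_psd => i.
    by rewrite mulr_ge0 ?ler0c ?ler0n // ltW.
  rewrite (homB hom) (homZ hom) pq mfunZ -{1}pid mfunB; apply: mfun_psd => i.
  rewrite /big; case: leP => h; last first.
    by rewrite mulr0 subr0 psd_specval.
  by rewrite mulr1 subr_ge0 sv_real lecR.
- rewrite -(rep_nrm hom inj) (homB hom) (homM hom) pq -{1 3}pid mfunM mfunB.
  apply: mfun_nrm_le => [|i]; first exact: ltW.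
  rewrite /big; case: (leP gam (complex.Re _)) => h; first by rewrite mul1r subrr nrm0 ltW.
  rewrite mul0r subr0 sv_real nrm_real ger0_norm ?(ltW h) //.
  by have := psd_specval i psdx; rewrite sv_real ler0c.
Qed.

Let support (q : T) : sa q -> q ** q = q -> (forall f, G f -> nrm (f q) <= xi / gam) ->
  exists z : 'I_n -> T, [/\ forall i, e i ** z i = z i, forall i, sa (z i) /\ z i ** z i = z i,
    forall i y, z i ** y = y ** z i, forall i, z i ** (e i ** q) = e i ** q &
    exists2 f, G f & forall i, nrm (f (z i)) <= 2 * (xi / gam)].
Proof.
move=> saq qq fq.
have beta0 : 0 < xi / gam by rewrite divr_gt0.
have [qi qiE] : exists qi, forall i, qi i = e i ** q by exists (fun i => e i ** q).
have eqi i : e i ** qi i = qi i by rewrite qiE cmulA e_idem.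
have qqi' i : q ** qi i = qi i by rewrite qiE cmulA -e_central -cmulA qq.
have qqi i : qi i ** qi i = qi i by rewrite {1}qiE -cmulA qqi' eqi.
have fqi i f : G f -> nrm (f (qi i)) <= xi / gam.
  move=> Gf; apply: le_trans (fq f Gf).
  have saqi : sa (qi i) by rewrite /sa qiE cstarM saq e_sa e_central.
  rewrite -[q in leRHS](subrK (qi i)) addrC (linD (ccp_lin (Gccp Gf))).
  apply: apos_nrm_le => //; apply: apos_f => //; first by exists (qi i); rewrite saqi qqi.
  exists (q - qi i); rewrite cstarB saq saqi cmulBl !cmulBr qq qqi.
  rewrite qqi'; have -> : qi i ** q = qi i by rewrite qiE -cmulA qq.
  by rewrite subrr subr0.
(* The ideal is described by finite sums so that membership of its unit produces the list required
   by [oz_support]. *)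
pose J i : set T := [set y | exists r : seq (T * T), y = \sum_(j <- r) j.1 ** qi i ** j.2].
have idJ i : ideal (J i).
  split.
  - by exists [::]; rewrite big_nil.
  - move=> c _ _ [r ->] [s ->]; exists ([seq (c *: j.1, j.2) | j <- r] ++ s).
    rewrite big_cat big_map scaler_sumr; congr (_ + _).
    by apply: eq_bigr => j _; rewrite !cmulZl.
  - move=> y _ [r ->]; exists [seq (y ** j.1, j.2) | j <- r].
    by rewrite big_map cmul_sumr; apply: eq_bigr => j _; rewrite !cmulA.
  - move=> y _ [r ->]; exists [seq (j.1, j.2 ** y) | j <- r].
    by rewrite big_map cmul_suml; apply: eq_bigr => j _; rewrite !cmulA.
have [z zP] := choice (fun i => ideal_unit hom inj (idJ i)).
have Jq i : J i (qi i).
  by exists [:: (qi i, qi i)]; rewrite big_seq1 !qqi.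
have ez i : e i ** z i = z i.
  have [[r ->] _ _ _ _] := zP i; rewrite cmul_sumr; apply: eq_bigr => j _.
  by rewrite !cmulA (e_central i j.1) -(cmulA j.1 (e i) (qi i)) eqi.
exists z; split.
- by [].
- by move=> i; have [Jz saz zl _ _] := zP i; split=> //; exact: zl.
- by move=> i y; case: (zP i).
- by move=> i; rewrite -qiE; case: (zP i) => _ _ zl _ _; exact: zl.
apply: (oz_ev_ex Goz); apply: oz_ev_forall => i.
have [[r zE] saz zl _ _] := zP i.
have zz : z i ** z i = z i by apply: zl; case: (zP i).
(* Multiplication by the central block unit moves all coefficients into block i without changing the
   sum. *)
pose r' := [seq (e i ** j.1, e i ** j.2) | j <- r].
apply: (oz_support hom inj e_idem e_central Gccp (q := qi i) (r := r')) => //.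
- rewrite {1}zE big_map; apply: eq_bigr => j _ /=.
  by rewrite e_central -!cmulA (cmulA (e i) (qi i)) eqi (cmulA (qi i)) -e_central eqi.
- by move=> _ /mapP[j _ ->] /=; rewrite !cmulA e_idem.
- exact: fqi.
Qed.

Lemma cut_hom : exists pr : T -> opmx R N,
  [/\ star_hom pr, (forall y, nrm (pr y) <= nrm y),
    (forall c, c \in cs -> nrm (pr (x_ c)) <= gam) &
    (forall c, c \in cs -> nrm c - eta - kap <= nrm (pr (psi c)))].
Proof.
have [q [saq qq fq xq]] := cut_projection.
have [z [ez saz zc zq [f Gf fz]]] := support saq qq fq.
pose zt := \sum_i z i.
have zeq i : z i ** q = e i ** q.
  by rewrite -{1}(ez i) e_central -cmulA zq.
have ztq : zt ** q = q.
  by rewrite /zt cmul_suml (eq_bigr (fun i => e i ** q)) ?e_sum.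
have ztc y : zt ** y = y ** zt.
  by rewrite /zt cmul_suml cmul_sumr; apply: eq_bigr => i _; exact: zc.
have sazt : sa zt by rewrite /sa cstar_sum; apply: eq_bigr => i _; by case: (saz i).
have zz i : zt ** z i = z i.
  rewrite /zt cmul_suml (bigD1 i) //= big1 ?addr0 => [|j ji].
    by case: (saz i).
  by rewrite -(ez j) -(ez i) e_central -cmulA (cmulA (e j)) e_orth // cmul0l cmul0r.
have ztzt : zt ** zt = zt by rewrite {2}/zt cmul_sumr; apply: eq_bigr => i _; exact: zz.
pose cut y := y - zt ** y.
have cutM a b : cut (a ** b) = cut a ** cut b.
  rewrite /cut cmulBr; have -> : (a - zt ** a) ** (zt ** b) = 0.
    by rewrite cmulA cmulBl -!ztc cmulA ztzt subrr cmul0l.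
  by rewrite subr0 cmulBl cmulA.
have cut_star a : cut a^# = (cut a)^#.
  by rewrite /cut cstarB cstarM sazt ztc.
have cut_hom : star_hom (fun y => p (cut y)).
  split=> [c a b|a b|a].
  - rewrite -(homZ hom) -(homD hom) /cut cmulDr cmulZr scalerBr opprD.
    by rewrite addrACA.
  - by rewrite cutM (homM hom).
  - by rewrite cut_star (hom_star hom).
(* y^# ** y minus the square of the cut is the square of zt ** y. *)
have cut_le y : nrm (cut y) <= nrm y.
  rewrite -(@ler_pXn2r _ 2) ?nnegrE ?nrm_ge0 // -!nrm_starM -!(rep_nrm hom inj).
  apply: psd_nrm_le; first by apply: (cpos_rep_psd hom); exact: cpos_starM.
  rewrite -(homB hom) -cut_star -cutM /cut opprB addrC subrK.
  have -> : zt ** (y^# ** y) = (zt ** y)^# ** (zt ** y).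
    by rewrite cstarM sazt -ztc -!cmulA (cmulA y^#) -ztc !cmulA ztzt.
  by apply: (cpos_rep_psd hom); exact: cpos_starM.
exists (fun y => p (cut y)); split => //.
- by move=> y; rewrite (rep_nrm hom inj).
- move=> c cc.
  have cx : nrm (p (cut x)) <= gam.
    (* The cut kills q ** x because zt dominates q; what remains is below gam. *)
    have -> : cut x = cut (x - q ** x).
      by rewrite /cut cmulBr cmulA ztq opprB addrA subrK.
    by rewrite (rep_nrm hom inj) (le_trans (cut_le _)).
  apply: le_trans cx; apply: psd_nrm_le.
    by apply: (cpos_rep_psd cut_hom); exact: cpos_x.
  rewrite -(homB cut_hom) /x (big_rem c cc) /= addrC addrK (hom_sum cut_hom).
  by apply: psd_sum => b _; apply: (cpos_rep_psd cut_hom); exact: cpos_x.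
- move=> c cc; rewrite (rep_nrm hom inj).
  have lf := ccp_lin (Gccp Gf); have [fc _] := approx Gf cc.
  set y := psi c in fc *.
  apply: (@le_trans _ _ (nrm (f (cut y)))); last exact: ccp_nrm (Gccp Gf).
  (* c is close to f y, the sum of f (cut y) and f (zt ** y); it remains to bound the latter. *)
  have h1 : nrm c <= nrm (f y - c) + nrm (f (cut y)) + nrm (f (zt ** y)).
    have cE : c = - (f y - c) + f (cut y) + f (zt ** y).
      by rewrite /cut (linB lf) opprB -addrA subrK subrK.
    rewrite {1}cE (le_trans (nrmD _ _)) // lerD2r (le_trans (nrmD _ _)) //.
    by rewrite (nrmN (f y - c)).
  suff h2 : nrm (f (zt ** y)) <= kap by lra.
  (* By the Schwarz inequality f w ** (f w)^# is below f (w ** w^#), and w ** w^# is below M^2 zt;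
     then [fz] and [consts] apply. *)
  set w := zt ** y.
  rewrite -(@ler_pXn2r _ 2) ?nnegrE ?nrm_ge0 // -nrm_Mstar.
  apply: le_trans consts.
  have [apS _] := schwarz_unital w (Gccp Gf) one1 saone onel.
  have apw : apos (f w ** (f w)^#) by rewrite -{1}[f w]cstarK; exact: apos_starM.
  have := apos_nrm_le Anormed apw apS; rewrite addrC subrK => /le_trans; apply.
  have ww : p (w ** w^#) = p zt ** p (y ** y^#) ** (p zt)^#.
    by rewrite -(hom_star hom) -!(homM hom) /w cstarM !cmulA.
  have pyy : nrm (p (y ** y^#)) <= M ^+ 2.
    rewrite (rep_nrm hom inj) nrm_Mstar lerXn2r ?nnegrE ?nrm_ge0 //.
    by rewrite (le_trans (ccp_nrm _ cpsi)) ?csM.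
  have psyy : psd (p (y ** y^#)).
    by rewrite (homM hom) (hom_star hom); exact: psd_Mstar.
  have psww : psd (p (w ** w^#)).
    by rewrite (homM hom) (hom_star hom); exact: psd_Mstar.
  have le : nrm (f (w ** w^#)) <= nrm (f ((M ^+ 2)%:C *: zt)).
    apply: f_le => //; rewrite (homB hom) (homZ hom) ww.
    have E : p zt ** (p zt)^# = p zt by rewrite -(hom_star hom) -(homM hom) sazt ztzt.
    by have := psd_bound (p zt) pyy psyy; rewrite E.
  apply: le_trans le _; rewrite (linZ lf) nrmZr ger0_norm ?sqr_ge0 // mulrC.
  rewrite ler_wpM2r ?sqr_ge0 // /zt (lin_sum lf) (le_trans (nrm_sum _ _ _)) //.
  apply: le_trans (ler_sum _ (fun i _ => fz i)) _.
  by rewrite sumr_const card_ord -[X in X <= _]mulr_natl.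
Qed.

End Cut.

(** * Simple commutative C*-algebras *)

Section GelfandMazur.
Variables (R : realType) (U : cstarAlgType R) (one : U).
Local Notation C := R[i].
Hypothesis onel : forall u : U, one ** u = u.
Hypothesis cmulC : forall u v : U, u ** v = v ** u.
Hypothesis one0 : one != 0.
Hypothesis inverse : forall x : U, x != 0 -> exists y, x ** y = one.

Let oner u : u ** one = u. Proof. by rewrite cmulC onel. Qed.

Let saone : one^# = one.
Proof.
have h : one^# = one^# ** one by rewrite oner.
have := congr1 (@cstar R U) h; rewrite cstarM cstarK => e.
by rewrite [RHS]e oner.
Qed.

Let nrm1 : nrm one = 1.
Proof.
have := nrm_starM one; rewrite saone onel expr2 => h.
have n0 : nrm one != 0 by rewrite gt_eqF // nrm_gt0.
by apply: (mulfI n0); rewrite -h mulr1.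
Qed.

Let inv_exists : exists inv : U -> U, forall x, x != 0 -> x ** inv x = one.
Proof.
have h x : exists y, x != 0 -> x ** y = one.
  have [->|x0] := eqVneq x 0; first by exists 0 => /eqP.
  by have [y xy] := inverse x0; exists y.
by have [inv invP] := choice h; exists inv.
Qed.

Let inv := projT1 (cid inv_exists).
Let invP x : x != 0 -> x ** inv x = one.
Proof. exact: (projT2 (cid inv_exists)). Qed.

Let inv_unique (x y : U) : x ** y = one -> y = inv x.
Proof.
move=> xy; have x0 : x != 0.
  by apply: contra_neq one0 => x0; rewrite -xy x0 cmul0l.
by rewrite -[LHS]oner -(invP x0) cmulA (cmulC y) xy onel.
Qed.

Let mul_neq0 (x y : U) : x != 0 -> y != 0 -> x ** y != 0.
Proof.
move=> x0 y0; apply: contra_neq one0 => xy.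
by rewrite -(invP x0) -[x]oner -(invP y0) cmulA xy !cmul0l.
Qed.

Let resolvent (x y : U) : x != 0 -> y != 0 -> inv x - inv y = inv x ** (y - x) ** inv y.
Proof.
move=> x0 y0; rewrite cmulBr cmulBl -cmulA (invP y0) oner.
by rewrite (cmulC _ x) (invP x0) onel.
Qed.

(* Rickart's proof of [gelfand_mazur]: if [h] were not a scalar, the resolvents
   g_m(y) = (1 - y h^(2^m))^-1 would exist for all y.  As
   g_(m+1)(w^2) = (g_m(w) + g_m(-w)) / 2, a bound on |g_0(w) - g_0(r w)| over the
   unit circle passes to g_m, with r^(2^m) in place of r.  For large m this makes
   g_m(1) close to g_m(0) = 1 and h^(2^m) small, whereas |h^(2^m)| = 1. *)
Section NonScalar.
Variable h : U.
Hypothesis sah : sa h.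
Hypothesis h1 : nrm h = 1.
Hypothesis nonscalar : forall z : C, h != z *: one.

Let res0 (y : C) : one - y *: h != 0.
Proof.
have [->|y0] := eqVneq y 0; first by rewrite scale0r subr0.
apply: contra_neq (nonscalar y^-1) => /eqP.
by rewrite subr_eq0 => /eqP ->; rewrite scalerA mulVf ?scale1r.
Qed.

Let hm m := sqiter m h.

Let fact (y : C) (k : U) : (one - y *: k) ** (one + y *: k) = one - y ^+ 2 *: (k ** k).
Proof.
rewrite cmulDr !cmulBl !onel oner cmulZl cmulZr scalerA -expr2.
by rewrite addrA subrK.
Qed.

(** Factor 1 - y k^2 as (1 - s k) (1 + s k) with s a square root of y. *)
Let resm0 m y : one - y *: hm m != 0.
Proof.
elim: m y => [|m IH] y; first exact: res0.
rewrite -(sqr_sqrtc y) -fact; apply: mul_neq0; first exact: IH.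
by have := IH (- sqrtc y); rewrite scaleNr opprK.
Qed.

Let g m y := inv (one - y *: hm m).

Let gS m w : g m.+1 (w ^+ 2) = 2^-1 *: (g m w + g m (- w)).
Proof.
apply/esym/inv_unique; rewrite [hm m.+1]/(hm m ** hm m) -fact.
rewrite cmulZr cmulDr /g.
have e1 : (one - w *: hm m) ** (one + w *: hm m) ** inv (one - w *: hm m) = one + w *: hm m.
  by rewrite -cmulA (cmulC (one + w *: hm m)) cmulA invP ?resm0 // onel.
have e2 : (one - w *: hm m) ** (one + w *: hm m) ** inv (one - (- w) *: hm m) = one - w *: hm m.
  rewrite scaleNr opprK -cmulA invP ?oner //.
  by have := resm0 m (- w); rewrite scaleNr opprK.
rewrite e1 e2 addrACA subrr addr0 -mulr2n -[one *+ 2]scaler_nat scalerA.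
by rewrite mulVf ?scale1r // pnatr_eq0.
Qed.

(** The product (1 - u h) (1 - v h) for u v = 1 and u + v = 2 a; on the unit circle, u = w and v is
    its conjugate, with a = Re w. *)
Let quad (a : R) := one - (2 * a)%:C *: h + h ** h.

Let quadE (u v : C) (a : R) : u * v = 1 -> u + v = (2 * a)%:C ->
  (one - u *: h) ** (one - v *: h) = quad a.
Proof.
move=> uv upv; rewrite cmulBr oner cmulBl onel cmulZl cmulZr scalerA uv scale1r.
by rewrite /quad -upv scalerDl opprB opprD [h ** h - _]addrC !addrA.
Qed.

Let quad0 a : quad a != 0.
Proof.
(* u and v are the two complex roots of t^2 - 2 a t + 1, for every real a and not only on
   [-1, 1]. *)
pose s := sqrtc ((a ^+ 2 - 1)%:C).
rewrite -(quadE (u := a%:C + s) (v := a%:C - s)).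
- exact: mul_neq0.
- rewrite mulrC -subr_sqr sqr_sqrtc -rmorphXn -rmorphB.
  by rewrite opprB addrCA subrr addr0.
- by rewrite addrACA subrr addr0 -rmorphD -mulr2n mulr_natl.
Qed.

(** Taking the reciprocal makes the function globally Lipschitz by the resolvent identity, with no
    prior bound on the inverses. *)
Let phi a := (nrm (inv (quad a)))^-1.

Let inv_quad_gt0 a : 0 < nrm (inv (quad a)).
Proof.
rewrite nrm_gt0; apply: contra_neq one0 => e.
by rewrite -(invP (quad0 a)) e cmul0r.
Qed.

Let phi_lip a b : `|phi a - phi b| <= 2 * `|a - b|.
Proof.
suff le c d : phi c - phi d <= 2 * `|c - d|.
  by rewrite ler_norml lerNl opprB !le // distrC le.
have cp := inv_quad_gt0 c; have dp := inv_quad_gt0 d.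
have r1 := resolvent (quad0 d) (quad0 c).
have -> : phi c - phi d = (nrm (inv (quad d)) - nrm (inv (quad c))) *
    (phi c * phi d).
  by rewrite /phi; field; rewrite !gt_eqF.
rewrite /phi -invfM ler_pdivrMr ?mulr_gt0 //.
have r2 : nrm (inv (quad d)) <= nrm (inv (quad d) - inv (quad c)) + nrm (inv (quad c)).
  by rewrite -{1}[inv (quad d)](subrK (inv (quad c))) nrmD.
have r3 : nrm (inv (quad d) - inv (quad c)) <=
    nrm (inv (quad d)) * (2 * `|c - d|) * nrm (inv (quad c)).
  rewrite r1; apply: nrmM_le => //; apply: nrmM_le => //.
  have -> : quad c - quad d = (2 * (d - c))%:C *: h.
    rewrite /quad opprD addrACA subrr addr0 opprB addrC addrA subrK.
    by rewrite -scalerBl -rmorphB mulrBr.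
  by rewrite nrmZr h1 mulr1 normrM normr_nat distrC.
rewrite lerBlDr (le_trans r2) // lerD2r (le_trans r3) //.
by rewrite le_eqVlt; apply/orP; left; apply/eqP; ring.
Qed.

Let invM (x y : U) : x != 0 -> y != 0 -> inv (x ** y) = inv x ** inv y.
Proof.
move=> x0 y0; apply/esym/inv_unique.
by rewrite cmulA (cmulC (x ** y)) cmulA (cmulC _ x) invP // onel invP.
Qed.

Let inv_star (x : U) : x != 0 -> inv x^# = (inv x)^#.
Proof.
by move=> x0; apply/esym/inv_unique; rewrite -cstarM cmulC invP ?saone.
Qed.

(* For |w| = 1, |g_0(w)|^2 is the norm of the inverse of [quad (Re w)]: a function of
   a parameter in [-1, 1], so that the extreme value theorem on R applies. *)
Let circle_bound : exists M : R, 0 < M /\ forall w : C, nrm w = 1 -> nrm (g 0 w) <= M.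
Proof.
have pc : {within `[-1, 1], continuous phi}.
  apply: continuous_subspaceT => a; apply/cvgrPdist_lt => d d0.
  near=> b; apply: le_lt_trans (phi_lip _ _) _.
  rewrite mulrC -ltr_pdivlMr //; near: b.
  by apply: cvgr_dist_lt; rewrite ?divr_gt0.
have le11 : -1 <= 1 :> R by lra.
have [a0 _ amin] := EVT_min le11 pc.
have mu0 : 0 < phi a0 by rewrite invr_gt0.
(* t^2 <= c implies t <= 1 + c, which avoids a square root. *)
exists (1 + (phi a0)^-1); split=> [|w w1]; first by rewrite ltr_wpDr // invr_ge0 ltW.
have wa : complex.Re w \in `[-1, 1]%R.
  by rewrite in_itv /= -ler_norml (le_trans (normr_Re _)) // w1.
have stE : (one - w *: h)^# = one - w^* *: h by rewrite cstarB cstarZ sah saone.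
have gg : nrm (g 0 w) ^+ 2 = nrm (inv (quad (complex.Re w))).
  rewrite -nrm_starM /g /= -inv_star ?resm0 // -invM ?resm0 //; last first.
    by rewrite stE; exact: (resm0 0).
  rewrite stE (quadE (a := complex.Re w)) //.
    rewrite mulrC; apply: etrans (esym (sqr_normc w)) _.
    by rewrite nrmE w1 expr1n.
  by rewrite addrC addcJ rmorphM rmorph_nat.
have le : nrm (inv (quad (complex.Re w))) <= (phi a0)^-1.
  have := amin _ wa; rewrite /phi => hle.
  by rewrite -[leLHS]invrK lef_pV2 ?posrE ?invr_gt0.
move: (phi a0)^-1 le => c; rewrite -gg; move: (nrm _) (nrm_ge0 (g 0 w)) => t t0; nra.
Unshelve. all: by end_near.
Qed.

Let radial (d : R) : 0 < d -> exists r : R, [/\ 0 < r, r < 1 &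
  forall w : C, nrm w = 1 -> nrm (g 0 w - g 0 (r%:C * w)) <= d].
Proof.
move=> d0; have [M [M0 hM]] := circle_bound.
(* The radius is 1 - s. The bound s M <= 1/2 gives |g(r w)| <= 2 M by the resolvent identity, and
   the same identity bounds the difference by 2 s M^2 <= d. *)
pose s := Num.min (1 / 2) (Num.min (1 / (2 * M)) (d / (2 * M ^+ 2))).
have s0 : 0 < s by rewrite !lt_min !divr_gt0 ?mulr_gt0 ?exprn_gt0.
have sM : s * M <= 1 / 2.
  have : s <= 1 / (2 * M) by rewrite /s !ge_min lexx orbT.
  by rewrite ler_pdivlMr ?mulr_gt0 //; lra.
have sd : 2 * s * M ^+ 2 <= d.
  have : s <= d / (2 * M ^+ 2) by rewrite /s !ge_min lexx !orbT.
  by rewrite ler_pdivlMr ?mulr_gt0 ?exprn_gt0 //; lra.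
have s12 : s <= 1 / 2 by rewrite /s ge_min lexx.
exists (1 - s); split; [lra|lra|] => w w1.
have r1 := resolvent (resm0 0 w) (resm0 0 ((1 - s)%:C * w)).
have le : nrm (g 0 w - g 0 ((1 - s)%:C * w)) <= M * s * nrm (g 0 ((1 - s)%:C * w)).
  rewrite /g r1; apply: nrmM_le => //; apply: nrmM_le; first exact: hM.
  have -> : one - ((1 - s)%:C * w) *: hm 0 - (one - w *: hm 0) = (s%:C * w) *: h.
    rewrite opprB addrC addrA subrK -scalerBl; congr (_ *: _).
    by rewrite rmorphB rmorph1 mulrBl mul1r opprB addrCA subrr addr0.
  by rewrite nrmZ h1 mulr1 nrmcM w1 mulr1 nrm_real ger0_norm // ltW.
have le2 : nrm (g 0 ((1 - s)%:C * w)) <= 2 * M.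
  have : nrm (g 0 ((1 - s)%:C * w)) <=
      nrm (g 0 w) + nrm (g 0 w - g 0 ((1 - s)%:C * w)).
    by rewrite -{1}[g 0 ((1 - s)%:C * w)](subKr (g 0 w)) nrmB.
  have h12 : M * s * nrm (g 0 ((1 - s)%:C * w)) <= 1 / 2 * nrm (g 0 ((1 - s)%:C * w)).
    by rewrite ler_wpM2r ?nrm_ge0 // mulrC.
  have := hM _ w1; lra.
apply: le_trans le _; apply: le_trans sd.
have -> : 2 * s * M ^+ 2 = M * s * (2 * M) by ring.
by rewrite ler_wpM2l // mulr_ge0 ?(ltW M0) ?(ltW s0).
Qed.

Let radial_iter (d r : R) m :
  (forall w : C, nrm w = 1 -> nrm (g 0 w - g 0 (r%:C * w)) <= d) ->
  forall w : C, nrm w = 1 -> nrm (g m w - g m ((r ^+ (2 ^ m))%:C * w)) <= d.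
Proof.
move=> h0; elim: m => [|m IH] w w1; first by rewrite expn0 expr1; exact: h0.
pose s := sqrtc w.
have s1 : nrm s = 1.
  have : nrm s ^+ 2 = 1 by rewrite expr2 -nrmcM -expr2 sqr_sqrtc w1.
  by move/eqP; rewrite sqrp_eq1 ?nrm_ge0 // => /eqP.
have wE : w = s ^+ 2 by rewrite sqr_sqrtc.
have -> : (r ^+ (2 ^ m.+1))%:C * w = ((r ^+ (2 ^ m))%:C * s) ^+ 2.
  by rewrite exprMn -wE -rmorphXn -exprM -expnSr.
rewrite {1}wE !gS -scalerBr nrmZ opprD addrACA.
have n2 : nrm (2^-1 : C) = 2^-1.
  by rewrite -(rmorph_nat (real_complex R)) -fmorphV nrm_real ger0_norm // invr_ge0.
rewrite n2 -mulrN ler_pdivrMl //.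
rewrite (le_trans (nrmD _ _)) // mulr2n mulrDl !mul1r lerD ?IH // nrmN //.
Qed.

Lemma rickart_contradiction : False.
Proof.
(* With t <= 1/16 one gets |v - 1| <= 1/8, hence |w - 1| <= 1/4, against 1 <= 2 |w - 1|. *)
have [r [r0 r1 hr]] := @radial (1 / 8) (divr_gt0 ltr01 (ltr0n _ 8)).
have [m hm8] : exists m, r ^+ (2 ^ m) <= 1 / 16.
  apply: contrapT => hn; suff : 1 <= r by rewrite leNgt r1.
  apply: (@pow2_le _ 16) => //; first exact: ltW.
  move=> k; rewrite expr1n.
  have : 1 / 16 < r ^+ (2 ^ k) by rewrite ltNge; apply/negP => hle; apply: hn; exists k.
  by lra.
have le1 := radial_iter m hr (_ : nrm (1 : C) = 1).
have kn : nrm (hm m) = 1 by rewrite nrm_sqiter // h1 expr1n.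
set k := hm m in kn.
pose t := r ^+ (2 ^ m); pose w := g m 1; pose v := g m t%:C.
have t0 : 0 < t by rewrite exprn_gt0.
have wv : nrm (w - v) <= 1 / 8.
  by have := le1; rewrite mulr1; apply; rewrite (nrm_real 1) normr1.
have vE : v - one = t%:C *: (k ** v).
  have : (one - t%:C *: k) ** v = one by apply: invP; exact: resm0.
  by rewrite cmulBl onel cmulZl => <-; rewrite opprB addrCA subrr addr0.
have wE : w - one = k ** w.
  have : (one - 1 *: k) ** w = one by apply: invP; exact: resm0.
  by rewrite scale1r cmulBl onel => <-; rewrite opprB addrCA subrr addr0.
have v1 : nrm (v - one) <= t * nrm v.
  rewrite vE nrmZr (gtr0_norm t0) ler_wpM2l ?(ltW t0) //.
  by rewrite (le_trans (nrmM _ _)) // kn mul1r.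
have v2 : nrm v <= 1 + nrm (v - one).
  by rewrite -{1}[v](subrK one) addrC (le_trans (nrmD _ _)) // nrm1.
have w1 : nrm (w - one) <= nrm (w - v) + nrm (v - one).
  by rewrite -{1}(subrK v w) -addrA nrmD.
(* w is the inverse of 1 - k; closeness of w to 1 therefore forces k to be small, although |k| =
   1. *)
have kE : k = (w - one) - k ** (w - one).
  by rewrite {1}wE cmulBr oner opprB addrC subrK.
have k1 : 1 <= nrm (w - one) + nrm (w - one).
  rewrite -{1}kn {1}kE (le_trans (nrmB _ _)) // lerD2l.
  by rewrite (le_trans (nrmM _ _)) // kn mul1r.
have : nrm (v - one) <= 1 / 8.
  have h16 : t * nrm v <= 1 / 16 * nrm v by rewrite ler_wpM2r ?nrm_ge0.
  lra.
lra.
Qed.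

End NonScalar.

Lemma sa_scalar (h : U) : sa h -> exists z : C, h = z *: one.
Proof.
move=> sah; have [->|h0] := eqVneq h 0; first by exists 0; rewrite scale0r.
apply: contrapT => hn.
have np : 0 < nrm h by rewrite nrm_gt0.
pose k := (nrm h)^-1%:C *: h.
apply: (@rickart_contradiction k).
- by rewrite /sa cstarZr sah.
- by rewrite nrmZr ger0_norm ?invr_ge0 ?nrm_ge0 // mulVf // gt_eqF.
- move=> z; apply/eqP => e; apply: hn; exists ((nrm h)%:C * z).
  rewrite -scalerA -e scalerA -rmorphM mulfV ?rmorph1 ?scale1r // gt_eqF //.
Qed.

Lemma gelfand_mazur (u : U) : exists z : C, u = z *: one.
Proof.
have [b [c [sab sac ->]]] := re_im u.
have [y ->] := sa_scalar sab; have [z ->] := sa_scalar sac.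
by exists (y + 'i%C * z); rewrite scalerDl scalerA.
Qed.

End GelfandMazur.

Section Topology.
Variable R : realType.
Local Notation C := R[i].

Lemma closed_nrm (V : normedModType C) (I : set V) :
  (forall a, (forall e : R, 0 < e -> exists2 b, I b & nrm (a - b) < e) -> I a) ->
  closed I.
Proof.
move=> h a ca; apply: h => e e0.
have e0' : 0 < e%:C :> C by rewrite ltcR.
have [b [Ib ab]] := ca _ (nbhsx_ballx a _ e0').
by exists b => //; move: ab; rewrite -ball_normE /= nrmE ltcR.
Qed.

Lemma contractive_continuous (A B : normedModType C) (f : A -> B) :
  linear f -> (forall a, nrm (f a) <= nrm a) -> continuous f.
Proof.
move=> lin h a; apply/cvgrPdist_lt => d /gt0_ReE[-> d0].
have d0' : 0 < (complex.Re d)%:C :> C by rewrite ltcR.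
near=> b.
have -> : f a - f b = f (a - b).
  by have e := lin (-1) b a; rewrite !scaleN1r in e; rewrite [a - b]addrC e [RHS]addrC.
rewrite nrmE ltcR; apply: le_lt_trans (h _) _; rewrite -ltcR -nrmE.
by near: b; apply: cvgr_dist_lt.
Unshelve. all: by end_near.
Qed.

End Topology.

Section Neumann.
Variables (R : realType) (U : cstarAlgType R) (one : U).
Local Notation C := R[i].
Hypothesis onel : forall u : U, one ** u = u.

(** S n is the n-th partial sum of the Neumann series, written as a fixed-point iteration whose
    limit solves l = 1 + x l. *)
Lemma neumann (a : U) : nrm (one - a) < 1 -> exists b, a ** b = one.
Proof.
set x := one - a; set r := nrm x => r1.
have r0 : 0 <= r by exact: nrm_ge0.
pose S n := iter n (fun y => one + x ** y) (0 : U).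
have r10 : 0 < 1 - r by rewrite subr_gt0.
pose B := nrm one / (1 - r).
have B0 : 0 <= B by rewrite divr_ge0 ?nrm_ge0 // ltW.
have SB n : nrm (S n) <= B.
  elim: n => [|n IH] /=; first by rewrite nrm0.
  rewrite (le_trans (nrmD _ _)) //.
  have -> : B = nrm one + r * B by rewrite /B; field; rewrite gt_eqF.
  by rewrite lerD2l; apply: nrmM_le.
have Sdiff n j : nrm (S (n + j)%N - S n) <= r ^+ n * B.
  elim: n => [|n IH]; first by rewrite subr0 expr0 mul1r add0n.
  rewrite addSn /= opprD addrACA subrr add0r -cmulBr exprS -mulrA.
  exact: nrmM_le.
have small (e : R) : 0 < e -> exists n, r ^+ n * B < e.
  move=> e0; apply: contrapT => hn; suff : 1 <= r by rewrite leNgt r1.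
  apply: (@pow2_le _ (B / e)) => // k; rewrite expr1n mulrAC ler_pdivlMr // mul1r mulrC.
  by rewrite leNgt; apply/negP => h; apply: hn; exists (2 ^ k)%N.
have cS : cvg (S @ \oo).
  apply/cauchy_cvgP; apply: cauchy_exP => d /gt0_ReE[-> d0].
  have [n hn] := small _ d0; exists (S n); exists n => // m /= nm.
  rewrite -ball_normE /= nrmE ltcR nrmBC -(subnKC nm).
  exact: le_lt_trans (Sdiff _ _) hn.
move: cS => /cvg_ex[l Sl]; exists l.
have lx : l = one + x ** l.
  apply/eqP; rewrite -subr_eq0; apply/eqP/nrm_le0_eq0; apply/ler_addgt0Pr => e e0.
  rewrite add0r.
  have e20 : 0 < (e / 2)%:C :> C by rewrite ltcR divr_gt0.
  have /cvgrPdist_lt /(_ _ e20)[n _ hn] := Sl.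
  have h1 := hn n (leqnn n); have h2 := hn n.+1 (leqnSn n).
  rewrite !nrmE !ltcR in h1 h2.
  have -> : l - (one + x ** l) = (l - S n.+1) + x ** (S n - l).
    by rewrite [S n.+1]/(one + x ** S n) cmulBr !opprD !addrA subrK.
  rewrite (le_trans (nrmD _ _)) // [leRHS]splitr lerD ?(ltW h2) //.
  rewrite -[leRHS]mul1r; apply: nrmM_le; first exact: ltW.
  by rewrite nrmBC ltW.
move: lx; rewrite /x cmulBl onel => lx.
by apply/eqP; rewrite -subr_eq0 -oppr_eq0 opprB -[X in _ == X](subrr l) {2}lx addrCA addrC addrK.
Qed.

End Neumann.

Section SimpleCommutative.
Variables (R : realType) (U : cstarAlgType R) (one : U).
Local Notation C := R[i].
Hypothesis onel : forall u : U, one ** u = u.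
Hypothesis cmulC : forall u v : U, u ** v = v ** u.
Hypothesis U_simple : simple_cstar U.

(** The closure of x U is a closed ideal containing x, hence all of U; some x ** y is then within
    distance 1 of the unit, so invertible. *)
Lemma simple_comm_inverse (x : U) : x != 0 -> exists y, x ** y = one.
Proof.
move=> x0.
pose I : set U := [set a | forall e : R, 0 < e -> exists y, nrm (a - x ** y) < e].
have idI : closed_ideal I.
  have mulI w a : I a -> I (w ** a).
    move=> Ia e e0; have w0 : 0 < nrm w + 1 by rewrite ltr_wpDl ?nrm_ge0.
    have [y hy] := Ia _ (divr_gt0 e0 w0); exists (w ** y).
    have -> : w ** a - x ** (w ** y) = w ** (a - x ** y).
      by rewrite cmulBr !cmulA (cmulC x w).
    apply: (@le_lt_trans _ _ ((nrm w + 1) * nrm (a - x ** y))).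
      by apply: nrmM_le => //; rewrite lerDl.
    by rewrite mulrC -ltr_pdivlMr.
  split.
  - apply: closed_nrm => a ha e e0; have e20 : 0 < e / 2 by rewrite divr_gt0.
    have [b Ib ab] := ha _ e20; have [y by_] := Ib _ e20; exists y.
    rewrite -(subrK b a) -addrA (le_lt_trans (nrmD _ _)) //.
    by rewrite [ltRHS]splitr ltrD.
  - by move=> e e0; exists 0; rewrite cmul0r subrr nrm0.
  - move=> z a b Ia Ib e e0; have e20 : 0 < e / 2 by rewrite divr_gt0.
    have Iza : I (z *: a).
      have -> : z *: a = (z *: one) ** a by rewrite cmulZl onel.
      exact: mulI.
    have [y hy] := Iza _ e20; have [w hw] := Ib _ e20; exists (y + w).
    rewrite cmulDr opprD addrACA (le_lt_trans (nrmD _ _)) //.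
    by rewrite [ltRHS]splitr ltrD.
  - exact: mulI.
  - by move=> w a Ia; rewrite cmulC; exact: mulI.
have [_ /(_ I idI)[I0|IT]] := U_simple.
  have : I x by move=> e e0; exists one; rewrite cmulC onel subrr nrm0.
  by rewrite I0 /= => xe; rewrite xe eqxx in x0.
have : I one by rewrite IT.
move=> /(_ 1 ltr01)[y /(neumann onel)[b yb]].
by exists (y ** b); rewrite cmulA.
Qed.

Lemma simple_comm_scalar (u : U) : exists z : C, u = z *: one.
Proof.
have one0 : one != 0.
  case: U_simple => -[a a0] _; apply: contra_neq a0 => e.
  by rewrite -[a]onel e cmul0l.
exact: gelfand_mazur simple_comm_inverse u.
Qed.

End SimpleCommutative.

(** * Modules *)

Section Action.
Variables (R : realType) (U : cstarAlgType R) (A : cstarModType U).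
Local Notation C := R[i].

Lemma actDl (a b : A) u : act (a + b) u = act a u + act b u.
Proof. by have := act_linearl u 1 a b; rewrite !scale1r. Qed.

Lemma act0l u : act (0 : A) u = 0.
Proof. by apply: (addIr (act 0 u)); rewrite -actDl !add0r. Qed.

Lemma actBl (a b : A) u : act (a - b) u = act a u - act b u.
Proof. by rewrite addrC -scaleN1r act_linearl scaleN1r addrC. Qed.

Lemma actDr (a : A) u v : act a (u + v) = act a u + act a v.
Proof. by have := act_linearr a 1 u v; rewrite !scale1r. Qed.

Lemma act0r (a : A) : act a 0 = 0.
Proof. by apply: (addIr (act a 0)); rewrite -actDr !add0r. Qed.

Lemma actBr (a : A) u v : act a (u - v) = act a u - act a v.
Proof. by rewrite addrC -scaleN1r act_linearr scaleN1r addrC. Qed.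

Lemma nrm_act (a : A) u : nrm (act a u) <= nrm a * nrm u.
Proof. by rewrite -lecR rmorphM /= -!nrmE act_norm. Qed.

Hypothesis act_star : forall (a : A) (u : U), (act a u)^# = act a^# u^#.

(** The involution reverses products, so it carries [act_mull] over to the other factor. *)
Lemma act_mulr_swap (a b : A) u : act (a ** b) u = act a u ** b.
Proof.
rewrite -[LHS]cstarK act_star cstarM act_mull -act_star -cstarM.
by rewrite cstarK.
Qed.

(** On a product b ** c both orders of u and v lead to act b u ** act c v. For a single a, set y to
    be the left side: y^# ** y is the action on a product. *)
Lemma act_commutator (a : A) u v : act a (u ** v - v ** u) = 0.
Proof.
have h (b c : A) : act (b ** c) (u ** v - v ** u) = 0.
  rewrite actBr act_mulr act_mulr_swap (act_mull (act b u)); apply/eqP; rewrite subr_eq0; apply/eqP.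
  by rewrite [RHS]act_mulr act_mull act_mulr_swap.
by apply: starM_eq0; rewrite -act_mull h.
Qed.

Lemma annihilator_ideal : closed_ideal [set u : U | forall a : A, act a u = 0].
Proof.
split => [|a|z u v hu hv a|x u hu a|x u hu a].
- apply: closed_nrm => u hu a; apply: nrm_le0_eq0; apply/ler_addgt0Pr => e e0.
  have a0 : 0 < nrm a + 1 by rewrite ltr_wpDl ?nrm_ge0.
  have [v hv uv] := hu _ (divr_gt0 e0 a0).
  rewrite add0r -[act a u]subr0 -(hv a) -actBr (le_trans (nrm_act _ _)) //.
  apply: (@le_trans _ _ ((nrm a + 1) * nrm (u - v))).
    by rewrite ler_wpM2r ?nrm_ge0 // lerDl.
  by rewrite mulrC -ler_pdivlMr // ltW.
- exact: act0r.
- by rewrite act_linearr hu hv scaler0 addr0.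
- by rewrite act_mulr hu.
- by rewrite act_mulr hu act0l.
Qed.

End Action.

(** * Coefficient algebras isomorphic to the scalars *)

Record character (R : realType) (U : cstarAlgType R) (one : U) := Character {
  chi :> U -> R[i] ;
  chiE : forall u, u = chi u *: one ;
  chi_scale : forall z : R[i], chi (z *: one) = z ;
  char_onel : forall u, one ** u = u ;
  char_oner : forall u, u ** one = u ;
  char_neq0 : one != 0 }.

Section CharacterTheory.
Variables (R : realType) (U : cstarAlgType R) (one : U) (X : character one).
Local Notation C := R[i].

Lemma chi_lin : linear_for *%R X.
Proof.
by move=> z u v; rewrite {1}(chiE X u) {1}(chiE X v) scalerA -scalerDl chi_scale.
Qed.

Lemma chiD u v : X (u + v) = X u + X v.
Proof. by have := chi_lin 1 u v; rewrite scale1r mul1r. Qed.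

Lemma chiZ (z : C) u : X (z *: u) = z * X u.
Proof. by rewrite {1}(chiE X u) scalerA chi_scale. Qed.

Lemma chi0 : X 0 = 0.
Proof. by rewrite -(scale0r one) chi_scale. Qed.

Lemma chi_sum (I : Type) (r : seq I) (P : pred I) (F : I -> U) :
  X (\sum_(i <- r | P i) F i) = \sum_(i <- r | P i) X (F i).
Proof. exact: (big_morph X chiD chi0). Qed.

Lemma chiM u v : X (u ** v) = X u * X v.
Proof.
by rewrite {1}(chiE X u) {1}(chiE X v) cmulZl (char_onel X) scalerA chi_scale.
Qed.

Lemma char_one_sa : one^# = one.
Proof.
have := congr1 (@cstar R U) (char_oner X one^#); rewrite cstarM cstarK => e.
by rewrite -[RHS]e char_oner.
Qed.

Lemma char_one_nrm : nrm one = 1.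
Proof.
have := nrm_starM one; rewrite char_one_sa (char_onel X) expr2 => h.
have n0 : nrm one != 0 by rewrite gt_eqF // nrm_gt0 (char_neq0 X).
by apply: (mulfI n0); rewrite -h mulr1.
Qed.

Lemma chi_star u : X u^# = (X u)^*.
Proof. by rewrite {1}(chiE X u) cstarZ char_one_sa chi_scale. Qed.

Lemma nrm_chi u : nrm (X u) = nrm u.
Proof. by rewrite {2}(chiE X u) nrmZ char_one_nrm mulr1. Qed.

End CharacterTheory.

(** U as a module over itself, that is M_1(U): the target of the zero maps in the case A = 0. *)
Definition regmod (R : realType) (U : cstarAlgType R) : Type := U.

Section RegularModule.
Variables (R : realType) (U : cstarAlgType R).
Local Notation C := R[i].
Local Notation T := (regmod U).

HB.instance Definition _ := CstarAlgebra.copy T U.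

Let reg_act (a : T) (u : U) : T := cmul (a : U) u.

Let reg_linl u (z : C) (a b : T) : reg_act (z *: a + b) u = z *: reg_act a u + reg_act b u.
Proof. exact: (@cmul_linearl R U). Qed.

Let reg_linr (a : T) (z : C) u v : reg_act a (z *: u + v) = z *: reg_act a u + reg_act a v.
Proof. exact: (@cmul_linearr R U). Qed.

Let reg_norm (a : T) u : `|reg_act a u| <= `|a| * `|u|.
Proof. exact: (@cmul_norm R U). Qed.

Let reg_mull (a b : T) u : reg_act (a ** b) u = a ** reg_act b u.
Proof. exact/esym/(@cmulA R U). Qed.

Let reg_mulr (a : T) u v : reg_act a (u ** v) = reg_act (reg_act a u) v.
Proof. exact: (@cmulA R U). Qed.

HB.instance Definition _ := CstarAlgebra_isCstarModule.Build R U T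
  reg_linl reg_linr reg_norm reg_mull reg_mulr.

Definition reg_iota (M : 'M[U]_1) : T := M 0 0.

Lemma reg_matrix_algebra : is_matrix_algebra reg_iota.
Proof.
split.
  exists (fun u : T => const_mx (u : U)) => [M|u]; last by rewrite /reg_iota mxE.
  by apply/matrixP => i j; rewrite !ord1 mxE.
split=> [M N|z M|M N|M|M u]; rewrite /reg_iota ?mxE //.
by rewrite big_ord1.
Qed.

End RegularModule.

(* [M_N(U)] when [U] is one-dimensional, with [X] the isomorphism onto the scalars. *)
Definition chimod (R : realType) (U : cstarAlgType R) (one : U) (X : character one)
  (N : nat) : Type := opmx R N.

Section CharacterModule.
Variables (R : realType) (U : cstarAlgType R) (one : U) (X : character one) (N : nat).
Local Notation C := R[i].
Local Notation T := (chimod X N).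

HB.instance Definition _ := CstarAlgebra.copy T (opmx R N).

Let chi_act (a : T) (u : U) : T := X u *: a.

Let chi_linl u (z : C) (a b : T) : chi_act (z *: a + b) u = z *: chi_act a u + chi_act b u.
Proof. by rewrite /chi_act scalerDr !scalerA mulrC. Qed.

Let chi_linr (a : T) (z : C) u v : chi_act a (z *: u + v) = z *: chi_act a u + chi_act a v.
Proof. by rewrite /chi_act chi_lin scalerDl scalerA. Qed.

Let chi_norm (a : T) u : `|chi_act a u| <= `|a| * `|u|.
Proof. by rewrite !nrmE -rmorphM lecR nrmZ nrm_chi mulrC. Qed.

Let chi_mull (a b : T) u : chi_act (a ** b) u = a ** chi_act b u.
Proof. by rewrite /chi_act cmulZr. Qed.

Let chi_mulr (a : T) u v : chi_act a (u ** v) = chi_act (chi_act a u) v.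
Proof. by rewrite /chi_act scalerA chiM mulrC. Qed.

HB.instance Definition _ := CstarAlgebra_isCstarModule.Build R U T
  chi_linl chi_linr chi_norm chi_mull chi_mulr.

Definition chi_iota (M : 'M[U]_N) : T := (map_mx X M : 'M[C]_N).

Lemma chi_matrix_algebra : is_matrix_algebra chi_iota.
Proof.
split.
  exists (fun M : T => map_mx (fun z : C => z *: one) (M : 'M[C]_N)) => [M|M].
    by apply/matrixP => i j; rewrite !mxE -chiE.
  by apply/matrixP => i j; rewrite !mxE chi_scale.
split=> [M M'|z M|M M'|M|M u]; apply/matrixP => i j.
- by rewrite !mxE chiD.
- by rewrite !mxE chiZ.
- by rewrite !mxE chi_sum; apply: eq_bigr => k _; rewrite !mxE chiM.
- by rewrite !mxE chi_star.
- by rewrite !mxE chiM mulrC.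
Qed.

End CharacterModule.

Section Tensor.
Variables (R : realType) (U : cstarAlgType R) (one : U) (X : character one).
Variables (F : cstarAlgType R) (T : cstarModType U) (t : F -> U -> T).
Local Notation C := R[i].
Hypotheses (Ffin : finite_dim F) (tens : is_tensor t).

Let onel := char_onel X.
Let saone := char_one_sa X.

Let t_linl f g (z : C) : t (z *: f + g) one = z *: t f one + t g one.
Proof. by case: tens => -[h _ _ _ _] _; exact: h. Qed.

Let tD f g : t (f + g) one = t f one + t g one.
Proof. by have := t_linl f g 1; rewrite !scale1r. Qed.

Let t0 : t 0 one = 0.
Proof. by apply: (addIr (t 0 one)); rewrite -tD !add0r. Qed.

Let tZ (z : C) f : t (z *: f) one = z *: t f one.
Proof. by have := t_linl f 0 z; rewrite t0 !addr0. Qed.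

Let t_sum (I : Type) (r : seq I) (P : pred I) (f : I -> F) :
  t (\sum_(i <- r | P i) f i) one = \sum_(i <- r | P i) t (f i) one.
Proof. by apply: (big_morph (fun f => t f one)) => [f1 f2|]; [exact: tD | exact: t0]. Qed.

Let tM f g : t f one ** t g one = t (f ** g) one.
Proof. by case: tens => -[_ _ -> _ _] _; rewrite onel. Qed.

Let t_star f : (t f one)^# = t f^# one.
Proof. by case: tens => -[_ _ _ -> _] _; rewrite saone. Qed.

Let t_scal f u : t f u = X u *: t f one.
Proof.
case: tens => -[_ hr _ _ _] _; have h0 : t f 0 = 0.
  by have := hr f (-1) one one; rewrite !scaleN1r !addNr => ->.
by have := hr f (X u) one 0; rewrite h0 !addr0 -chiE.
Qed.

Lemma tensor_elim (x : T) : exists f, x = t f one.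
Proof.
case: tens => _ [/(_ x)[m [f [u ->]]] _]; exists (\sum_j X (u j) *: f j).
by rewrite t_sum; apply: eq_bigr => j _; rewrite t_scal tZ.
Qed.

Lemma act_tensor (x : T) u : act x u = X u *: x.
Proof.
have [f ->] := tensor_elim x.
by case: tens => -[_ _ _ _ ->] _; rewrite onel t_scal.
Qed.

Lemma tensor_finite_dim : finite_dim T.
Proof.
case: Ffin => m [b hb]; exists m, (fun j => t (b j) one) => x.
have [f ->] := tensor_elim x; have [c ->] := hb f; exists c.
by rewrite t_sum; apply: eq_bigr => j _; rewrite tZ.
Qed.

Variables (n : nat) (I : 'I_n.+1 -> set F).
Hypothesis dec : ideal_decomposition I.

Let idI i : ideal (I i).
Proof. by case: dec => /(_ i)[_ ? ? ? ?] _; split. Qed.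

(** Placing w in slot i or in slot j gives two decompositions of w, which uniqueness identifies. *)
Let inter0 i j w : i != j -> I i w -> I j w -> w = 0.
Proof.
move=> ij Ii Ij; case: dec => _ /(_ w)[f0 [_ uniq]].
have single k : I k w -> f0 = [ffun l => if l == k then w else 0].
  move=> Ik; apply: uniq; split=> [l|].
    rewrite ffunE; case: eqP => [->|_] //; by case: (idI l).
  rewrite (bigD1 k) //= ffunE eqxx big1 ?addr0 // => l lk.
  by rewrite ffunE (negPf lk).
have := single i Ii; rewrite (single j Ij) => /ffunP/(_ i).
by rewrite !ffunE eqxx (negPf ij) => <-.
Qed.

(** F is represented by matrices to obtain units of its ideals; tensored with [one], they become the
    block units of T. *)
Lemma tensor_projections : exists e : 'I_n.+1 -> T,
  [/\ [/\ forall i, e i ** e i = e i, forall i j, i != j -> e i ** e j = 0,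
          forall i y, e i ** y = y ** e i & forall i, sa (e i)],
    forall y, \sum_i e i ** y = y &
    forall i y, e i ** y = y -> tensor_ideal t (I i) y].
Proof.
have [N [p [hom inj]]] := finite_dim_rep Ffin.
have [u uP] := choice (fun i => ideal_unit hom inj (idI i)).
have uu i j f : i != j -> I j f -> u i ** f = 0.
  move=> ij Jf; apply: (inter0 ij).
    by have [Ju _ _ _ _] := uP i; case: (idI i) => _ _ _ hr; exact: hr.
  by case: (idI j) => _ _ hl _; exact: hl.
exists (fun i => t (u i) one); split; first split.
- by move=> i; rewrite tM; have [Ju _ ul _ _] := uP i; rewrite ul.
- by move=> i j ij; rewrite tM (uu i j) ?t0 //; case: (uP j).
- move=> i y; have [f ->] := tensor_elim y; rewrite !tM.
  by have [_ _ _ _ ->] := uP i.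
- by move=> i; rewrite /sa t_star; have [_ -> _ _ _] := uP i.
- move=> y; have [f ->] := tensor_elim y.
  transitivity (t (\sum_i u i ** f) one).
    by rewrite t_sum; apply: eq_bigr => i _; rewrite tM.
  congr (t _ one); case: dec => _ /(_ f)[g [[Ig ->] _]].
  apply: eq_bigr => i _; rewrite cmul_sumr (bigD1 i) //= big1 ?addr0 => [|j ji].
    by have [_ _ ul _ _] := uP i; rewrite ul.
  by rewrite (uu i j) // eq_sym.
- move=> i y ey; have [f yf] := tensor_elim y.
  exists 1%N, (fun _ => u i ** f), (fun _ => one); split.
    by move=> _; have [Ju _ _ _ _] := uP i; case: (idI i) => _ _ _ hr; exact: hr.
  by rewrite big_ord1 -tM -yf ey.
Qed.

End Tensor.

(** * From approximate order zero to small images of zero products *)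

Section ApproxOrderZero.
Variables (R : realType) (T A : cstarAlgType R) (n : nat).
Variables (e : 'I_n -> T) (D : 'I_n -> set T) (G : set (T -> A)).
Local Notation C := R[i].
Hypothesis Gccp : forall f, G f -> ccp f.
Hypothesis eD : forall i y, e i ** y = y -> D i y.
Hypothesis Goz : forall (K : 'I_n -> set T) (d : 'I_n -> C),
  (forall i, compact (K i)) ->
  (forall i, K i `<=` D i `&` [set x | `|x| <= 1]) ->
  (forall i, 0 < d i) ->
  exists2 phi, G phi & forall i, approx_order0 (D i) phi (d i) (K i).

(** A product equal to zero has norm below every s, so the perturbed pair may be taken as close to
    x, y as desired. *)
Lemma approx_order0_zero (Dm K : set T) (f : T -> A) (d : R) (x y : T) :
  ccp f -> 0 < d -> approx_order0 Dm f d%:C K -> K x -> K y ->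
  nrm x <= 1 -> nrm y <= 1 -> x ** y = 0 -> nrm (f x ** f y) <= 2 * d.
Proof.
move=> cf d0 ao Kx Ky x1 y1 xy.
(* The cap 1 keeps |f a| <= 2; the two errors then add up to at most 3 s / 2 <= d. *)
pose s := Num.min 1 (d / 2).
have s0 : 0 < s by rewrite lt_min ltr01 divr_gt0.
have s1 : s <= 1 by rewrite ge_min lexx.
have sd : s <= d / 2 by rewrite ge_min lexx orbT.
have s0' : 0 < s%:C :> C by rewrite ltcR.
have [|a [b [_ _ ax by_ ab]]] := ao _ x y s0' Kx Ky; first by rewrite xy normr0.
have s2 : s%:C / 2 = (s / 2)%:C :> C by rewrite rmorphM fmorphV rmorph_nat.
move: ax by_ ab; rewrite s2 !nrmE !lecR ltcR => ax by_ ab.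
have fa : nrm (f x - f a) <= s / 2.
  by rewrite -(linB (ccp_lin cf)) (le_trans (ccp_nrm _ cf)) // nrmBC.
have fb : nrm (f y - f b) <= s / 2.
  by rewrite -(linB (ccp_lin cf)) (le_trans (ccp_nrm _ cf)) // nrmBC.
have -> : f x ** f y = f a ** f b + ((f x - f a) ** f y + f a ** (f y - f b)).
  by rewrite cmulBl cmulBr addrC -addrA subrK subrK.
have fy1 : nrm (f y) <= 1 by rewrite (le_trans (ccp_nrm _ cf)).
have fa1 : nrm (f a) <= 1 + s / 2.
  rewrite -[f a](subKr (f x)) (le_trans (nrmB _ _)) // lerD //.
  by rewrite (le_trans (ccp_nrm _ cf)).
have h1 := nrmM_le fa fy1; have h2 := nrmM_le fa1 fb.
have h3 := nrmD (f a ** f b) ((f x - f a) ** f y + f a ** (f y - f b)).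
have h4 := nrmD ((f x - f a) ** f y) (f a ** (f y - f b)).
have h5 : (1 + s / 2) * (s / 2) <= 2 * (s / 2) by rewrite ler_wpM2r //; lra.
lra.
Qed.

Lemma oz_from_approx (s : seq ('I_n * T * T)) (d : R) :
  (forall t, t \in s -> zero_pair e t) -> 0 < d -> exists2 f, G f & small_on s d f.
Proof.
move=> sz d0.
pose b := 1 + \sum_(t <- s) (nrm t.1.2 + nrm t.2).
have b1 : 1 <= b.
  by rewrite lerDl; apply: sumr_ge0 => t _; rewrite addr_ge0 ?nrm_ge0.
have b0 : 0 < b := lt_le_trans ltr01 b1.
have tb t : t \in s -> nrm t.1.2 <= b /\ nrm t.2 <= b.
  move=> ts; have : nrm t.1.2 + nrm t.2 <= \sum_(t <- s) (nrm t.1.2 + nrm t.2).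
    rewrite (big_rem t ts) /= lerDl; apply: sumr_ge0 => w _.
    by rewrite addr_ge0 ?nrm_ge0.
  by have := nrm_ge0 t.1.2; have := nrm_ge0 t.2; rewrite /b; lra.
pose sc (x : T) := b^-1%:C *: x.
have nsc x : nrm (sc x) = b^-1 * nrm x.
  by rewrite nrmZr ger0_norm // invr_ge0 ltW.
have sc1 x : nrm x <= b -> nrm (sc x) <= 1.
  by move=> xb; rewrite nsc mulrC ler_pdivrMr // mul1r.
pose K i : set T := [set w | exists t, [/\ t \in s, t.1.1 = i & w = sc t.1.2 \/ w = sc t.2]].
(* The 2 compensates the loss in [approx_order0_zero], and b^2 the scaling of both factors into the
   unit ball. *)
have [|i|i|f Gf fK] := @Goz K (fun=> (d / (2 * b ^+ 2))%:C).
- move=> i; apply: finite_compact.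
  apply: (@sub_finite_set _ _ [set` [seq sc t.1.2 | t <- s] ++ [seq sc t.2 | t <- s]]).
    move=> w [t [ts _ [->|->]]] /=; rewrite mem_cat; apply/orP; [left|right];
      by apply/mapP; exists t.
  exact: finite_seq.
- move=> w [t [ts ti wt]]; have [xb yb] := tb t ts; have [/= ex ey _] := sz t ts.
  rewrite ti in ex ey.
  split; last by rewrite /= nrmE lecR; case: wt => ->; exact: sc1.
  by apply: eD; case: wt => ->; rewrite /sc cmulZr ?ex ?ey.
- by rewrite ltcR divr_gt0 // mulr_gt0 ?exprn_gt0.
exists f => // t ts; have [xb yb] := tb t ts; have [_ _ xy] := sz t ts.
have le : nrm (f (sc t.1.2) ** f (sc t.2)) <= 2 * (d / (2 * b ^+ 2)).
  apply: (approx_order0_zero (Gccp Gf) _ (fK t.1.1)).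
  - by rewrite divr_gt0 // mulr_gt0 ?exprn_gt0.
  - by exists t; split => //; left.
  - by exists t; split => //; right.
  - exact: sc1.
  - exact: sc1.
  - by rewrite /sc cmulZl cmulZr xy !scaler0.
have lf := ccp_lin (Gccp Gf).
move: le; rewrite /sc !(linZ lf) cmulZl cmulZr !nrmZr ger0_norm ?invr_ge0 ?(ltW b0) //.
move: (nrm _) => c.
have -> : 2 * (d / (2 * b ^+ 2)) = b^-1 * (b^-1 * d).
  by field; rewrite gt_eqF.
by rewrite !ler_pM2l ?invr_gt0.
Qed.

End ApproxOrderZero.

Section Padding.
Local Open Scope sesquilinear_scope.
Variables (R : realType) (T : cstarAlgType R).
Local Notation C := R[i].

(** Quasidiagonality asks for matrices of positive size; padding with a zero row and column covers T
    = 0. *)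
Lemma finite_dim_rep_pos : finite_dim T ->
  exists N (p : T -> opmx R N.+1), star_hom p /\ injective p.
Proof.
move=> /finite_dim_rep[N [p [hom inj]]].
pose q (x : T) : opmx R N.+1 := block_mx (0 : 'M[C]_1) 0 0 (p x : 'M[C]_N) : 'M[C]_(1 + N).
have qinj : injective q.
  move=> x y e; have : block_mx (0 : 'M[C]_1) 0 0 (p x : 'M[C]_N) =
    block_mx (0 : 'M[C]_1) 0 0 (p y : 'M[C]_N) := e.
  by move=> /eq_block_mx[_ _ _ /inj].
exists N, q; split=> //.
pose pad (L : 'M[C]_N) : 'M[C]_(1 + N) := block_mx 0 0 0 L.
have padD (z : C) L L' : z *: pad L + pad L' = pad (z *: L + L').
  by rewrite /pad scale_block_mx add_block_mx !scaler0 !addr0.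
have padM L L' : pad L *m pad L' = pad (L *m L').
  by rewrite /pad mulmx_block !mulmx0 !mul0mx !addr0 add0r.
have pads L : (pad L)^t* = pad (L^t*).
  by rewrite /pad tr_block_mx map_block_mx !trmx0 !map_mx0.
split=> [z x y|x y|x].
- by rewrite /q (homD hom) (homZ hom); exact: esym (padD _ _ _).
- by rewrite opmx_mulE /q (homM hom) opmx_mulE; exact: esym (padM _ _).
- by rewrite opmx_starE /q (hom_star hom) opmx_starE; exact: esym (pads _).
Qed.

End Padding.

(** * Almost multiplicative maps *)

(** On products the star is preserved by [schwarz_identity], and a ** x approximates a. *)
Lemma ccp_star (R : realType) (A B : cstarAlgType R) (f : A -> B) a :
  matrix_normed A -> ccp f -> f a^# = (f a)^#.
Proof.
move=> nA cf; have lf := ccp_lin cf; apply/eqP; rewrite -subr_eq0; apply/eqP.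
apply: nrm_le0_eq0; apply/ler_addgt0Pr => e e0; rewrite add0r.
have e20 : 0 < e / 2 by rewrite divr_gt0.
have [x x1 ax] := approx_unit nA a e20.
have [d [gE _]] := schwarz_identity cf.1 a^# x.
rewrite cstarK in gE.
have -> : f a^# - (f a)^# = f (a^# - (a ** x)^#) - (f (a - a ** x))^#.
  rewrite !(linB lf) cstarB opprB addrA; congr (_ - _).
  by rewrite cstarM gE cstarK subrK.
rewrite (le_trans (nrmB _ _)) // [leRHS]splitr nrm_star lerD //.
  by rewrite (le_trans (ccp_nrm _ cf)) // -cstarB nrm_star.
by rewrite (le_trans (ccp_nrm _ cf)).
Qed.

Section Polarization.
Variables (R : realType) (A B : cstarAlgType R) (f : A -> B).
Local Notation C := R[i].
Hypothesis lf : linear f.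

Let S u v := f (u ** v^#) - f u ** (f v)^#.

Let SDl u u' v : S (u + u') v = S u v + S u' v.
Proof. by rewrite /S cmulDl !(linD lf) cmulDl opprD addrACA. Qed.

Let SZl (z : C) u v : S (z *: u) v = z *: S u v.
Proof. by rewrite /S cmulZl !(linZ lf) cmulZl scalerBr. Qed.

Let SDr u v v' : S u (v + v') = S u v + S u v'.
Proof. by rewrite /S cstarD cmulDr !(linD lf) cstarD cmulDr opprD addrACA. Qed.

Let SZr (z : C) u v : S u (z *: v) = conjc z *: S u v.
Proof. by rewrite /S cstarZ cmulZr !(linZ lf) cstarZ cmulZr scalerBr. Qed.

Let S_expand (z w : C) u v : conjc z = w -> z * w = 1 ->
  S (u + z *: v) (u + z *: v) = S u u + S v v + (w *: S u v + z *: S v u).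
Proof.
move=> wE zw; rewrite SDl !SDr !SZl !SZr wE scalerA zw scale1r.
by rewrite (addrC (z *: _)) addrACA.
Qed.

(* 4 S a v is the sum of i^k S (a + i^k v) (a + i^k v) over k < 4. *)
Lemma polarization (a b : A) (m : R) :
  f b^# = (f b)^# ->
  (forall z : C, z \in [:: 1; -1; 'i%C; - 'i%C] ->
     nrm (S (a + z *: b^#) (a + z *: b^#)) <= m) ->
  nrm (f (a ** b) - f a ** f b) <= m.
Proof.
move=> fb h.
have Sab : f (a ** b) - f a ** f b = S a b^# by rewrite /S fb !cstarK.
rewrite Sab; move: (b^#) h => v h.
have i2 : 'i%C * 'i%C = -1 :> C by rewrite -expr2 sqr_i.
have n1 : conjc (-1 : C) = -1 by rewrite rmorphN rmorph1.
have ci : conjc ('i%C : C) = - 'i%C by apply/eqP; rewrite eq_complex /= oppr0 !eqxx.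
have cni : conjc (- 'i%C : C) = 'i%C.
  by apply/eqP; rewrite eq_complex /= !oppr0 !opprK !eqxx.
have h1 := h 1 (mem_head _ _).
have h2 : nrm (S (a + -1 *: v) (a + -1 *: v)) <= m by apply: h; rewrite !inE eqxx orbT.
have h3 : nrm (S (a + 'i%C *: v) (a + 'i%C *: v)) <= m by apply: h; rewrite !inE eqxx !orbT.
have h4 : nrm (S (a + - 'i%C *: v) (a + - 'i%C *: v)) <= m by apply: h; rewrite !inE eqxx !orbT.
have E : 4%:R *: S a v = (S (a + 1 *: v) (a + 1 *: v) - S (a + -1 *: v) (a + -1 *: v)) +
    'i%C *: (S (a + 'i%C *: v) (a + 'i%C *: v) - S (a + - 'i%C *: v) (a + - 'i%C *: v)).
  rewrite (S_expand _ _ (rmorph1 _)) ?mulr1 // (S_expand _ _ n1) ?mulrNN ?mulr1 //.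
  rewrite (S_expand _ _ ci) ?mulrN ?i2 ?opprK // (S_expand _ _ cni) ?mulNr ?i2 ?opprK //.
  set s := S a a + S v v; set p := S a v; set q := S v a.
  have D (x y : B) : s + x - (s + y) = x - y by rewrite opprD addrACA subrr add0r.
  have lc (x y x' y' : C) : x *: p + y *: q - (x' *: p + y' *: q) =
      (x - x') *: p + (y - y') *: q by rewrite opprD addrACA !scalerBl.
  rewrite !D !lc; clearbody p q; rewrite scalerDr !scalerA addrACA -!scalerDl.
  have -> : 1 - -1 + 'i%C * ('i%C - - 'i%C) = 0 :> C.
    by rewrite !opprK mulrDr i2; ring.
  have -> : 1 - -1 + 'i%C * (- 'i%C - 'i%C) = 4%:R :> C.
    by rewrite !opprK mulrBr mulrN i2; ring.
  by rewrite scale0r addr0.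
have : nrm (4%:R *: S a v) <= 4%:R * m.
  rewrite E (le_trans (nrmD _ _)) // nrmZ nrmci mul1r.
  apply: le_trans (lerD (nrmB _ _) (nrmB _ _)) _; lra.
have -> : (4%:R : C) = (4%:R)%:C by rewrite rmorph_nat.
by rewrite nrmZr ger0_norm // ler_pM2l.
Qed.

End Polarization.

Section Approximation.
Variables (R : realType) (U : cstarAlgType R) (one : U) (X : character one).
Variables (A : cstarModType U) (n : nat).
Local Notation C := R[i].
Hypothesis dr : module_dr_le A n.

(** Since f is contractive and f (psi a) is close to a, psi loses little norm; the representation of
    T loses none. *)
Lemma dr_matrix_normed : matrix_normed A.
Proof.
move=> a e e0; have e0c : 0 < e%:C by rewrite ltcR.
have [F [T [t [psi [G [I [[ffin tens cpsi _] [[f Gf] Gmod app _ _]]]]]]]] :=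
  dr (finite_set1 a) e0c.
have [N [p [hom inj]]] := finite_dim_rep_pos (tensor_finite_dim X ffin tens).
exists N.+1, (fun a => p (psi a)); split.
  by apply: (ccp_comp cpsi); apply: (ccp_hom hom) => y; exact: rep_nrm_le.
rewrite (rep_nrm hom inj); have [cf _] := Gmod _ Gf.
have : nrm (f (psi a) - a) < e by have := app f a Gf erefl; rewrite nrmE ltcR.
have := nrmD (f (psi a)) (- (f (psi a) - a)); rewrite nrmN opprB addrC subrK.
by have := ccp_nrm (psi a) cf; lra.
Qed.

(** Provides the hypothesis [consts] of the cut: its left side is linear in eta, with coefficient
    [K]. *)
Lemma small_constant (k M gam kap : R) : 0 <= k -> 0 <= M -> 0 < gam -> 0 < kap ->
  exists2 eta, 0 < eta <= kap &
    n.+1%:R * (2 * (k * ((1 + 2 * M) * eta) / gam)) * M ^+ 2 <= kap ^+ 2.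
Proof.
move=> k0 M0 g0 kap0; pose K := n.+1%:R * 2 * k * (1 + 2 * M) * M ^+ 2 / gam.
have K0 : 0 <= K.
  by rewrite divr_ge0 ?(ltW g0) // !mulr_ge0 ?exprn_ge0 // addr_ge0 // mulr_ge0.
have K1 : 0 < K + 1 by rewrite ltr_wpDl.
have k2 : 0 < kap ^+ 2 by rewrite exprn_gt0.
pose eta := Num.min kap (kap ^+ 2 / (K + 1)).
have eta0 : 0 < eta by rewrite lt_min kap0 divr_gt0.
exists eta; first by rewrite eta0 ge_min lexx.
have -> : n.+1%:R * (2 * (k * ((1 + 2 * M) * eta) / gam)) * M ^+ 2 = K * eta.
  by rewrite /K; field; rewrite gt_eqF.
have : eta <= kap ^+ 2 / (K + 1) by rewrite ge_min lexx orbT.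
rewrite ler_pdivlMr // mulrDr mulr1 mulrC; apply: le_trans; exact: ler_wpDr (ltW eta0) _.
Qed.

Lemma approx_hom (L : seq A) (eps : R) : 0 < eps ->
  exists N (f : A -> chimod X N.+1), [/\ ccp f, admissible f,
    forall a b, a \in L -> b \in L -> nrm (f (a ** b) - f a ** f b) <= eps &
    forall a, a \in L -> nrm a - eps <= nrm (f a)].
Proof.
move=> eps0; have kap0 : 0 < eps / 2 by rewrite divr_gt0.
pose zs : seq C := [:: 1; -1; 'i%C; - 'i%C].
(* Elements of L for the norm estimate, and the elements a + z b^# for polarization, since the cut
   controls only the defects at (c, c^#). *)
pose cs : seq A := L ++ [seq q.1 + z *: q.2^# | q <- [seq (a, b) | a <- L, b <- L], z <- zs].
pose M := \sum_(c <- cs) nrm c.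
have M0 : 0 <= M by apply: sumr_ge0 => c _; exact: nrm_ge0.
have csM c : c \in cs -> nrm c <= M.
  move=> cc; rewrite /M (big_rem c cc) /= lerDl.
  by apply: sumr_ge0 => b _; exact: nrm_ge0.
(* gam = eps bounds the defects; kap = eps / 2 and eta <= kap make the total loss of norm at most
   eps. *)
have [eta /andP[eta0 etak] consts] :=
  small_constant (ler0n _ (size cs).+1) M0 eps0 kap0.
have eta0c : 0 < eta%:C by rewrite ltcR.
pose S := cs ++ [seq c ** c^# | c <- cs].
have [F [T [t [psi [G [I [[ffin tens cpsi apsi] [Gne Gmod app dec oz]]]]]]]] :=
  dr (finite_seq S) eta0c.
have [N [p [hom inj]]] := finite_dim_rep_pos (tensor_finite_dim X ffin tens).
have [e [[ei eo ec es] esum eD]] := tensor_projections X ffin tens dec.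
have Gccp f : G f -> ccp f by move=> /Gmod[].
have Goz := oz_from_approx Gccp eD oz.
have approx f c : G f -> c \in cs ->
    nrm (f (psi c) - c) <= eta /\ nrm (f (psi (c ** c^#)) - c ** c^#) <= eta.
  move=> Gf cc; have h a : a \in S -> nrm (f (psi a) - a) <= eta.
    by move=> aS; have := app f a Gf aS; rewrite nrmE ltcR => /ltW.
  split; apply: h; rewrite mem_cat ?cc //; apply/orP; right.
  by apply/mapP; exists c.
have [pr [prh prn prx prc]] := cut_hom hom inj ei eo ec es esum Gccp Goz
  dr_matrix_normed cpsi eta0 eps0 (ltW kap0) M0 csM approx consts.
pose f : A -> chimod X N.+1 := fun a => pr (psi a).
have cpr : ccp (pr : T -> chimod X N.+1) := ccp_hom prh prn.
exists N, f; split.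
- exact: (ccp_comp cpsi cpr).
(* [pr] respects the action because U acts by scalars on both sides. *)
- apply: (admissible_comp apsi); apply: admissible_module; first by case: cpr.
  split; first exact: ccp_lin cpr.
    exact: (contractive_continuous (ccp_lin cpr)).
  by move=> a u; rewrite (act_tensor X tens) (homZ prh).
- move=> a b aL bL; have cf := ccp_comp cpsi cpr.
  apply: (polarization (f := f) (ccp_lin cf)).
    exact: (ccp_star _ dr_matrix_normed cf).
  move=> z zz; have := prx (a + z *: b^#); rewrite /f (homB prh) (homM prh) (hom_star prh); apply.
  rewrite mem_cat; apply/orP; right; apply/allpairsP; exists ((a, b), z); split => //.
  by apply/allpairsP; exists (a, b).
- move=> a aL; have := prc a; rewrite mem_cat aL => /(_ isT); rewrite /f; lra.
Qed.

End Approximation.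

Section Unit.
Variables (R : realType) (U : cstarAlgType R) (one : U) (A : cstarModType U) (n : nat).
Hypothesis oner : forall u, u ** one = u.

Lemma act_tensor_one (F : cstarAlgType R) (T : cstarModType U) (t : F -> U -> T) (x : T) :
  is_tensor t -> act x one = x.
Proof.
move=> [[_ _ _ _ tact] [span _]]; have [m [f [u ->]]] := span x.
rewrite (big_morph (fun y : T => act y one) (fun y z => actDl y z one) (act0l T one)).
by apply: eq_bigr => j _; rewrite tact oner.
Qed.

(** f (psi a) is fixed by [one] as f is a module map, so only the small difference f (psi a) - a
    contributes. *)
Lemma act_one (a : A) : module_dr_le A n -> act a one = a.
Proof.
move=> dr; apply/eqP; rewrite -subr_eq0; apply/eqP; apply: nrm_le0_eq0.
apply/ler_addgt0Pr => e e0; rewrite add0r.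
have o0 : 0 < nrm one + 1 by rewrite ltr_wpDl ?nrm_ge0.
have d0 : 0 < e / (nrm one + 1) by rewrite divr_gt0.
have d0c : 0 < (e / (nrm one + 1))%:C by rewrite ltcR.
have [F [T [t [psi [G [I [[_ tens _ _] [[f Gf] Gmod app _ _]]]]]]]] :=
  dr _ _ (finite_set1 a) d0c.
have [_ [_ _ fact]] := Gmod _ Gf.
have : nrm (f (psi a) - a) < e / (nrm one + 1).
  by have := app f a Gf erefl; rewrite nrmE ltcR.
rewrite ltr_pdivlMr // => h.
have -> : act a one - a = (f (psi a) - a) - act (f (psi a) - a) one.
  by rewrite actBl -fact (act_tensor_one _ tens) opprB [RHS]addrC addrA subrK.
apply: le_trans (nrmB _ _) _; apply: le_trans _ (ltW h).
by rewrite mulrDr mulr1 addrC lerD2r; exact: nrm_act.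
Qed.

End Unit.

Section Trivial.
Variables (R : realType) (U : cstarAlgType R) (A : cstarModType U).

Lemma trivial_quasidiagonal : (forall a : A, a = 0) -> module_quasidiagonal A.
Proof.
move=> A0; exists unit, (fun _ _ => True), (fun _ => 1%N), (fun _ => regmod U),
  (fun _ => @reg_iota R U), (fun _ _ => 0).
have lin0 : linear (fun _ : A => 0 : regmod U) by move=> z a b; rewrite scaler0 addr0.
have cp0 : completely_positive (fun _ : A => 0 : regmod U).
  split=> // m M; exists 0; apply/matrixP => i j; rewrite !mxE big1 // => k _.
  by rewrite !mxE cmul0r.
split; first by split=> //; exists tt.
split.
- by move=> _; split => //; exact: reg_matrix_algebra.
- move=> _; split; first by split=> // a; rewrite normr0.
  apply: admissible_module => //; split => //; last by move=> a u; rewrite act0l.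
  exact: cst_continuous.
- by move=> a b e e0; exists tt => _ _; rewrite cmul0r !subr0 !normr0.
- by move=> a e e0; exists tt => _ _; rewrite (A0 a) !normr0 subr0 normr0.
Qed.

End Trivial.

Section Net.
Variables (R : realType) (U : cstarAlgType R) (one : U) (X : character one).
Variables (A : cstarModType U) (n : nat).
Hypothesis dr : module_dr_le A n.

Lemma character_quasidiagonal : module_quasidiagonal A.
Proof.
have c0 (j : seq A * nat) : 0 < (j.2.+1%:R)^-1 :> R by rewrite invr_gt0 ltr0n.
have ap (j : seq A * nat) := cid (approx_hom X dr j.1 (c0 j)).
pose k j := sval (ap j); pose phi j := sval (cid (svalP (ap j))).
have phiP j := svalP (cid (svalP (ap j))).
(* An index is a finite part of A with the tolerance 1 / (j.2 + 1). *)
pose le (i j : seq A * nat) : Prop := {subset i.1 <= j.1} /\ (i.2 <= j.2)%N.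
have archi (e : R) : 0 < e -> exists m : nat, forall j : seq A * nat,
    (m <= j.2)%N -> (j.2.+1%:R)^-1 < e.
  move=> e0; have [m hm] := nat_inv ler01 (divr_gt0 e0 (ltr0n R 2)).
  exists m => j mj; apply: (@le_lt_trans _ _ (e / 2)); last first.
    by rewrite ltr_pdivrMr // mulr_natr mulr2n ltrDl.
  apply: le_trans hm.
  by rewrite mul1r lef_pV2 ?posrE ?ltr0n // ler_nat.
exists (seq A * nat)%type, le, (fun j => (k j).+1), (fun j => chimod X (k j).+1),
  (fun j => @chi_iota R U one X (k j).+1), phi.
split.
  split.
  - exact: (inhabits ([::], 0%N)).
  - by move=> j; split.
  - move=> i j l [s1 m1] [s2 m2]; split; last exact: leq_trans m1 m2.
    by move=> x /s1 /s2.
  - move=> i j; exists (i.1 ++ j.1, maxn i.2 j.2); split; split=> /=.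
    + by move=> x xi; rewrite mem_cat xi.
    + exact: leq_maxl.
    + by move=> x xj; rewrite mem_cat xj orbT.
    + exact: leq_maxr.
split.
- by move=> j; split=> //; exact: chi_matrix_algebra.
- by move=> j; have [] := phiP j.
- move=> a b e /gt0_ReE[eE e0]; have [m hm] := archi _ e0.
  exists ([:: a; b], m) => j [sj mj]; have [_ _ h _] := phiP j.
  rewrite subr0 normr_id nrmE eE ltcR (le_lt_trans (h a b _ _)) ?hm //.
    by apply: sj; rewrite inE eqxx.
  by apply: sj; rewrite !inE eqxx orbT.
- move=> a e /gt0_ReE[eE e0]; have [m hm] := archi _ e0.
  exists ([:: a], m) => j [sj mj]; have [cf _ _ h] := phiP j.
  have := h a (sj _ (mem_head _ _)); have := ccp_nrm a cf => le1 le2.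
  rewrite !nrmE -rmorphB /= nrm_real eE ltcR distrC ger0_norm ?subr_ge0 //.
  by apply: le_lt_trans (hm j mj); rewrite lerBlDr addrC -lerBlDr.
Qed.

End Net.

Theorem theorem2p23 (R : realType) (U : cstarAlgType R)
    (U_unital : unital U) (U_simple : simple_cstar U)
    (A : cstarModType U) (A_separable : separable_cstar A)
    (act_star : forall (a : A) (u : U),
       cstar (act a u) = act (cstar a) (cstar u))
    (A_dr : (module_dr A < +oo)%E) :
  module_quasidiagonal A.
Proof.
(* The infimum of the empty set is +oo, so finiteness yields some n. *)
have [n dr] : exists n, module_dr_le A n.
  apply: contrapT => no; move: A_dr; rewrite /module_dr.
  have -> : [set n%:R%:E | n in [set n | module_dr_le A n]] = set0 :> set (\bar R).
    by rewrite -subset0 => x [n dr _]; apply: no; exists n.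
  by rewrite ereal_inf0 ltxx.
have [one oneP] := U_unital.
have onel u : one ** u = u by case: (oneP u).
have oner u : u ** one = u by case: (oneP u).
have [ann|ann] := U_simple.2 _ (annihilator_ideal A); last first.
  apply: trivial_quasidiagonal => a; rewrite -(act_one oner a dr).
  by have : [set u : U | forall a : A, act a u = 0] one by rewrite ann.
have comm (u v : U) : u ** v = v ** u.
  apply/eqP; rewrite -subr_eq0; apply/eqP.
  have ann0 w : (forall a : A, act a w = 0) -> w = 0.
    by move=> aw; have : [set w : U | forall a : A, act a w = 0] w := aw; rewrite ann.
  by apply: ann0 => a; exact: act_commutator.
have scal (u : U) := cid (simple_comm_scalar onel comm U_simple u).
have one0 : one != 0.
  apply/eqP => one0; have [[b /eqP b0] _] := U_simple.
  by apply: b0; rewrite -(onel b) one0 cmul0l.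
pose chi u := sval (scal u).
have chiE u : u = chi u *: one := svalP (scal u).
have chi_scale z : chi (z *: one) = z.
  apply/eqP; rewrite -subr_eq0; have : (chi (z *: one) - z) *: one = 0.
    by rewrite scalerBl -chiE subrr.
  by move=> /eqP; rewrite scaler_eq0 (negbTE one0) orbF.
exact: (character_quasidiagonal (Character chiE chi_scale onel oner one0) dr).
Qed.
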